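(* Let $a\ge 4$ be even and let $b>a$ be odd. Then $$\rho^*(\alpha)=\begin{cases}\delta_0,& \text{if } b=a+1,\ b=a+3,\ \text{or } b\ge 2a-3,\\ \delta_{-2},&\text{if } a+5\le b\le 2a-5.\end{cases}$$ Moreover the sequence $(\delta_k)_{k\ge 0}$ is strictly decreasing with limit $$\delta_\infty:=\Big(1-\beta-\frac{\beta(1-D)(1+2D^2)}{1+D^2}\Big)\Big(1-\eta-\frac{D(1-D)}{1+D^2}\Big),$$ and $$\mathcal L^*\cap(\delta_\infty,\infty)=\{\delta_{-1}\}\cup\{\delta_k:k\ge0\}\cup E,$$ where $E=\{\delta_{-2}\}$ if $a+3\le b\le 2a-3$ and $E=\emptyset$ otherwise.
   Context: Negative continued fractions: $[0;c_1,c_2,\dots]^-:=\cfrac{1}{c_1-\cfrac{1}{c_2-\cdots}}$. Fix integers $2\le a<b$ and set $\alpha=\eta:=[0;\overline{a,b}]^-=\tfrac12\big(b-\sqrt{b^2-4b/a}\big)$, $\beta:=[0;\overline{b,a}]^-=\tfrac12\big(a-\sqrt{a^2-4a/b}\big)$, $D:=\eta\beta$. For real $\gamma$, $M(\alpha,\gamma):=\liminf_{|n|\to\infty,\ n\in\mathbb Z}|n|\,\|n\alpha-\gamma\|$ ($\|x\|$ = distance from $x$ to the nearest integer) and $M^*(\alpha,\gamma):=4(1-D)M(\alpha,\gamma)$. Let $\mathcal L^*:=\{M^*(\alpha,\gamma):\gamma\in\mathbb R\setminus(\mathbb Z+\alpha\mathbb Z)\}$ and $\rho^*(\alpha):=\max\mathcal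 L^*$. Expansions: to a bounded integer sequence $(b_i)_{i\ge1}$ associate $\gamma((b_i)):=\sum_{i\ge1}(b_{2i-1}\eta+b_{2i}D)D^{i-1}$; a block is a pair $(b_{2i-1},b_{2i})$. For a finite word $P$ of blocks, $\gamma_P$ is $\gamma((b_i))$ for the purely periodic sequence repeating $P$; $X^k$ denotes $k$ repetitions of $X$ ($X^0$ empty). Blocks (with $a$ even, $b$ odd, $t$ odd): $A_t=\big(\tfrac{a-2}{2},\tfrac{b-2+t}{2}\big)$, $A'_t=\big(\tfrac{a-2}{2},\tfrac{b-2-t}{2}\big)$, $C_t=\big(\tfrac{a-4}{2},\tfrac{b-2+t}{2}\big)$. Define $\delta_{-1}:=M^*(\alpha,\gamma_{A_1A_1A_1'A_1'})$, $\delta_{-2}:=M^*(\alpha,\gamma_{C_3})$, and for $k\ge0$, $\delta_k:=M^*(\alpha,\gamma_{A_1'A_1(A_1'A_1'A_1A_1)^k})$. *)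

(* Defs.v *)
From Stdlib Require Import Reals Lra Lia ZArith List ClassicalEpsilon.
Open Scope R_scope.

Definition eta (a b : Z) : R :=
  (IZR b - sqrt (IZR b ^ 2 - 4 * IZR b / IZR a)) / 2.
Definition beta (a b : Z) : R :=
  (IZR a - sqrt (IZR a ^ 2 - 4 * IZR a / IZR b)) / 2.
Definition Dc (a b : Z) : R := eta a b * beta a b.

Definition nint_dist (x : R) : R :=
  Rmin (x - IZR (Int_part x)) (IZR (Int_part x) + 1 - x).

Definition is_liminf_Z (f : Z -> R) (L : R) : Prop :=
  (forall eps, eps > 0 -> forall N : Z, exists n : Z,
      (N <= Z.abs n)%Z /\ f n < L + eps) /\
  (forall eps, eps > 0 -> exists N : Z, forall n : Z,
      (N <= Z.abs n)%Z -> L - eps < f n).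

Definition M (alpha gamma : R) : R :=
  epsilon (inhabits 0)
    (fun L => is_liminf_Z (fun n => Rabs (IZR n) * nint_dist (IZR n * alpha - gamma)) L).

Definition Mstar (a b : Z) (gamma : R) : R :=
  4 * (1 - Dc a b) * M (eta a b) gamma.

Definition Lstar (a b : Z) (x : R) : Prop :=
  exists gamma : R,
    ~ (exists p q : Z, gamma = IZR p + IZR q * eta a b) /\
    x = Mstar a b gamma.

Definition is_max (S : R -> Prop) (m : R) : Prop :=
  S m /\ forall y, S y -> y <= m.

(* gamma((b_i)) for a sequence of blocks: blk i = (b_{2i+1}, b_{2i+2}) (0-indexed) *)
Definition gamma_blocks (a b : Z) (blk : nat -> Z * Z) : R :=
  epsilon (inhabits 0)
    (fun g => infinite_sum
       (fun i => (IZR (fst (blk i)) * eta a b + IZR (snd (blk i)) * Dc a b)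
                 * Dc a b ^ i) g).

Definition gamma_word (a b : Z) (P : list (Z * Z)) : R :=
  gamma_blocks a b (fun i => nth (i mod length P)%nat P (0%Z, 0%Z)).

Definition blockA (a b t : Z) : Z * Z := (((a - 2) / 2)%Z, ((b - 2 + t) / 2)%Z).
Definition blockA' (a b t : Z) : Z * Z := (((a - 2) / 2)%Z, ((b - 2 - t) / 2)%Z).
Definition blockC (a b t : Z) : Z * Z := (((a - 4) / 2)%Z, ((b - 2 + t) / 2)%Z).

Definition delta_m1 (a b : Z) : R :=
  Mstar a b (gamma_word a b
    (blockA a b 1 :: blockA a b 1 :: blockA' a b 1 :: blockA' a b 1 :: nil)).
Definition delta_m2 (a b : Z) : R :=
  Mstar a b (gamma_word a b (blockC a b 3 :: nil)).
Definition delta (a b : Z) (k : nat) : R :=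
  Mstar a b (gamma_word a b
    (blockA' a b 1 :: blockA a b 1 ::
     concat (repeat (blockA' a b 1 :: blockA' a b 1 :: blockA a b 1 :: blockA a b 1 :: nil) k))).

Definition delta_inf (a b : Z) : R :=
  let D := Dc a b in
  (1 - beta a b - beta a b * (1 - D) * (1 + 2 * D ^ 2) / (1 + D ^ 2)) *
  (1 - eta a b - D * (1 - D) / (1 + D ^ 2)).

(* Main.v *)
Require Import Defs.
From Stdlib Require Import Reals ZArith List Lra Lia Psatz Classical ClassicalEpsilon.
Open Scope R_scope.

(** Write [h = eta], [k = beta], [D = h k], so that [a h = b k = 1 + D]. For a point [gamma = (1 - h + X) / 2]
    and an arbitrary [Y], the products [n * ||n eta - gamma||] are asymptotically the products
    [Pr h k X Y p q] of the two coordinates of the points of a planar grid, up to the factor [4 (1 - D)].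
    Passing one digit of the expansion is a unimodular change of the indices [(p, q)] which leaves these products
    invariant, so only the corners [(0,0)], [(0,-1)], [(-1,0)], [(-1,-1)] of each of the successive cells matter.

    If the liminf exceeds [delta_inf], then the corner inequalities of consecutive cells force the digit pairs
    (twice the centred digits) to be eventually all [(0, 1)] or [(0, -1)], or constantly [(-2, 3)] or [(2, -3)].
    In the first case the remaining signs are governed by a pair of power series in [D], one forward and one
    backward, and comparison with [delta_inf] leaves three possibilities for the sign sequence: it alternates,
    it is made of blocks of two equal signs, or between two consecutive occurrences of a pair of single signs
    there is always the same even number of such blocks of length two.

    Conversely, for a two-sided sequence, every grid point has a product at least as large as the smallest corner
    product: the point is moved from cell to cell until its indices have opposite signs or are locally minimal,
    and on a segment between two corners the product is a concave function. *)

(** * Local inequalities *)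

(** Since [D = h k], the decisive estimates set a power [D^(j+1)] against [k D^j]; the ratio [h], at
    most 0.264, is the margin that absorbs the truncation of the series. The bounds come from the
    extreme pair [a = 4], [b = 5]: [20 D <= (1 + D)^2] gives [D <= 0.056], whence [h <= 1.056 / 4]
    and [k <= 1.056 / 5].

    The thresholds in the theorem have one source: [(1 + D)(h - k) = (b - a) D] and
    [(1 + D)(2 k - h) = (2 a - b) D]. Counting [h], [k] as first order, two corners of the constant
    word exceed [delta_inf] by [2 (b - a - 3) D] and [2 (2 a - b - 3) D] up to third order, and
    [delta 0] by the same with 4 in place of 3. Both differences are odd, so 4 is never met; at 3
    the third-order terms decide.

    Only the forward expansion matters for the liminf, because changing [Y] alters a product by a
    multiple of its small coordinate. So the classification needs only a tail of [X], and the lower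
    bounds may choose the [Y] that completes it to a two-sided periodic sequence. *)

Record adm (h k : R) : Prop := {
  adm_k : 0 < k;
  adm_h : 0 < h;
  adm_4 : 4 * h <= 1 + h * k;
  adm_5 : 5 * k <= 1 + h * k;
  adm_hk : h * k <= (1 + h * k) * (h - k);
  adm_D : h * k <= 56 / 1000 }.

Lemma adm_bounds h k : adm h k ->
  0 < k /\ 0 < h /\ h <= 264 / 1000 /\ k <= 2112 / 10000 /\ 0 < h * k <= 56/1000 /\
  h * k - (h * k) * (h * k) <= h - k /\ k < h.
Proof.
  intros [Hk Hh H4 H5 Hhk HD].
  assert (HD0 : 0 < h * k) by (apply Rmult_lt_0_compat; lra).
  assert (h * k - (h * k) * (h * k) <= h - k) by nra.
  repeat split; try lra; nra.
Qed.

(** A lower estimate of [limit_value], from [ws D <= 1 + D] and the omission of a positive term of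
    order [k D]. It is free of series and still strong enough to eliminate digits. *)
Definition crude_bound (h k : R) : R := (1 - 2 * k) * (1 - h - h * k).

(** The corner products with their signs resolved; [cor1] to [cor4] belong to the indices (0,0),
    (0,-1), (-1,0), (-1,-1). The last two fields place one corner in each open quadrant. *)
Record corners (h k X Y c : R) : Prop := {
  cor1 : c < (1 - h + X) * (1 - k + Y);
  cor2 : c < (1 + h + X) * (1 + k - Y);
  cor3 : c < (1 + h - X) * (1 + k + Y);
  cor4 : c < (1 - h - X) * (1 - k - Y);
  corX : - (1 - h) < X < 1 - h;
  corY : - (1 - k) < Y < 1 - k }.

Lemma corners_neg h k X Y c : corners h k X Y c -> corners h k (- X) (- Y) c.
Proof. intros [H1 H2 H3 H4 HX HY]; split; nra || lra. Qed.

(** Adding [cor1] to [cor2], and [cor3] to [cor4], cancels the terms [X Y] and leaves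
    [|X - h Y| < 1 + D - c < 3 h] in both cells; the two quantities [X - h Y] add up to [2 h T]. *)
Lemma T_bound h k X0 Y0 X1 Y1 T : adm h k ->
  corners h k X0 Y0 (crude_bound h k) -> corners h k X1 Y1 (crude_bound h k) ->
  X0 = h * (T + Y1) -> X1 = h * (T + Y0) -> -4 < T < 4.
Proof.
  intros A [H1 H2 H3 H4 _ _] [K1 K2 K3 K4 _ _] E0 E1.
  destruct (adm_bounds _ _ A) as (Hk & Hh & Hh' & Hk' & HD & Hd & Hhk).
  assert (Hc : 1 + h * k - crude_bound h k < 3 * h) by (unfold crude_bound; nra).
  assert (-(3*h) < X0 - h * Y0 < 3*h) by (split; lra).
  assert (-(3*h) < X1 - h * Y1 < 3*h) by (split; lra).
  assert (2 * h * T = (X0 - h * Y0) + (X1 - h * Y1)) by (subst; ring).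
  assert (- (3 * h) < h * T < 3 * h) as [Ha Hb] by lra.
  clear - Ha Hb Hh. split; nra.
Qed.

Lemma T0_bound_aux h k Y0 Y1 : adm h k ->
  corners h k (h * Y1) Y0 (crude_bound h k) -> corners h k (h * Y0) Y1 (crude_bound h k) ->
  Y1 < (2 + h) * k.
Proof.
  intros A [H1 H2 H3 H4 _ HY0] [K1 K2 K3 K4 _ HY1].
  destruct (adm_bounds _ _ A) as (Hk & Hh & Hh' & Hk' & HD & Hd & Hhk).
  unfold crude_bound in *.
  assert (Hc : (1-h)*(1-k) - (1 - 2 * k) * (1 - h - h * k) <= k) by nra.
  (* [Q0] bounds whichever ordinate is larger in modulus; the three cases below only decide whether
     that is [Y1], [-Y0] or [Y0]. *)
  assert (Q0 : forall Y Z, 0 <= Y < 1 - k -> - Y <= Z <= Y -> 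
     (1 - 2 * k) * (1 - h - h * k) < (1 - h - h * Z) * (1 - k - Y) -> Y < (2+h)*k).
  { intros Y Z HY HZ HH.
    assert ((1-h)*Y + (1-k-Y)*h*Z < k) by lra.
    assert (0 <= (1-k-Y)*h*(Z+Y)) by (apply Rmult_le_pos; [apply Rmult_le_pos|]; lra).
    assert (0 <= h*(Y*Y)) by (apply Rmult_le_pos; [|apply Rle_0_sqr]; lra).
    assert (Y * (1 - 2*h + h*k) < k) by lra.
    assert (1 <= (2+h) * (1 - 2*h + h*k)).
    { pose proof (adm_4 _ _ A). assert (h * h <= 264/1000*(264/1000)) by (apply Rmult_le_compat; lra).
      assert (0 < h * (h*k)) by (apply Rmult_lt_0_compat; lra). lra. }
    assert (k * 1 <= k * ((2+h) * (1 - 2*h + h*k))) by (apply Rmult_le_compat_l; lra).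
    destruct (Rlt_le_dec Y ((2+h)*k)); [assumption|].
    assert (Hp : 0 < 1 - 2*h + h*k) by lra.
    apply (Rmult_lt_reg_r (1 - 2*h + h*k)); lra. }
  destruct (Rlt_le_dec Y1 0); [nra|].
  destruct (Rle_dec Y0 Y1); [destruct (Rle_dec (-Y1) Y0)|].
  - apply (Q0 Y1 Y0); lra.
  -
    assert (- Y0 < (2+h)*k); [|lra].
    apply (Q0 (-Y0) (-Y1)); lra.
  - assert (Y0 < (2+h)*k); [|lra].
    apply (Q0 Y0 Y1); lra.
Qed.

Lemma T0_bound h k Y0 Y1 : adm h k ->
  corners h k (h * Y1) Y0 (crude_bound h k) -> corners h k (h * Y0) Y1 (crude_bound h k) ->
  - ((2 + h) * k) < Y1 < (2 + h) * k.
Proof.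
  intros A H0 H1. split; [|eapply T0_bound_aux; eauto].
  apply corners_neg in H0, H1.
  assert (- Y1 < (2 + h) * k); [|lra].
  apply (T0_bound_aux h k (- Y0) (- Y1) A).
  - replace (h * - Y1) with (- (h * Y1)) by ring; assumption.
  - replace (h * - Y0) with (- (h * Y0)) by ring; assumption.
Qed.

(** With digit -2 the factor [1 - h + X] stays below [1 - 2 h - D], too small for [cor1] unless a
    positive [Y0] makes up for it. *)
Lemma T2_pos h k Y0 Y1 : adm h k ->
  corners h k (h * (-2 + Y1)) Y0 (crude_bound h k) -> corners h k (h * (-2 + Y0)) Y1 (crude_bound h k) ->
  0 < Y0.
Proof.
  intros A [H1 H2 H3 H4 HX0 HY0] [K1 K2 K3 K4 _ HY1].
  destruct (adm_bounds _ _ A) as (Hk & Hh & Hh' & Hk' & HD & Hd & Hhk).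
  unfold crude_bound in *.
  destruct (Rlt_le_dec 0 Y0); [assumption|exfalso].
  assert (E : 1 - h + h * (-2 + Y1) < 1 - 2*h - h*k) by nra.
  assert (0 < k * (h * k)) by (apply Rmult_lt_0_compat; lra).
  assert ((1-k)*(1-2*h-h*k) < (1 - 2 * k) * (1 - h - h * k)) by lra.
  assert (0 < 1 - h + h * (-2 + Y1)) by lra.
  assert ((1 - h + h * (-2 + Y1)) * (1 - k + Y0) <= (1 - h + h * (-2 + Y1)) * (1 - k))
    by (apply Rmult_le_compat_l; lra).
  assert ((1 - h + h * (-2 + Y1)) * (1 - k) <= (1 - 2*h - h*k) * (1-k))
    by (apply Rmult_le_compat_r; lra).
  lra.
Qed.

(** The bound on [Y1] is the one that [T0_bound] yields next to a digit 0, when the odd digit in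
    between is at most 1. Then [cor1] of the second cell bounds [Y0] from below, [cor4] of the first
    bounds it from above, and the two are incompatible. *)
Lemma T2_main h k Y0 Y1 : adm h k ->
  corners h k (h * (-2 + Y1)) Y0 (crude_bound h k) -> corners h k (h * (-2 + Y0)) Y1 (crude_bound h k) ->
  Y1 <= k * (1 + (2 + h) * (h * k)) -> False.
Proof.
  intros A C0 C1 HY.
  pose proof (T2_pos _ _ _ _ A C0 C1) as P0.
  pose proof (T2_pos _ _ _ _ A C1 C0) as P1.
  destruct C0 as [H1 H2 H3 H4 HX0 HY0], C1 as [K1 K2 K3 K4 HX1 HY1].
  destruct (adm_bounds _ _ A) as (Hk & Hh & Hh' & Hk' & HD & Hd & Hhk).
  assert (L1 : crude_bound h k < (1 - 3*h + h*Y0) * (1 + (2+h)*(h*k)*k)).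
  { eapply Rlt_le_trans; [exact K1|].
    replace (1 - h + h * (-2 + Y0)) with (1 - 3*h + h*Y0) by ring.
    apply Rmult_le_compat_l; lra. }
  assert (L2 : crude_bound h k < (1 + h) * (1 - k - Y0)).
  { eapply Rlt_le_trans; [exact H4|].
    assert (0 < h * Y1) by (apply Rmult_lt_0_compat; lra).
    apply Rmult_le_compat_r; lra. }
  assert (Cp : 0 < crude_bound h k) by (unfold crude_bound; apply Rmult_lt_0_compat; lra).
  set (ep := (2+h)*(h*k)*k) in *.
  assert (Hkd : 0 < k * (h*k)) by (apply Rmult_lt_0_compat; lra).
  assert (E2 : 2 * (k * (h*k)) <= ep <= (227/100) * (k * (h*k))).
  { unfold ep; replace ((2 + h) * (h * k) * k) with ((2+h)*(k*(h*k))) by ring.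
    split; apply Rmult_le_compat_r; lra. }
  assert (k * (h*k) <= 22/100*(56/1000)) by (apply Rmult_le_compat; lra).
  assert (0 < ep < 3/100) by lra.
  assert (L3 : crude_bound h k * (1 - ep) < 1 - 3*h + h*Y0).
  { apply Rnot_le_lt; intro N.
    assert ((1 - 3*h + h*Y0) * (1 + ep) <= crude_bound h k * (1 - ep) * (1 + ep))
      by (apply Rmult_le_compat_r; lra).
    assert (0 <= crude_bound h k * (ep * ep)) by (apply Rmult_le_pos; [lra|apply Rle_0_sqr]).
    lra. }
  (* [(1 + h)] times [L3] plus [h] times [L2] eliminates [Y0]. *)
  assert (L4 : (1+h)*(crude_bound h k * (1 - ep)) + h * crude_bound h k < (1+h)*(1 - 2*h - h*k)).
  { assert ((1+h)*(crude_bound h k * (1 - ep)) < (1+h)*(1 - 3*h + h*Y0)) by (apply Rmult_lt_compat_l; lra).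
    assert (h * crude_bound h k < h * ((1 + h) * (1 - k - Y0))) by (apply Rmult_lt_compat_l; lra).
    lra. }
  assert (Ceq : crude_bound h k = 1 - h - 2*k + h*k + 2*k*(h*k)) by (unfold crude_bound; ring).
  assert (E1 : (1+h) * (crude_bound h k * ep) <= 1 * ep).
  { replace ((1+h) * (crude_bound h k * ep)) with (((1+h) * crude_bound h k) * ep) by ring.
    apply Rmult_le_compat_r; [lra|].
    assert (h * k <= 264/1000 * k) by (apply Rmult_le_compat_r; lra).
    assert ((1+h) * crude_bound h k <= (1+h)*(1-h)); [apply Rmult_le_compat_l; lra|].
    assert (0 < h * h) by (apply Rmult_lt_0_compat; lra). lra. }
  rewrite Ceq in *. clear - L4 E1 E2 HD Hk Hh Hd Hh' Hk' Hkd.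
  assert (0 < h * (h * k)) by (apply Rmult_lt_0_compat; lra).
  assert (k * (h * k) <= h * (h * k)) by nra.
  assert (0 < h * h) by (apply Rmult_lt_0_compat; lra).
  assert (0 < k * k) by (apply Rmult_lt_0_compat; lra).
  nra.
Qed.

(** Excludes odd digits from 5 on next to -2 when [a >= 6]. At the larger ordinate [M] the product
    of [cor2] is at most [(1 - h + h M)(1 + k - M)], which decreases from [M = (5 - 2 h) k] on and
    is too small already there. *)
Lemma T2_U5_small h k Y0 Y1 : adm h k -> 6 * h <= 1 + h * k ->
  corners h k (h * (-2 + Y1)) Y0 (crude_bound h k) -> corners h k (h * (-2 + Y0)) Y1 (crude_bound h k) ->
  (5 - 2 * h) * k <= Y1 -> False.
Proof.
  intros A H6 [H1 H2 H3 H4 HX0 HY0] [K1 K2 K3 K4 HX1 HY1] HY.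
  destruct (adm_bounds _ _ A) as (Hk & Hh & Hh' & Hk' & HD & Hd & Hhk).
  assert (G : forall M, (5-2*h)*k <= M < 1 - k -> (1 - h + h*M)*(1+k-M) < crude_bound h k).
  { intros M HM.
    assert ((1 - h + h*M)*(1+k-M) <= (1 - h + h*((5-2*h)*k))*(1+k-(5-2*h)*k)).
    { set (m := (5-2*h)*k) in *.
      assert (0 < m) by (apply Rmult_lt_0_compat; lra).
      assert (0 <= h * (M+m)) by (apply Rmult_le_pos; lra).
      assert (0 <= (M-m)*(1-2*h-h*k+h*(M+m))) by (apply Rmult_le_pos; lra).
      lra. }
    assert ((1 - h + h*((5-2*h)*k))*(1+k-(5-2*h)*k) < crude_bound h k).
    { unfold crude_bound.
      assert (h <= 176/1000) by lra.
      assert (0 < h * (h * k)) by (apply Rmult_lt_0_compat; lra).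
      assert (0 < k * (h * k)) by (apply Rmult_lt_0_compat; lra).
      assert (0 < h * (h * k) * (h * k)) by (apply Rmult_lt_0_compat; lra).
      assert (h * k <= 176/1000 * k) by (apply Rmult_le_compat_r; lra).
      assert (h * (k * (h * k)) <= 176/1000 * (k * (h * k))) by (apply Rmult_le_compat_r; lra).
      lra. }
    lra. }
  destruct (Rle_dec Y0 Y1) as [L|L].
  - specialize (G Y1 ltac:(lra)).
    assert ((1 - h + h * Y0) * (1 + k - Y1) <= (1 - h + h * Y1) * (1 + k - Y1)).
    { apply Rmult_le_compat_r; [lra|].
      assert (h * Y0 <= h * Y1) by (apply Rmult_le_compat_l; lra). lra. }
    lra.
  - specialize (G Y0 ltac:(lra)).
    assert ((1 - h + h * Y1) * (1 + k - Y0) <= (1 - h + h * Y0) * (1 + k - Y0)).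
    { apply Rmult_le_compat_r; [lra|].
      assert (h * Y1 <= h * Y0) by (apply Rmult_le_compat_l; lra). lra. }
    lra.
Qed.

(** The case [a = 4]. For [b = 5] the assumed ordinate exceeds [1 - k]; for [b >= 7], [cor4] caps
    the larger ordinate near 4/10, and then [cor1] fails. *)
Lemma T2_U5_four h k Y0 Y1 : adm h k -> 4 * h = 1 + h * k -> (5 * k = 1 + h * k \/ 7 * k <= 1 + h * k) ->
  corners h k (h * (-2 + Y1)) Y0 (crude_bound h k) -> corners h k (h * (-2 + Y0)) Y1 (crude_bound h k) ->
  (5 - 2 * h) * k <= Y1 -> False.
Proof.
  intros A H4 H57 C0 C1 HY.
  pose proof (T2_pos _ _ _ _ A C0 C1) as P0.
  pose proof (T2_pos _ _ _ _ A C1 C0) as P1.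
  destruct C0 as [H1 H2 H3 H4' HX0 HY0], C1 as [K1 K2 K3 K4 HX1 HY1].
  destruct (adm_bounds _ _ A) as (Hk & Hh & Hh' & Hk' & HD & Hd & Hhk).
  destruct H57 as [H5|H7].
  { assert ((5 - 2*h)*k >= (5 - 2*(264/1000)) * k) by (apply Rle_ge, Rmult_le_compat_r; lra).
    lra. }
  assert (1/4 < h) by lra.
  assert (k <= 151/1000) by lra.
  assert (h * k <= 264/1000*(151/1000)) by (apply Rmult_le_compat; lra).
  assert (h <= 26/100) by lra.
  assert (G : forall M N, 0 < N -> N <= M -> M < 1 - k ->
     crude_bound h k < (1 - 3*h + h*N) * (1 - k + M) -> crude_bound h k < (1 + h - h*N)*(1-k-M) -> False).
  { intros M N HN HM HM1 A1 A2.
    assert (0 < h * N) by (apply Rmult_lt_0_compat; lra).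
    assert (h * N <= h * M) by (apply Rmult_le_compat_l; lra).
    assert (D1 : 25/100 * k <= h * k <= 264/1000 * k) by (split; apply Rmult_le_compat_r; lra).
    assert (B2 : (1 + h - h*N)*(1-k-M) <= (125/100+66/1000*k)*(1-k-M)) by (apply Rmult_le_compat_r; lra).
    assert (B1 : (1 - 3*h + h*N)*(1-k+M) <= (25/100-18/100*k+26/100*M)*(1-k+M)).
    { apply Rmult_le_compat_r; [lra|].
      assert (h * M <= 26/100 * M) by (apply Rmult_le_compat_r; lra). lra. }
    assert (Hkk : 0 < k * k) by (apply Rmult_lt_0_compat; lra).
    assert (Ceq : crude_bound h k >= 75/100 - 183/100 * k).
    { unfold crude_bound. assert (0 < k * (h*k)) by (apply Rmult_lt_0_compat; lra). lra. }
    assert (BM : M <= 4/10 + 5/10*k).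
    { apply Rnot_lt_le; intro N'.
      assert ((125/100+66/1000*k)*(1-k-M) <= (125/100+66/1000*k)*(6/10-15/10*k)) by (apply Rmult_le_compat_l; lra).
      lra. }
    assert ((25/100-18/100*k+26/100*M)*(1-k+M) <= (354/1000-5/100*k)*(14/10-5/10*k)).
    { apply Rmult_le_compat; lra. }
    assert (k * k <= 151/1000 * k) by (apply Rmult_le_compat_r; lra).
    lra. }
  replace (1 - h + h * (-2 + Y0)) with (1 - 3 * h + h * Y0) in * by ring.
  replace (1 - h + h * (-2 + Y1)) with (1 - 3 * h + h * Y1) in * by ring.
  replace (1 - h - h * (-2 + Y0)) with (1 + h - h * Y0) in * by ring.
  replace (1 - h - h * (-2 + Y1)) with (1 + h - h * Y1) in * by ring.
  destruct (Rle_dec Y0 Y1) as [L|L].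
  - apply (G Y1 Y0); lra.
  - apply (G Y0 Y1); lra.
Qed.

Lemma crude_bound_lower h k : adm h k -> 39/100 <= crude_bound h k.
Proof.
  intros A. destruct (adm_bounds _ _ A) as (Hk & Hh & Hh' & Hk' & HD & Hd & Hhk).
  unfold crude_bound. assert ((1 - 2*(2112/10000)) * (1-264/1000-56/1000) <= (1-2*k)*(1-h-h*k)); [|lra].
  apply Rmult_le_compat; lra.
Qed.

(** Resolves the absolute values from the position of the cell centre. If the factor were [-x <= 0],
    the first corner would give [c < x (1 + s)] and the second [c < (2 h - x)(2 - (1 + s)(1 - D))];
    eliminating [x] leaves a quadratic in [1 + s] whose maximum forces [c (1 - D) < h], against
    [c >= 39/100]. *)
Lemma cell_pos h k r s c :
  0 < h <= 264/1000 -> 0 < k <= 264/1000 -> h * k <= 56/1000 -> 39/100 <= c ->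
  -1 <= r <= 1 -> -1 <= s <= 1 ->
  c < Rabs ((1 - h + (r - h*s)) * (1 - k + (s - k*r))) ->
  c < Rabs ((1 + h + (r - h*s)) * (1 + k - (s - k*r))) ->
  0 < 1 - h + (r - h*s).
Proof.
  intros Hh Hk HD Hc Hr Hs H1 H2.
  apply Rnot_le_lt; intro N.
  assert (0 < h * k) by (apply Rmult_lt_0_compat; lra).
  set (x := h * (1+s) - (1+r)).
  assert (Hx : 0 <= x) by (unfold x; lra).
  assert (E1 : (1 - h + (r - h*s)) = - x) by (unfold x; ring).
  assert (HR : 0 <= h * (1+s) - x) by (unfold x; lra).
  assert (HS : 0 <= h * (1+s)) by (apply Rmult_le_pos; lra).
  assert (Hkr : 0 <= k * (1+r)) by (apply Rmult_le_pos; lra).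
  assert (Hkx : k * (1+r) <= h * k * (1+s)).
  { replace (h*k*(1+s)) with (k * (h*(1+s))) by ring. apply Rmult_le_compat_l; lra. }
  assert (h * k * (1+s) <= 56/1000*(1+s)) by (apply Rmult_le_compat_r; lra).
  rewrite E1, Rabs_left1 in H1.
  2: { assert (0 <= x * (1 - k + (s - k * r))) by (apply Rmult_le_pos; lra). lra. }
  assert (A1 : c < x * (1+s)).
  { assert (x * (1 - k + (s - k*r)) <= x * (1+s)) by (apply Rmult_le_compat_l; lra). lra. }
  assert (B1 : 0 <= h * (1 - s)) by (apply Rmult_le_pos; lra).
  rewrite Rabs_pos_eq in H2 by (apply Rmult_le_pos; lra).
  assert (A2 : c < (2*h - x) * (2 - (1+s)*(1-h*k))).
  { assert ((1 + h + (r - h*s)) * (1 + k - (s - k*r)) <= (1 + h + (r - h*s)) * (2 - (1+s)*(1-h*k)))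
      by (apply Rmult_le_compat_l; lra).
    unfold x in *. lra. }
  assert (S0 : 0 < 1 + s).
  { apply Rnot_le_lt; intro. assert (1+s = 0) as E by lra. rewrite E in A1. lra. }
  assert (A3 : c * (1+s) < (2*h*(1+s) - x*(1+s)) * (2 - (1+s)*(1-h*k))).
  { replace ((2*h*(1+s) - x*(1+s)) * (2 - (1+s)*(1-h*k))) with
      (((2*h - x) * (2 - (1+s)*(1-h*k))) * (1+s)) by ring.
    apply Rmult_lt_compat_r; lra. }
  assert (A4 : (2*h*(1+s) - x*(1+s)) * (2 - (1+s)*(1-h*k)) <= (2*h*(1+s) - c) * (2 - (1+s)*(1-h*k))).
  { apply Rmult_le_compat_r; lra. }
  assert (Q : 0 <= 2*h*(1-h*k)*((1+s)*(1-h*k) - 1)²).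
  { apply Rmult_le_pos; [apply Rmult_le_pos; lra|apply Rle_0_sqr]. }
  assert (Q2 : 0 <= h * ((1+s)*(1-h*k) - 1)²).
  { apply Rmult_le_pos; [lra|apply Rle_0_sqr]. }
  unfold Rsqr in *.
  assert (cD : 0 <= c * (h*k) * (1+s)).
  { apply Rmult_le_pos; [apply Rmult_le_pos|]; lra. }
  assert (A5 : 2 * c < (4 * h * (1+s) - 2*h*(1+s)*(1+s)*(1-h*k))) by lra.
  assert (A6 : (4 * h * (1+s) - 2*h*(1+s)*(1+s)*(1-h*k)) * (1-h*k) <= 2 * h) by lra.
  assert (A7 : 2 * c * (1-h*k) < (4 * h * (1+s) - 2*h*(1+s)*(1+s)*(1-h*k)) * (1-h*k))
    by (apply Rmult_lt_compat_r; lra).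
  assert (2*c*(1-56/1000) <= 2 * c * (1-h*k)) by (apply Rmult_le_compat_l; lra).
  lra.
Qed.

(** Four uses of [cell_pos], related by the symmetries of a cell: central reflection and exchange of
    the axes. *)
Lemma cell_corners h k r s c : adm h k -> crude_bound h k <= c ->
  -1 <= r <= 1 -> -1 <= s <= 1 ->
  let X := r - h * s in let Y := s - k * r in
  c < Rabs ((1 - h + X) * (1 - k + Y)) ->
  c < Rabs ((1 + h + X) * (1 + k - Y)) ->
  c < Rabs ((1 + h - X) * (1 + k + Y)) ->
  c < Rabs ((1 - h - X) * (1 - k - Y)) ->
  corners h k X Y c.
Proof.
  intros A Hc Hr Hs X Y H1 H2 H3 H4.
  pose proof (crude_bound_lower _ _ A) as Hcl.
  destruct (adm_bounds _ _ A) as (Hk & Hh & Hh' & Hk' & HD & Hd & Hhk).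
  assert (P1 : 0 < 1 - h + X) by (apply (cell_pos h k r s c); auto; lra).
  assert (P2 : 0 < 1 - h - X).
  { replace (1 - h - X) with (1 - h + (- r - h * - s)) by (unfold X; ring).
    apply (cell_pos h k (-r) (-s) c); try lra.
    - eapply Rlt_le_trans; [exact H4|]. right; f_equal; unfold X, Y; ring.
    - eapply Rlt_le_trans; [exact H3|]. right; f_equal; unfold X, Y; ring. }
  assert (P3 : 0 < 1 - k + Y).
  { apply (cell_pos k h s r c); try lra.
    - eapply Rlt_le_trans; [exact H1|]. right; f_equal; unfold X, Y; ring.
    - eapply Rlt_le_trans; [exact H3|]. right; f_equal; unfold X, Y; ring. }
  assert (P4 : 0 < 1 - k - Y).
  { replace (1 - k - Y) with (1 - k + (- s - k * - r)) by (unfold Y; ring).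
    apply (cell_pos k h (-s) (-r) c); try lra.
    - eapply Rlt_le_trans; [exact H4|]. right; f_equal; unfold X, Y; ring.
    - eapply Rlt_le_trans; [exact H2|]. right; f_equal; unfold X, Y; ring. }
  rewrite Rabs_pos_eq in H1 by (apply Rmult_le_pos; lra).
  rewrite Rabs_pos_eq in H2 by (apply Rmult_le_pos; lra).
  rewrite Rabs_pos_eq in H3 by (apply Rmult_le_pos; lra).
  rewrite Rabs_pos_eq in H4 by (apply Rmult_le_pos; lra).
  split; lra.
Qed.

(** * Elimination of digits along consecutive cells *)

Record par (a b : Z) (h k : R) : Prop := {
  par_a : IZR a * h = 1 + h * k;
  par_b : IZR b * k = 1 + h * k;
  par_4 : (4 <= a)%Z;
  par_even : Z.Even a;
  par_lt : (a < b)%Z;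
  par_odd : Z.Odd b;
  par_h : 0 < h;
  par_k : 0 < k;
  par_D : h * k < 1 }.

Lemma par_adm a b h k : par a b h k -> adm h k.
Proof.
  intros [Ha Hb H4 _ Hlt _ Hh Hk HD].
  assert (HD0 : 0 < h * k) by (apply Rmult_lt_0_compat; lra).
  assert (A4 : 4 <= IZR a) by (apply IZR_le; lia).
  assert (B5 : 5 <= IZR b) by (apply IZR_le; lia).
  assert (AB : IZR a + 1 <= IZR b) by (rewrite <- plus_IZR; apply IZR_le; lia).
  assert (E4 : 4 * h <= 1 + h * k) by (rewrite <- Ha; apply Rmult_le_compat_r; lra).
  assert (E5 : 5 * k <= 1 + h * k) by (rewrite <- Hb; apply Rmult_le_compat_r; lra).
  assert (EE : (4 * h) * (5 * k) <= (1 + h*k) * (1 + h * k)) by (apply Rmult_le_compat; lra).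
  assert (HD56 : h * k <= 56/1000).
  { apply Rnot_lt_le; intro N.
    assert (0 < (h*k - 56/1000) * (1 - h*k)) by (apply Rmult_lt_0_compat; lra). lra. }
  split; try assumption.
  replace ((1 + h*k)*(h-k)) with ((1+h*k)*h - (1+h*k)*k) by ring.
  rewrite <- Hb at 1; rewrite <- Ha.
  assert (1 * (h * k) <= (IZR b - IZR a) * (h * k)) by (apply Rmult_le_compat_r; lra). lra.
Qed.

Lemma par_split a b h k : par a b h k ->
  6 * h <= 1 + h * k \/ (4 * h = 1 + h * k /\ (5 * k = 1 + h * k \/ 7 * k <= 1 + h * k)).
Proof.
  intros [Ha Hb H4 [m Hm] Hlt [n Hn] Hh Hk HD].
  destruct (Z.eq_dec a 4) as [->|N].
  - right; split; [lra|].
    destruct (Z.eq_dec b 5) as [->|N']; [left; lra|right].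
    rewrite <- Hb; apply Rmult_le_compat_r; [lra|apply IZR_le; lia].
  - left. rewrite <- Ha; apply Rmult_le_compat_r; [lra|apply IZR_le; lia].
Qed.

Lemma T2_U5 a b h k Y0 Y1 : par a b h k ->
  corners h k (h * (-2 + Y1)) Y0 (crude_bound h k) -> corners h k (h * (-2 + Y0)) Y1 (crude_bound h k) ->
  (5 - 2 * h) * k <= Y1 -> False.
Proof.
  intros P. destruct (par_split _ _ _ _ P) as [H6|[H4 H57]].
  - apply T2_U5_small; eauto using par_adm.
  - apply T2_U5_four; eauto using par_adm.
Qed.

(** Four consecutive cells [(Xi, Yi)], separated by the digits [T1], [U], [T2]. Each digit enters
    one equation for the future of the earlier cell and one for the past of the later cell, so a
    chain read backwards is again a chain. *)
Record chain (h k Y0 Y1 Y2 Y3 X0 X1 X2 X3 : R) (T1 U T2 : Z) : Prop := {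
  ch_T1 : Z.Even T1;
  ch_U : Z.Odd U;
  ch_T2 : Z.Even T2;
  ch_c0 : corners h k X0 Y0 (crude_bound h k);
  ch_c1 : corners h k X1 Y1 (crude_bound h k);
  ch_c2 : corners h k X2 Y2 (crude_bound h k);
  ch_c3 : corners h k X3 Y3 (crude_bound h k);
  ch_X0 : X0 = h * (IZR T1 + Y1);
  ch_X1 : X1 = h * (IZR T1 + Y0);
  ch_Y1 : Y1 = k * (IZR U + X2);
  ch_Y2 : Y2 = k * (IZR U + X1);
  ch_X2 : X2 = h * (IZR T2 + Y3);
  ch_X3 : X3 = h * (IZR T2 + Y2) }.

Lemma chain_rev h k Y0 Y1 Y2 Y3 X0 X1 X2 X3 T1 U T2 :
  chain h k Y0 Y1 Y2 Y3 X0 X1 X2 X3 T1 U T2 ->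
  chain h k Y3 Y2 Y1 Y0 X3 X2 X1 X0 T2 U T1.
Proof. intros []; split; assumption. Qed.

Lemma chain_neg h k Y0 Y1 Y2 Y3 X0 X1 X2 X3 T1 U T2 :
  chain h k Y0 Y1 Y2 Y3 X0 X1 X2 X3 T1 U T2 ->
  chain h k (- Y0) (- Y1) (- Y2) (- Y3) (- X0) (- X1) (- X2) (- X3) (- T1) (- U) (- T2).
Proof.
  intros [[t1 ->] [u ->] [t2 ->] C0 C1 C2 C3 E0 E1 F1 F2 E2 E3].
  split; try (apply corners_neg; assumption);
    try (rewrite opp_IZR); try lra.
  - exists (- t1)%Z; lia.
  - exists (- u - 1)%Z; lia.
  - exists (- t2)%Z; lia.
Qed.

Lemma chain_T1_cases h k Y0 Y1 Y2 Y3 X0 X1 X2 X3 T1 U T2 : adm h k ->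
  chain h k Y0 Y1 Y2 Y3 X0 X1 X2 X3 T1 U T2 -> (T1 = -2 \/ T1 = 0 \/ T1 = 2)%Z.
Proof.
  intros A [[t1 Ht] _ _ C0 C1 _ _ E0 E1 _ _ _ _].
  pose proof (T_bound _ _ _ _ _ _ (IZR T1) A C0 C1 E0 E1) as BT.
  assert (HT : (-4 < T1 < 4)%Z) by (split; apply lt_IZR; lra). lia.
Qed.

(** At a digit 0, [T0_bound] keeps [Y1 = k (U + X2)] below [(2 + h) k] in modulus, which bounds [U];
    it also puts [Y2] under the threshold of [T2_main]. *)
Lemma chain_zero_aux h k Y0 Y1 Y2 Y3 X0 X1 X2 X3 U T2 : adm h k ->
  chain h k Y0 Y1 Y2 Y3 X0 X1 X2 X3 0 U T2 ->
  (-3 < U < 3)%Z /\ T2 <> (-2)%Z.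
Proof.
  intros A [_ [u Hu] _ C0 C1 C2 C3 E0 E1 F1 F2 E2 E3].
  destruct (adm_bounds _ _ A) as (Hk & Hh & Hh' & Hk' & HD & Hd & Hhk).
  rewrite Rplus_0_l in E0, E1. subst X0 X1.
  pose proof (T0_bound _ _ _ _ A C0 C1) as B1.
  pose proof (T0_bound _ _ _ _ A C1 C0) as B0.
  pose proof (corX _ _ _ _ _ C2) as BX2.
  assert (BU : -3 < IZR U < 3).
  { assert (-(2 + h) < IZR U + X2 < 2 + h); [|lra].
    split; apply (Rmult_lt_reg_l k); lra. }
  assert (HU : (-3 < U < 3)%Z) by (split; apply lt_IZR; lra).
  split; [exact HU|]. intros ->. subst X2 X3.
  apply (T2_main h k Y3 Y2 A C3 C2).
  rewrite F2. apply Rmult_le_compat_l; [lra|].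
  assert (IZR U <= 1) by (apply IZR_le; lia).
  assert (h * Y0 <= h * ((2 + h) * k)) by (apply Rmult_le_compat_l; lra).
  lra.
Qed.

Lemma chain_zero h k Y0 Y1 Y2 Y3 X0 X1 X2 X3 U T2 : adm h k ->
  chain h k Y0 Y1 Y2 Y3 X0 X1 X2 X3 0 U T2 -> (T2 = 0 /\ (U = 1 \/ U = -1))%Z.
Proof.
  intros A C.
  destruct (chain_zero_aux _ _ _ _ _ _ _ _ _ _ _ _ A C) as [HU N1].
  pose proof (chain_neg _ _ _ _ _ _ _ _ _ _ _ _ _ C) as C'.
  change (- 0)%Z with 0%Z in C'.
  destruct (chain_zero_aux _ _ _ _ _ _ _ _ _ _ _ _ A C') as [_ N2].
  destruct (chain_T1_cases _ _ _ _ _ _ _ _ _ _ _ _ _ A (chain_rev _ _ _ _ _ _ _ _ _ _ _ _ _ C)) as [|[|]];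
    destruct (ch_U _ _ _ _ _ _ _ _ _ _ _ _ _ C) as [u Hu]; lia.
Qed.

(** Digit -2 makes the adjacent ordinates positive, so between two such digits [U > 0]; [T2_main]
    then removes 1, and [T2_U5] removes 5 and more. A following digit 2 would confine the odd [U]
    strictly between -1 and 1. *)
Lemma chain_two a b h k Y0 Y1 Y2 Y3 X0 X1 X2 X3 U T2 : par a b h k ->
  chain h k Y0 Y1 Y2 Y3 X0 X1 X2 X3 (-2) U T2 -> (T2 = -2 /\ U = 3)%Z.
Proof.
  intros P C. pose proof (par_adm _ _ _ _ P) as A.
  destruct (adm_bounds _ _ A) as (Hk & Hh & Hh' & Hk' & HD & Hd & Hhk).
  pose proof (chain_rev _ _ _ _ _ _ _ _ _ _ _ _ _ C) as Cr.
  destruct (chain_T1_cases _ _ _ _ _ _ _ _ _ _ _ _ _ A Cr) as [->|[->| ->]].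
  - split; [reflexivity|].
    destruct C as [_ [u Hu] _ C0 C1 C2 C3 -> -> F1 F2 -> ->].
    pose proof (T2_pos _ _ _ _ A C0 C1) as P0.
    pose proof (T2_pos _ _ _ _ A C1 C0) as P1.
    pose proof (T2_pos _ _ _ _ A C2 C3) as P2.
    pose proof (T2_pos _ _ _ _ A C3 C2) as P3.
    pose proof (corY _ _ _ _ _ C0) as B0.
    pose proof (corY _ _ _ _ _ C3) as B3.
    assert (L1 : 0 < h * Y3 < h) by (split; [apply Rmult_lt_0_compat; lra|]; 
      assert (h * Y3 < h * 1) by (apply Rmult_lt_compat_l; lra); lra).
    assert (0 < IZR U).
    { assert (0 < IZR U + h * (-2 + Y3)) by (apply (Rmult_lt_reg_l k); lra). lra. }
    assert (0 < U)%Z by (apply lt_IZR; lra).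
    assert (U <> 1)%Z.
    { intros ->. apply (T2_main h k Y0 Y1 A C0 C1). rewrite F1.
      apply Rmult_le_compat_l; [lra|].
      assert (0 < (2 + h) * (h * k)) by (apply Rmult_lt_0_compat; lra). lra. }
    assert (~ (5 <= U)%Z); [|lia].
    intros N. apply IZR_le in N.
    apply (T2_U5 _ _ h k Y0 Y1 P C0 C1). rewrite F1, (Rmult_comm _ k).
    apply Rmult_le_compat_l; lra.
  - apply chain_zero in Cr; [lia|assumption].
  - exfalso.
    pose proof (chain_neg _ _ _ _ _ _ _ _ _ _ _ _ _ Cr) as Cn.
    destruct C as [_ [u Hu] _ C0 C1 C2 C3 -> -> F1 F2 E2 E3].
    destruct Cn as [_ _ _ D0 D1 _ _ G0 G1 _ _ _ _].
    rewrite G0 in D0; rewrite G1 in D1. change (- (2))%Z with (-2)%Z in *.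
    pose proof (T2_pos _ _ _ _ A C1 C0) as P1.
    pose proof (T2_pos _ _ _ _ A D1 D0) as P2.
    pose proof (corY _ _ _ _ _ C0) as B0.
    pose proof (corX _ _ _ _ _ C2) as B2.
    pose proof (corX _ _ _ _ _ C1) as B1.
    assert (0 < IZR U + X2) by (apply (Rmult_lt_reg_l k); lra).
    assert (IZR U + h * (-2 + Y0) < 0) by (apply (Rmult_lt_reg_l k); lra).
    assert (-1 < U < 1)%Z by (split; apply lt_IZR; lra). lia.
Qed.

Lemma chain_step a b h k Y0 Y1 Y2 Y3 X0 X1 X2 X3 T1 U T2 : par a b h k ->
  chain h k Y0 Y1 Y2 Y3 X0 X1 X2 X3 T1 U T2 ->
  (T1 = 0 /\ T2 = 0 /\ (U = 1 \/ U = -1) \/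
   T1 = -2 /\ T2 = -2 /\ U = 3 \/ T1 = 2 /\ T2 = 2 /\ U = -3)%Z.
Proof.
  intros P C. pose proof (par_adm _ _ _ _ P) as A.
  destruct (chain_T1_cases _ _ _ _ _ _ _ _ _ _ _ _ _ A C) as [->|[->| ->]].
  - apply (chain_two _ _ _ _ _ _ _ _ _ _ _ _ _ _ P) in C. lia.
  - apply chain_zero in C; [lia|assumption].
  - apply chain_neg in C. change (- (2))%Z with (-2)%Z in C.
    apply (chain_two _ _ _ _ _ _ _ _ _ _ _ _ _ _ P) in C. lia.
Qed.

(** * Sign sequences *)

(* [ws] is the value of ++--++--..., and [wz D n] that of the periodic sequence +-(++--)^n +-(++--)^n ... *)
Definition ws (D : R) : R := (1 + D) / (1 + D ^ 2).
Definition wz (D : R) (n : nat) : R :=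
  (1 - D + D ^ 2 * ws D * (1 - D ^ (4 * n))) / (1 - D ^ (4 * n + 2)).
Definition limit_value (h k : R) : R :=
  let D := h * k in
  (2 - h - ws D) * (1 - 2 * k + k * D * (1 - D + D ^ 2 * ws D)).

Lemma ws_eq D : ws D = 1 + D - D ^ 2 * ws D.
Proof. unfold ws. assert (0 <= D^2) by nra. field. lra. Qed.

Lemma ws_bounds D : 0 < D <= 56/1000 -> 1 + D - 106/100 * D^2 <= ws D <= 1 + D - D^2 /\ 1 <= ws D.
Proof.
  intros HD. assert (0 < D^2) by nra.
  assert (D^2 <= 56/1000*D) by nra.
  assert (0 < ws D) by (unfold ws; apply Rdiv_lt_0_compat; lra).
  pose proof (ws_eq D) as E.
  assert (0 < D^2 * ws D) by (apply Rmult_lt_0_compat; lra).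
  assert (D^2 * ws D <= D^2 * (1056/1000)) by (apply Rmult_le_compat_l; lra).
  assert (1 <= ws D) by lra.
  assert (D^2 * 1 <= D^2 * ws D) by (apply Rmult_le_compat_l; lra).
  lra.
Qed.

Lemma pow_unit D n : 0 < D <= 1 -> 0 <= D ^ n <= 1.
Proof.
  intros H. split; [apply pow_le; lra|rewrite <- (pow1 n); apply pow_incr; lra].
Qed.

(** One reading of the period: the two single signs contribute [1 - D] and a factor [D^2], and each
    of the [2 n] blocks multiplies the deviation from [ws D] by [- D^2]. *)
Lemma wz_eq D n : 0 < D <= 56/1000 -> wz D n = 1 - D + D^2 * (ws D + D ^ (4 * n) * (wz D n - ws D)).
Proof.
  intros HD.
  assert (L : D ^ (4 * n + 2) < 1).
  { rewrite pow_add. destruct (pow_unit D (4 * n)); [lra|].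
    assert (0 < D^2 < 1) by nra.
    assert (D ^ (4*n) * D^2 <= 1 * D^2) by (apply Rmult_le_compat_r; lra). lra. }
  assert (E : wz D n * (1 - D ^ (4 * n + 2)) = 1 - D + D ^ 2 * ws D * (1 - D ^ (4 * n))).
  { unfold wz. field. lra. }
  rewrite pow_add in E. lra.
Qed.

Lemma wz_bounds D n : 0 < D <= 56/1000 -> 1 - D <= wz D n <= 1 - D + D^2 * ws D.
Proof.
  intros HD. destruct (pow_unit D (4 * n)) as [P0 P1]; [lra|].
  destruct (ws_bounds D HD) as [Hw Hw1].
  assert (HD2 : 0 < D^2 <= 56/1000*D) by nra.
  pose proof (wz_eq D n HD) as E. set (p := D ^ (4 * n)) in *. set (z := wz D n) in *.
  assert (0 <= p * D^2 <= 1 * D^2) by (split; [apply Rmult_le_pos|apply Rmult_le_compat_r]; lra).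
  assert (0 < D^2 * ws D <= D^2 * (1056/1000)).
  { split; [apply Rmult_lt_0_compat; lra| apply Rmult_le_compat_l; lra]. }
  split; apply (Rmult_le_reg_r (1 - p * D^2)); try lra.
  - assert (0 <= D^2 * ws D * (1 - p)) by (apply Rmult_le_pos; lra).
    assert (0 <= p * D^2 * (1 - D)) by (apply Rmult_le_pos; lra). lra.
  - assert (0 <= p * D^2 * (ws D - (1 - D + D^2 * ws D))) by (apply Rmult_le_pos; lra). lra.
Qed.

Definition sg (b : bool) : R := if b then 1 else -1.

(** Uniqueness of the bounded solution of a contracting recurrence; it identifies an infinite
    expansion with the closed form obeying the same recurrence. *)
Lemma contraction_zero (x : nat -> R) :
  (forall m, Rabs (x m) <= 1) -> (forall m, Rabs (x m) <= / 2 * Rabs (x (S m))) -> x 0%nat = 0.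
Proof.
  intros HB HC.
  assert (H : forall m j, Rabs (x j) <= (/2)^m).
  { induction m as [|m IH]; intros j; simpl; [apply HB|].
    eapply Rle_trans; [apply HC|]. apply Rmult_le_compat_l; [lra|apply IH]. }
  apply NNPP; intro N. apply Rabs_pos_lt in N.
  destruct (pow_lt_1_zero (/2)) with (y := Rabs (x 0%nat)) as [n Hn]; [rewrite Rabs_pos_eq; lra|lra|].
  specialize (Hn n (le_n n)). specialize (H n 0%nat).
  rewrite Rabs_pos_eq in Hn by (apply pow_le; lra). lra.
Qed.

(* [s i] tells whether the i-th and the next sign agree; [W] and [U] are the forward and backward series in [D],
   normalised by the i-th sign. *)
Section Letters.
Variables (h k : R) (s : nat -> bool) (W U : nat -> R).
Hypothesis A : adm h k.
Let D := h * k.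
Hypothesis HW : forall i, W i = 1 + sg (s i) * D * W (S i).
Hypothesis HU : forall i, U (S i) = 1 + sg (s i) * D * U i.
Hypothesis HA : forall i, limit_value h k < (2 - h - W i) * (1 - k - k * U i).
Hypothesis HB : forall i, limit_value h k < (2 - h - U i) * (1 - k - k * W i).
Hypothesis BW : forall i, - (D + 12/10*D^2) <= W i - 1 <= D + 12/10 * D^2.
Hypothesis BU : forall i, - (D + 12/10*D^2) <= U i - 1 <= D + 12/10 * D^2.

Let A1 := 2 - h - ws D.
Let A2 := 1 - 2 * k + k * D * (1 - D + D ^ 2 * ws D).

Lemma numeric : 0 < k <= 2112/10000 /\ 0 < h <= 264/1000 /\ 0 < D <= 56/1000 /\
  0 < D^2 <= 56/1000*D /\ D = h * k /\ 68/100 <= A1 <= 1 /\ 57/100 <= A2 <= 1 /\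
  1 + D - 106/100 * D^2 <= ws D <= 1 + D - D^2.
Proof.
  destruct (adm_bounds _ _ A) as (Hk & Hh & Hh' & Hk' & HD & Hd & Hhk). fold D in HD, Hd, Hhk |- *.
  destruct (ws_bounds D HD) as [Hw Hw1].
  assert (HD2 : 0 < D^2 <= 56/1000*D) by nra.
  assert (0 < D^2 * ws D <= D^2 * (1056/1000)).
  { split; [apply Rmult_lt_0_compat; lra| apply Rmult_le_compat_l; lra]. }
  assert (0 <= k * D * (1 - D + D ^ 2 * ws D)).
  { apply Rmult_le_pos; [apply Rmult_le_pos|]; lra. }
  assert (k * D * (1 - D + D ^ 2 * ws D) <= k * D * 1).
  { apply Rmult_le_compat_l; [apply Rmult_le_pos; lra|lra]. }
  assert (k * D <= k * (56/1000)) by (apply Rmult_le_compat_l; lra).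
  unfold A1, A2. repeat split; try lra.
Qed.

(* [limit_value] is the product at [w = ws D], [u = 1 - D (1 - D + D^2 ws D)], the limiting critical position. *)
Lemma excess (w u : R) : limit_value h k < (2 - h - w) * (1 - k - k * u) ->
  (w - ws D) * A2 < k * (1 - D * (1 - D + D ^ 2 * ws D) - u) * (2 - h - w).
Proof. unfold limit_value, A2. fold D. intros H. lra. Qed.

(** In the middle of three equal signs the forward series is at most order [D^2] below [ws D], while
    the backward one exceeds its critical value by nearly [2 D]. In [excess] this sets [k D] against
    [D^2]. *)
Lemma no_triple i : s i = true -> s (S i) = true -> False.
Proof.
  intros S0 S1. destruct numeric as (Hk & Hh & HD & HD2 & ED & HA1 & HA2 & Hw).
  pose proof (excess _ _ (HA (S i))) as E.
  pose proof (HW (S i)) as EW. pose proof (HU i) as EU.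
  rewrite S1 in EW; rewrite S0 in EU. unfold sg in *.
  pose proof (BW (S (S i))) as B2. pose proof (BU i) as B0.
  pose proof (BW (S i)) as B1.
  assert (LW : 1 + D - 12/10 * D^2 <= W (S i)).
  { assert (D * (1 - 12/10*D) <= D * W (S (S i))) by (apply Rmult_le_compat_l; lra). lra. }
  assert (LU : 1 + D - 12/10 * D^2 <= U (S i)).
  { assert (D * (1 - 12/10*D) <= D * U i) by (apply Rmult_le_compat_l; lra). lra. }
  assert (0 <= D^2 * ws D) by (apply Rmult_le_pos; lra).
  assert (LD : 17/10 * D <= U (S i) - (1 - D * (1 - D + D ^ 2 * ws D))).
  { assert (0 <= D * (D^2 * ws D)) by (apply Rmult_le_pos; lra). lra. }
  assert (k * (1 - D * (1 - D + D ^ 2 * ws D) - U (S i)) * (2 - h - W (S i)) <=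
     - (k * (17/10 * D) * (60/100))).
  { replace (k * (1 - D * (1 - D + D ^ 2 * ws D) - U (S i)) * (2 - h - W (S i)))
     with (- (k * (U (S i) - (1 - D * (1 - D + D ^ 2 * ws D))) * (2 - h - W (S i)))) by ring.
    apply Ropp_le_contravar. apply Rmult_le_compat; try lra.
    - apply Rmult_le_pos; lra.
    - apply Rmult_le_compat_l; lra. }
  assert (- (2/10 * D^2) <= (W (S i) - ws D) * A2).
  { assert (- (2/10 * D^2) * A2 <= (W (S i) - ws D) * A2) by (apply Rmult_le_compat_r; lra).
    assert (D^2 * A2 <= D^2 * 1) by (apply Rmult_le_compat_l; lra). lra. }
  assert (D^2 <= 264/1000 * (k * D)).
  { replace (D^2) with (h * (k * D)) by (rewrite ED; ring).
    apply Rmult_le_compat_r; [apply Rmult_le_pos; lra|lra]. }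
  assert (0 < k * D) by (apply Rmult_lt_0_compat; lra).
  lra.
Qed.

Lemma after_double i : s i = true -> s (S i) = false.
Proof. intros H. destruct (s (S i)) eqn:E; [exfalso; eauto using no_triple|reflexivity]. Qed.

(** [excess] at the first sign of a block, carried across the block on the forward side and one sign
    back on the backward side. *)
Lemma excess_double i : s (S i) = false -> s (S (S i)) = true ->
  - (D ^ 2 * (W (4 + i) - ws D)) * A2 <
  k * (D * (U (S i) - (1 - D + D ^ 2 * ws D))) * (2 - h - W (2 + i)).
Proof.
  intros S1 S2. pose proof (after_double _ S2) as S3.
  pose proof (excess _ _ (HA (2 + i)%nat)) as E.
  pose proof (HW (2 + i)%nat) as W2. pose proof (HW (3 + i)%nat) as W3.
  pose proof (HU (S i)) as U2. simpl in *. rewrite S1, S2, S3 in *. unfold sg in *.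
  replace (- (D * (D * 1) * (W (S (S (S (S i)))) - ws D))) with (W (S (S i)) - ws D); cycle 1.
  { rewrite W2, W3. rewrite (ws_eq D) at 1. ring. }
  replace (D * (U (S i) - (1 - D + D * (D * 1) * ws D))) with
    (1 - D * (1 - D + D * (D * 1) * ws D) - U (S (S i))) by (rewrite U2; ring).
  exact E.
Qed.

(** A lone sign between two blocks has a backward series nearly [2 D^2] below the critical one. The
    right side of [excess_double] is then negative of order [k D^3], and the left side, of order
    [D^4], cannot lie below it. *)
Lemma no_single i : s i = true -> s (1 + i)%nat = false -> s (2 + i)%nat = false ->
  s (3 + i)%nat = true -> False.
Proof.
  intros S0 S1 S2 S3. destruct numeric as (Hk & Hh & HD & HD2 & ED & HA1 & HA2 & Hw).
  pose proof (excess_double (1+i)%nat S2 S3) as E.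
  pose proof (HU i) as U1. pose proof (HU (1+i)%nat) as U2. simpl in *.
  rewrite S0, S1 in *. unfold sg in *.
  pose proof (BU i) as B0. pose proof (BW (S (S (S i)))) as B3.
  pose proof (BW (S (S (S (S (S i)))))) as B5.
  set (u := U (S (S i))) in *. set (w := W (S (S (S (S (S i)))))) in *. set (w' := W (S (S (S i)))) in *.
  assert (HDD : 0 < D * (D * 1)) by lra.
  assert (Lu : u - (1 - D + D * (D * 1) * ws D) <= - (19/10 * (D * (D * 1)))).
  { assert (D * (D * 1) * ws D >= D * (D*1) * 1) by (apply Rle_ge, Rmult_le_compat_l; lra).
    assert (D * (D * 1) * (9/10) <= D * (D*1) * U i) by (apply Rmult_le_compat_l; lra).
    rewrite U2, U1. lra. }
  assert (Lw : w - ws D <= 23/10 * (D * (D * 1))) by lra.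
  assert (X1 : k * (D * (u - (1 - D + D * (D * 1) * ws D))) * (2 - h - w') <=
     - (k * (D * (19/10 * (D * (D*1)))) * (66/100))).
  { replace (k * (D * (u - (1 - D + D * (D * 1) * ws D))) * (2 - h - w')) with
     (- (k * (D * - (u - (1 - D + D * (D * 1) * ws D))) * (2 - h - w'))) by ring.
    apply Ropp_le_contravar. apply Rmult_le_compat; try lra.
    - apply Rmult_le_pos; [lra|]. apply Rmult_le_pos; lra.
    - apply Rmult_le_compat_l; [lra|]. apply Rmult_le_compat_l; lra. }
  assert (X2 : - (D * (D * 1) * (23/10 * (D * (D * 1)))) <= - (D * (D * 1) * (w - ws D)) * A2).
  { assert (D * (D * 1) * (w - ws D) * A2 <= D * (D * 1) * (23/10 * (D * (D * 1))) * A2).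
    { apply Rmult_le_compat_r; [lra|]. apply Rmult_le_compat_l; lra. }
    assert (D * (D * 1) * (23/10 * (D * (D * 1))) * A2 <= D * (D * 1) * (23/10 * (D * (D * 1))) * 1).
    { apply Rmult_le_compat_l; [|lra]. apply Rmult_le_pos; lra. }
    lra. }
  assert (X3 : D * (D * 1) * (D * (D * 1)) <= 264/1000 * (k * (D * (D * (D*1))))).
  { replace (D * (D * 1) * (D * (D * 1))) with (h * (k * (D * (D * (D*1))))) by (unfold D; ring).
    apply Rmult_le_compat_r; [|lra]. apply Rmult_le_pos; [lra|]. apply Rmult_le_pos; lra. }
  assert (0 < k * (D * (D * (D*1)))).
  { apply Rmult_lt_0_compat; [lra|]. apply Rmult_lt_0_compat; lra. }
  lra.
Qed.

(** Three or more single signs before a block. The mechanism is that of [no_single], one power of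
    [D] further: order [k D^4] against order [D^5]. *)
Lemma no_four_changes i : s i = false -> s (1 + i)%nat = false -> s (2 + i)%nat = false ->
  s (3 + i)%nat = false -> s (4 + i)%nat = true -> False.
Proof.
  intros S0 S1 S2 S3 S4. destruct numeric as (Hk & Hh & HD & HD2 & ED & HA1 & HA2 & Hw).
  pose proof (excess_double (2+i)%nat S3 S4) as E.
  pose proof (HU i) as U1. pose proof (HU (1+i)%nat) as U2. pose proof (HU (2+i)%nat) as U3. simpl in *.
  rewrite S0, S1, S2 in *. unfold sg in *.
  pose proof (BU i) as B0. pose proof (BW (S (S (S (S i))))) as B4.
  set (w' := W (S (S (S (S i))))) in *. 
  assert (HDD : 0 < D * (D * 1)) by lra.
  set (u := U (S (S (S i)))) in *.
  assert (Lu : u - (1 - D + D * (D * 1) * ws D) <= - (D * (D * 1) * (18/10 * D))).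
  { replace (u - (1 - D + D * (D * 1) * ws D)) with (- (D * (D * 1) * (ws D - U (S i))))
      by (rewrite U3, U2; ring).
    apply Ropp_le_contravar, Rmult_le_compat_l; [lra|].
    assert (D * (1 - D - 12/10*D^2) <= D * U i) by (apply Rmult_le_compat_l; lra).
    assert (D * D^2 <= 56/1000*D^2) by (apply Rmult_le_compat_r; lra).
    lra. }
  set (w := W (S (S (S (S (S (S i))))))) in *.
  assert (Lw : w - ws D <= D * (D * 1) * (21/10 * D)).
  { pose proof (HW (6+i)%nat) as W6. pose proof (HW (7+i)%nat) as W7. simpl in W6, W7. fold w in W6.
    assert (B7 := BW (7+i)%nat). assert (B8 := BW (8+i)%nat). simpl in B7, B8.
    (* Either another block follows, which scales the deviation by [D^2], or the next sign changes
       and [w] is at most 1. *)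
    destruct (s (S (S (S (S (S (S i))))))) eqn:S6; unfold sg in W6.
    - rewrite (after_double _ S6) in W7. unfold sg in W7.
      replace (w - ws D) with (D * (D * 1) * (ws D - W (S (S (S (S (S (S (S (S i)))))))))).
      + apply Rmult_le_compat_l; lra.
      + rewrite W6, W7. rewrite (ws_eq D) at 2. ring.
    - assert (0 <= D * W (S (S (S (S (S (S (S i)))))))) by (apply Rmult_le_pos; lra).
      assert (0 <= D * (D * 1) * (21/10 * D)) by (apply Rmult_le_pos; lra). lra. }
  assert (X1 : k * (D * (u - (1 - D + D * (D * 1) * ws D))) * (2 - h - w') <=
     - (k * (D * (D * (D*1) * (18/10 * D))) * (66/100))).
  { assert (0 <= D * (D * 1) * (18/10*D)) by (apply Rmult_le_pos; lra).
    replace (k * (D * (u - (1 - D + D * (D * 1) * ws D))) * (2 - h - w')) with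
     (- (k * (D * - (u - (1 - D + D * (D * 1) * ws D))) * (2 - h - w'))) by ring.
    apply Ropp_le_contravar. apply Rmult_le_compat; try lra.
    - apply Rmult_le_pos; [lra|]. apply Rmult_le_pos; lra.
    - apply Rmult_le_compat_l; [lra|]. apply Rmult_le_compat_l; lra. }
  assert (X2 : - (D * (D * 1) * (D * (D * 1) * (21/10 * D))) <= - (D * (D * 1) * (w - ws D)) * A2).
  { assert (0 <= D * (D * 1) * (21/10*D)) by (apply Rmult_le_pos; lra).
    assert (D * (D * 1) * (w - ws D) * A2 <= D * (D * 1) * (D * (D * 1) * (21/10 * D)) * A2).
    { apply Rmult_le_compat_r; [lra|]. apply Rmult_le_compat_l; lra. }
    assert (D * (D * 1) * (D * (D * 1) * (21/10 * D)) * A2 <= D * (D * 1) * (D * (D * 1) * (21/10 * D)) * 1).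
    { apply Rmult_le_compat_l; [|lra]. apply Rmult_le_pos; lra. }
    lra. }
  assert (X3 : D * (D * 1) * (D * (D * 1) * D) <= 264/1000 * (k * (D * (D * (D*1) * D)))).
  { replace (D * (D * 1) * (D * (D * 1) * D)) with (h * (k * (D * (D * (D*1) * D)))) by (unfold D; ring).
    apply Rmult_le_compat_r; [|lra]. apply Rmult_le_pos; [lra|]. apply Rmult_le_pos; [lra|]. apply Rmult_le_pos; lra. }
  assert (0 < k * (D * (D * (D*1) * D))).
  { apply Rmult_lt_0_compat; [lra|]. apply Rmult_lt_0_compat; [lra|]. apply Rmult_lt_0_compat; lra. }
  lra.
Qed.

(** * Pairs of single signs and the blocks between them *)

Lemma boundary_sign (B1 B2 g x y : R) : 0 < B1 -> 0 < B2 -> 0 < g -> g * B1 < B2 ->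
  x < B1 -> y < B1 ->
  x * B2 < g * y * (B1 - x) -> y * B2 < g * x * (B1 - y) ->
  x < 0 /\ y < 0 /\ g * (- y) * B1 < - x * B2 /\ g * (- x) * B1 < - y * B2.
Proof.
  intros P1 P2 Pg Hg Hx Hy E1 E2.
  (* If [u >= 0], the first inequality makes [v] positive; since [g * B1 < B2], each of [u] and [v]
     would then be smaller than the other. *)
  assert (K : forall u v, u < B1 -> v < B1 -> u * B2 < g * v * (B1 - u) -> v * B2 < g * u * (B1 - v) -> u < 0).
  { intros u v Hu Hv F1 F2. apply Rnot_le_lt; intro N.
    assert (0 <= u * B2) by (apply Rmult_le_pos; lra).
    assert (Hv0 : 0 < v).
    { apply Rnot_le_lt; intro N'.
      assert (0 <= g * (- v) * (B1 - u)) by (apply Rmult_le_pos; [apply Rmult_le_pos|]; lra). lra. }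
    assert (g * v * u >= 0) by (apply Rle_ge, Rmult_le_pos; [apply Rmult_le_pos|]; lra).
    assert (v * (g * B1) < v * B2) by (apply Rmult_lt_compat_l; lra).
    assert (u * (g * B1) <= u * B2) by (apply Rmult_le_compat_l; lra).
    lra. }
  assert (x < 0) by (apply (K x y); assumption).
  assert (y < 0) by (apply (K y x); assumption).
  repeat split; try assumption.
  all: assert (0 <= g * (- y) * (- x)) by (apply Rmult_le_pos; [apply Rmult_le_pos|]; lra); lra.
Qed.

(** The signs [1 + i] and [2 + i] are the single pair. [HA] just after it and [HB] just before it
    give two inequalities, in which the three changes turn the deviation on one side into [D^3]
    times itself on the other. This coupling forces both deviations to be negative and compares them
    within the factor [k D^3]. *)
Lemma boundary i : s i = false -> s (1 + i)%nat = false -> s (2 + i)%nat = false ->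
  W (3 + i)%nat < ws D /\ U i < ws D /\
  k * D ^ 3 * (ws D - U i) * A1 < (ws D - W (3 + i)%nat) * A2 /\
  k * D ^ 3 * (ws D - W (3 + i)%nat) * A1 < (ws D - U i) * A2.
Proof.
  intros S0 S1 S2. destruct numeric as (Hk & Hh & HD & HD2 & ED & HA1 & HA2 & Hw).
  pose proof (excess _ _ (HA (3+i)%nat)) as E. pose proof (excess _ _ (HB i)) as E'.
  pose proof (HU i) as U1. pose proof (HU (1+i)%nat) as U2. pose proof (HU (2+i)%nat) as U3.
  pose proof (HW i) as W0. pose proof (HW (1+i)%nat) as W1. pose proof (HW (2+i)%nat) as W2.
  pose proof (BW (3+i)%nat) as BW3. pose proof (BU i) as BU0.
  simpl in S1, S2, U1, U2, U3, W0, W1, W2, E, BW3. rewrite S0, S1, S2 in *. unfold sg in *.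
  rewrite U3, U2, U1 in E. rewrite W0, W1, W2 in E'.
  set (w := W (S (S (S i)))) in *. set (u := U i) in *.
  assert (HD3 : 0 < D^3) by (apply pow_lt; lra).
  assert (g1 : k * D^3 <= 22/100 * (56/1000)).
  { apply Rmult_le_compat; try lra. assert (D^3 = D * D^2) as -> by ring.
    assert (D * D^2 <= 1 * D^2) by (apply Rmult_le_compat_r; lra). lra. }
  destruct (boundary_sign A1 A2 (k * D^3) (w - ws D) (u - ws D)) as (X & Y & Z & Z'); unfold A1 in *; try lra.
  - apply Rmult_lt_0_compat; lra.
  - assert (k * D^3 * (2 - h - ws D) <= (22/100*(56/1000)) * 1); [|lra].
    apply Rmult_le_compat; try lra. apply Rmult_le_pos; lra.
  - fold w u. change (W (3 + i)%nat) with w. repeat split; lra.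
Qed.

(** In terms of signs: [n] blocks of length two begin at [i] and are followed by two single signs,
    so the next gap begins at [i + 2 n + 2]. *)
Definition gap (i n : nat) : Prop := (1 <= n)%nat /\
  (forall j, (j < n)%nat -> s (i + 2 * j)%nat = true /\ s (S (i + 2 * j)) = false) /\
  s (i + 2 * n)%nat = false /\ s (S (i + 2 * n)) = false /\ s (S (S (i + 2 * n))) = true.

Lemma next_double i : s i = true -> (exists j, (i < j)%nat /\ s j = true) ->
  s (2 + i)%nat = true \/ (s (2 + i)%nat = false /\ s (3 + i)%nat = false /\ s (4 + i)%nat = true).
Proof.
  intros Si [j Hj].
  destruct (s (2 + i)%nat) eqn:E2; [left; reflexivity|right; split; [reflexivity|]].
  destruct (s (3 + i)%nat) eqn:E3.
  { exfalso. apply (no_single i); try assumption. apply (after_double _ Si). }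
  split; [reflexivity|]. destruct (s (4 + i)%nat) eqn:E4; [reflexivity|exfalso].
  pose proof (after_double _ Si) as E1.
  (* Four changes in a row propagate by [no_four_changes], so no later pair of equal signs could
     exist. *)
  assert (F : forall m, s (1 + m + i)%nat = false /\ s (2 + m + i)%nat = false /\
                        s (3 + m + i)%nat = false /\ s (4 + m + i)%nat = false).
  { induction m as [|m (F1 & F2 & F3 & F4)]; [auto|].
    repeat split; try assumption.
    destruct (s (4 + S m + i)%nat) eqn:E5; [exfalso|reflexivity].
    apply (no_four_changes (1 + m + i)%nat); assumption. }
  destruct (F (j - i - 1)%nat) as (F1 & _).
  replace (1 + (j - i - 1) + i)%nat with j in F1 by lia. destruct Hj; congruence.
Qed.

(** [ws D] is the fixed point of passing a block, and a block acts on the deviation from it as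
    multiplication by [- D^2]. *)
Lemma W_doubles i n : (forall j, (j < n)%nat -> s (i + 2 * j)%nat = true /\ s (S (i + 2 * j)) = false) ->
  W i - ws D = (- D ^ 2) ^ n * (W (i + 2 * n)%nat - ws D).
Proof.
  induction n as [|n IH]; intros H.
  - replace (i + 2 * 0)%nat with i by lia. simpl; ring.
  - rewrite IH by (intros; apply H; lia).
    destruct (H n (le_n _)) as [H1 H2].
    pose proof (HW (i + 2 * n)%nat) as E1. pose proof (HW (S (i + 2 * n))) as E2.
    rewrite H1 in E1; rewrite H2 in E2; unfold sg in *.
    replace (i + 2 * S n)%nat with (S (S (i + 2 * n))) by lia.
    rewrite E1, E2. change ((- D ^ 2) ^ S n) with (- D ^ 2 * (- D ^ 2) ^ n).
    rewrite (ws_eq D) at 1. ring.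
Qed.

Lemma U_doubles i n : (forall j, (j < n)%nat -> s (S i + 2 * j)%nat = true /\ s (S (S i + 2 * j)) = false) ->
  s i = false ->
  forall m, (m < n)%nat -> U (i + 2 * (S m))%nat - ws D = (- D ^ 2) ^ S m * (U i - ws D).
Proof.
  intros H Si. induction m as [|m IH]; intros Hm.
  - destruct (H 0%nat Hm) as [H1 _].
    pose proof (HU i) as E1. pose proof (HU (S i)) as E2. rewrite Si in E1.
    replace (S i + 2 * 0)%nat with (S i) in H1 by lia. rewrite H1 in E2. unfold sg in *.
    replace (i + 2 * 1)%nat with (S (S i)) by lia. rewrite E2, E1. rewrite (ws_eq D) at 1. ring.
  - destruct (H m ltac:(lia)) as [_ H1]. destruct (H (S m) Hm) as [H2 _].
    pose proof (HU (i + 2 * S m)%nat) as E1. pose proof (HU (S (i + 2 * S m))) as E2.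
    replace (S (S i + 2 * m)) with (i + 2 * S m)%nat in H1 by lia.
    replace (S i + 2 * S m)%nat with (S (i + 2 * S m)) in H2 by lia.
    rewrite H1 in E1; rewrite H2 in E2. unfold sg in *.
    replace (i + 2 * S (S m))%nat with (S (S (i + 2 * S m))) by lia.
    rewrite E2, E1. specialize (IH ltac:(lia)).
    change ((- D ^ 2) ^ S (S m)) with (- D ^ 2 * (- D ^ 2) ^ S m).
    transitivity (- D ^ 2 * (U (i + 2 * S m)%nat - ws D)); [rewrite (ws_eq D) at 1; ring|rewrite IH; ring].
Qed.

Lemma single_W i : s i = false -> 18/10 * D <= ws D - W i <= 21/10 * D.
Proof.
  intros H. destruct numeric as (Hk & Hh & HD & HD2 & ED & HA1 & HA2 & Hw).
  pose proof (HW i) as E. rewrite H in E. unfold sg in E. pose proof (BW (S i)).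
  assert (D * (1 - D - 12/10*D^2) <= D * W (S i) <= D * (1 + D + 12/10*D^2)) by (split; apply Rmult_le_compat_l; lra).
  assert (D * D^2 <= 56/1000*D^2) by (apply Rmult_le_compat_r; lra). lra.
Qed.

Lemma single_U i : s i = false -> 18/10 * D <= ws D - U (S i) <= 21/10 * D.
Proof.
  intros H. destruct numeric as (Hk & Hh & HD & HD2 & ED & HA1 & HA2 & Hw).
  pose proof (HU i) as E. rewrite H in E. unfold sg in E. pose proof (BU i).
  assert (D * (1 - D - 12/10*D^2) <= D * U i <= D * (1 + D + 12/10*D^2)) by (split; apply Rmult_le_compat_l; lra).
  assert (D * D^2 <= 56/1000*D^2) by (apply Rmult_le_compat_r; lra). lra.
Qed.

Lemma pow_neg_even n : Nat.Even n -> (- D ^ 2) ^ n = (D ^ 2) ^ n.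
Proof. intros [m ->]. rewrite !pow_mult. f_equal. ring. Qed.

Lemma pow_neg_odd n : Nat.Odd n -> (- D ^ 2) ^ n = - (D ^ 2) ^ n.
Proof.
  intros [m ->]. rewrite !pow_add, !pow_mult, !pow_1.
  replace ((- D^2)^2) with ((D^2)^2) by ring. ring.
Qed.

(** The deviation at the end of a gap is negative by [single_W], and each block reverses its
    sign. *)
Lemma gap_sign i n : gap i n -> W i < ws D -> Nat.Even n.
Proof.
  intros (Hn & Hd & S1 & S2 & S3) L.
  destruct (Nat.Even_or_Odd n) as [E|O]; [exact E|exfalso].
  pose proof (W_doubles i n Hd) as EW. rewrite (pow_neg_odd _ O) in EW.
  destruct (single_W _ S1) as [V _].
  destruct numeric as (Hk & Hh & HD & HD2 & ED & HA1 & HA2 & Hw).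
  assert (0 < (D^2)^n * (ws D - W (i + 2 * n)%nat)).
  { apply Rmult_lt_0_compat; [apply pow_lt; lra|lra]. }
  lra.
Qed.

(** Two additional blocks on one side cost [D^4], while [boundary] tolerates only [k D^3]; the
    quotient [h] contradicts the near equality of [v] and [v']. A single additional block costs only
    [D^2] and gives no contradiction, so the parity must be known first. *)
Lemma pow_gap n m v v' : (n + 2 <= m)%nat -> 0 <= v <= 21/10 * D -> 18/10 * D <= v' ->
  k * D ^ 3 * ((D ^ 2) ^ n * v') * A1 < (D ^ 2) ^ m * v * A2 -> False.
Proof.
  intros Hm Hv Hv' H. destruct numeric as (Hk & Hh & HD & HD2 & ED & HA1 & HA2 & Hw).
  set (q := (D^2)^n) in *. assert (Hq : 0 < q) by (apply pow_lt; lra).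
  assert (HD3 : 0 < D^3) by (apply pow_lt; lra).
  assert (Hq' : 0 < k * (D * D^3) * q).
  { apply Rmult_lt_0_compat; [apply Rmult_lt_0_compat; [lra|apply Rmult_lt_0_compat; lra]|lra]. }
  assert (E : (D^2)^m <= q * (D * D^3)).
  { replace m with (n + 2 + (m - n - 2))%nat by lia. rewrite !pow_add. fold q.
    replace ((D^2)^2) with (D * D^3) by ring.
    assert ((D^2)^(m-n-2) <= 1) by (rewrite <- (pow1 (m-n-2)); apply pow_incr; lra).
    assert (0 <= q * (D * D^3)) by (apply Rmult_le_pos; [lra|apply Rmult_le_pos; lra]).
    rewrite <- (Rmult_1_r (q * (D * D^3))) at 2. apply Rmult_le_compat_l; assumption. }
  assert (R1 : (D^2)^m * v * A2 <= (q * (D * D^3)) * (21/10*D) * 1).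
  { assert (0 <= (D^2)^m) by (apply pow_le; lra).
    apply Rmult_le_compat; try lra; [apply Rmult_le_pos; lra|apply Rmult_le_compat; lra]. }
  assert (R2 : k * D^3 * (q * (18/10 * D)) * (68/100) <= k * D ^ 3 * (q * v') * A1).
  { assert (0 <= k * D^3) by (apply Rmult_le_pos; lra).
    apply Rmult_le_compat; [apply Rmult_le_pos; [|apply Rmult_le_pos]; lra|lra| |lra].
    apply Rmult_le_compat_l; [lra|]. apply Rmult_le_compat_l; lra. }
  assert (R3 : (q * (D * D^3)) * D <= 264/1000 * (k * (D * D^3) * q)).
  { replace ((q * (D * D^3)) * D) with (h * (k * (D * D^3) * q)) by (unfold D; ring).
    apply Rmult_le_compat_r; lra. }
  lra.
Qed.

(** The single pair before a gap makes its deviation negative, hence its length even by [gap_sign];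
    the first of the three gaps supplies the pair before the second. At the pair between the second
    and the third, [boundary] compares [(D^2)^n1] with [(D^2)^n2], and distinct even lengths differ
    by at least 2. *)
Lemma gaps_eq i0 n0 i1 n1 i2 n2 : gap i0 n0 -> gap i1 n1 -> gap i2 n2 ->
  i1 = (i0 + 2 * n0 + 2)%nat -> i2 = (i1 + 2 * n1 + 2)%nat -> n1 = n2 /\ Nat.Even n1.
Proof.
  intros G0 G1 G2 E1 E2.
  destruct numeric as (Hk & Hh & HD & HD2 & ED & HA1 & HA2 & Hw).
  pose proof G0 as (H0 & D0 & P0 & Q0 & R0). pose proof G1 as (H1 & D1 & P1 & Q1 & R1).
  pose proof G2 as (H2 & D2 & P2 & Q2 & R2).
  assert (B1 : s (i1 - 3)%nat = false /\ s (i1 - 2)%nat = false /\ s (i1 - 1)%nat = false).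
  { replace (i1 - 3)%nat with (S (i0 + 2 * (n0 - 1))) by lia.
    replace (i1 - 2)%nat with (i0 + 2 * n0)%nat by lia.
    replace (i1 - 1)%nat with (S (i0 + 2 * n0))%nat by lia.
    repeat split; try assumption. apply D0; lia. }
  assert (B2 : s (i2 - 3)%nat = false /\ s (i2 - 2)%nat = false /\ s (i2 - 1)%nat = false).
  { replace (i2 - 3)%nat with (S (i1 + 2 * (n1 - 1))) by lia.
    replace (i2 - 2)%nat with (i1 + 2 * n1)%nat by lia.
    replace (i2 - 1)%nat with (S (i1 + 2 * n1))%nat by lia.
    repeat split; try assumption. apply D1; lia. }
  destruct B1 as (B11 & B12 & B13). destruct B2 as (B21 & B22 & B23).
  destruct (boundary (i1 - 3)%nat) as (X1 & _); try assumption.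
  { replace (1 + (i1 - 3))%nat with (i1 - 2)%nat by lia; assumption. }
  { replace (2 + (i1 - 3))%nat with (i1 - 1)%nat by lia; assumption. }
  destruct (boundary (i2 - 3)%nat) as (X2 & Y2 & Z2 & Z2'); try assumption.
  { replace (1 + (i2 - 3))%nat with (i2 - 2)%nat by lia; assumption. }
  { replace (2 + (i2 - 3))%nat with (i2 - 1)%nat by lia; assumption. }
  replace (3 + (i1 - 3))%nat with i1 in X1 by lia.
  replace (3 + (i2 - 3))%nat with i2 in X2, Z2, Z2' by lia.
  pose proof (gap_sign _ _ G1 X1) as Ev1. pose proof (gap_sign _ _ G2 X2) as Ev2.
  split; [|exact Ev1].
  pose proof (W_doubles i2 n2 D2) as EW. rewrite (pow_neg_even _ Ev2) in EW.
  assert (EU : U (i2 - 3)%nat - ws D = (D^2)^n1 * (U (i1 - 1)%nat - ws D)).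
  { rewrite <- (pow_neg_even _ Ev1).
    assert (EU : U (i1 - 1 + 2 * S (n1 - 1))%nat - ws D = (- D^2)^(S (n1 - 1)) * (U (i1 - 1)%nat - ws D)).
    { apply (U_doubles (i1 - 1) n1); [|assumption|lia].
      replace (S (i1 - 1)) with i1 by lia. exact D1. }
    replace (i1 - 1 + 2 * S (n1 - 1))%nat with (i2 - 3)%nat in EU by lia.
    replace (S (n1 - 1)) with n1 in EU by lia. exact EU. }
  destruct (single_W _ P2) as [V1 V2].
  destruct (single_U (i1 - 2)%nat B12) as [V3 V4]. replace (S (i1 - 2)) with (i1 - 1)%nat in V3, V4 by lia.
  set (v := ws D - W (i2 + 2 * n2)%nat) in *. set (v' := ws D - U (i1 - 1)%nat) in *.
  assert (Fw : ws D - W i2 = (D^2)^n2 * v) by (unfold v; lra).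
  assert (Fu : ws D - U (i2 - 3)%nat = (D^2)^n1 * v') by (unfold v'; lra).
  rewrite Fw, Fu in Z2, Z2'.
  destruct Ev1 as [e1 He1], Ev2 as [e2 He2].
  destruct (Nat.lt_trichotomy n1 n2) as [L|[L|L]]; [exfalso|exact L|exfalso].
  - apply (pow_gap n1 n2 v v'); lia || lra.
  - apply (pow_gap n2 n1 v' v); lia || lra.
Qed.

Lemma pow4 n : D ^ (4 * n) = (D ^ 2) ^ (2 * n).
Proof. rewrite <- pow_mult. f_equal. lia. Qed.

Lemma gap_exists i : s i = true -> (forall m, exists j, (m < j)%nat /\ s j = true) ->
  ~ (forall j, s (i + 2 * j)%nat = true) -> exists n, gap i n.
Proof.
  intros Si Inf N.
  assert (exists n, ~ s (i + 2 * n)%nat = true) as [n0 Hn0] by (apply not_all_ex_not; exact N).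
  assert (M : exists n, s (i + 2 * n)%nat = false /\ forall j, (j < n)%nat -> s (i + 2 * j)%nat = true).
  { clear N. induction n0 as [n IH] using lt_wf_ind.
    destruct (classic (exists m, (m < n)%nat /\ ~ s (i + 2 * m)%nat = true)) as [[m [Hm1 Hm2]]|Hno].
    - apply (IH m); assumption.
    - exists n. split; [destruct (s (i + 2 * n)%nat); congruence|].
      intros j Hj. apply NNPP; intro; apply Hno; eauto. }
  clear n0 Hn0. destruct M as [n [Sn Hn]]. exists n.
  assert (n <> 0)%nat by (intros ->; replace (i + 2 * 0)%nat with i in Sn by lia; congruence).
  split; [lia|]. split.
  { intros j Hj. split; [apply Hn; exact Hj|]. apply after_double, Hn, Hj. }
  pose proof (Hn (n - 1)%nat ltac:(lia)) as Sl.
  destruct (next_double _ Sl) as [X|(X & Y & Z)].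
  - destruct (Inf (i + 2 * (n - 1))%nat) as [j Hj]. exists j; exact Hj.
  - replace (2 + (i + 2 * (n - 1)))%nat with (i + 2 * n)%nat in X by lia. congruence.
  - replace (3 + (i + 2 * (n - 1)))%nat with (S (i + 2 * n))%nat in Y by lia.
    replace (4 + (i + 2 * (n - 1)))%nat with (S (S (i + 2 * n)))%nat in Z by lia. auto.
Qed.

Lemma letters_tail : exists i, W i = ws D \/ exists n, W i = wz D n.
Proof.
  destruct numeric as (Hk & Hh & HD & HD2 & ED & HA1 & HA2 & Hw).
  destruct (classic (forall m, exists j, (m < j)%nat /\ s j = true)) as [Inf|Fin].
  2: {
    apply not_all_ex_not in Fin as [m Hm].
    assert (F : forall j, s (S m + j)%nat = false).
    { intros j. destruct (s (S m + j)%nat) eqn:E; [|reflexivity].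
      exfalso; apply Hm. exists (S m + j)%nat; split; [lia|exact E]. }
    (* Alternation is the case of [wz] with no block between the pairs. *)
    exists (S m). right. exists 0%nat.
    assert (Z : W (S m) - wz D 0 = 0).
    { replace (S m) with (S m + 0)%nat by lia.
      apply (contraction_zero (fun j => W (S m + j)%nat - wz D 0)).
      - intros j. pose proof (BW (S m + j)%nat). pose proof (wz_bounds D 0 HD).
        assert (0 < D^2 * ws D <= D^2 * (1056/1000)).
        { split; [apply Rmult_lt_0_compat; lra| apply Rmult_le_compat_l; lra]. }
        apply Rabs_le. lra.
      - intros j. pose proof (HW (S m + j)%nat) as E. rewrite F in E. unfold sg in E.
        replace (S (S m + j)) with (S m + S j)%nat in E by lia.
        pose proof (wz_eq D 0 HD) as E0. simpl pow in E0.
        assert (E1 : wz D 0 = 1 - D * wz D 0).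
        { apply (Rmult_eq_reg_r (1 - D)); [|lra]. lra. }
        replace (W (S m + j)%nat - wz D 0) with (- D * (W (S m + S j)%nat - wz D 0)) by lra.
        rewrite Rabs_mult, Rabs_Ropp, (Rabs_pos_eq D) by lra.
        apply Rmult_le_compat_r; [apply Rabs_pos|lra]. }
    lra. }
  destruct (classic (exists i, s i = true /\ forall j, s (i + 2 * j)%nat = true)) as [[i [Si Hi]]|NoD].
  { exists i; left.
    assert (Z : W i - ws D = 0).
    { replace i with (i + 2 * 0)%nat by lia.
      apply (contraction_zero (fun j => W (i + 2 * j)%nat - ws D)).
      - intros j. pose proof (BW (i + 2 * j)%nat). apply Rabs_le. lra.
      - intros j. pose proof (W_doubles (i + 2 * j)%nat 1) as E.
        replace (i + 2 * j + 2 * 1)%nat with (i + 2 * S j)%nat in E by lia. rewrite E.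
        + rewrite Rabs_mult. apply Rmult_le_compat_r; [apply Rabs_pos|].
          rewrite pow_1, Rabs_Ropp, Rabs_pos_eq; lra.
        + intros j' Hj'. replace j' with 0%nat by lia.
          replace (i + 2 * j + 2 * 0)%nat with (i + 2 * j)%nat by lia.
          split; [apply Hi|apply after_double, Hi]. }
    lra. }
  assert (GE : forall i, s i = true -> exists n, gap i n).
  { intros i Si. apply gap_exists; [exact Si|exact Inf|].
    intros H. apply NoD; eauto. }
  destruct (Inf 0%nat) as [i0 [_ S0]].
  destruct (GE _ S0) as [n0 G0].
  set (i1 := (i0 + 2 * n0 + 2)%nat).
  assert (S1 : s i1 = true).
  { destruct G0 as (_ & _ & _ & _ & R). replace i1 with (S (S (i0 + 2 * n0))) by (unfold i1; lia). exact R. }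
  destruct (GE _ S1) as [n1 G1].
  set (ii := fun m => (i1 + m * (2 * n1 + 2))%nat).
  (* The length is constant from the second gap on. Two adjacent gaps are carried through the
     induction because [gaps_eq] consumes them to treat the next one. *)
  assert (GA : forall m, gap (ii m) n1 /\ gap (ii (S m)) n1 /\ Nat.Even n1).
  { assert (St : forall j i n, gap i n -> forall i' n', i' = (i + 2 * n + 2)%nat -> gap i' n' ->
        j = (i' + 2 * n' + 2)%nat -> gap j n' /\ Nat.Even n').
    { intros j i n G i' n' E G' E'.
      assert (Sj : s j = true).
      { destruct G' as (_ & _ & _ & _ & R). replace j with (S (S (i' + 2 * n'))) by lia. exact R. }
      destruct (GE _ Sj) as [nj Gj].
      destruct (gaps_eq i n i' n' j nj G G' Gj E E') as [-> Ev]. auto. }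
    induction m as [|m (I1 & I2 & I3)].
    - assert (ii 0%nat = i1) as E0 by (unfold ii; lia). rewrite E0. split; [exact G1|].
      apply (St _ i0 n0 G0 i1 n1); [reflexivity|exact G1|unfold ii; lia].
    - split; [exact I2|].
      apply (St _ (ii m) n1 I1 (ii (S m)) n1); [unfold ii; lia|exact I2|unfold ii; lia]. }
  destruct (GA 0%nat) as (_ & _ & [e He]).
  (* The series is read at the first sign of a single pair, where it equals [wz D e]; [wt] is its
     value at the start of the following gap. *)
  exists (i1 + 2 * n1)%nat. right. exists e.
  set (wt := ws D + D ^ (4 * e) * (wz D e - ws D)).
  assert (Ez : wz D e = 1 - D + D^2 * wt) by (apply wz_eq; exact HD).
  assert (Pe : 0 <= D ^ (4 * e) <= 1) by (apply pow_unit; lra).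
  assert (Step : forall m, W (ii m + 2 * n1)%nat = 1 - D + D^2 * W (ii (S m)) /\
    W (ii m) - wt = D ^ (4 * e) * D^2 * (W (ii (S m)) - wt)).
  { intros m. destruct (GA m) as ((_ & Dd & P & Q & _) & _).
    pose proof (HW (ii m + 2 * n1)%nat) as E1. pose proof (HW (S (ii m + 2 * n1))) as E2.
    rewrite P in E1; rewrite Q in E2. unfold sg in *.
    replace (S (S (ii m + 2 * n1))) with (ii (S m)) in E2 by (unfold ii; lia).
    pose proof (W_doubles _ _ Dd) as Ed. rewrite He in Ed at 1.
    rewrite pow_neg_even in Ed by (exists e; reflexivity). rewrite <- pow4 in Ed.
    assert (E3 : W (ii m + 2 * n1)%nat = 1 - D + D^2 * W (ii (S m))) by (rewrite E1, E2; ring).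
    split; [exact E3|].
    rewrite E3 in Ed. unfold wt at 1. rewrite Ez at 1.
    replace (W (ii m)) with (ws D + D ^ (4 * e) * (1 - D + D ^ 2 * W (ii (S m)) - ws D)) by lra. ring. }
  pose proof (wz_bounds D e HD) as Bz.
  assert (0 < D^2 * ws D <= D^2 * (1056/1000)).
  { split; [apply Rmult_lt_0_compat; lra| apply Rmult_le_compat_l; lra]. }
  assert (Z : W (ii 0%nat) - wt = 0).
  { apply (contraction_zero (fun m => W (ii m) - wt)).
    - intros m. pose proof (BW (ii m)). apply Rabs_le.
      assert (9/10 <= wt <= 11/10); [|lra]. unfold wt.
      assert (0 <= D ^ (4 * e) * (ws D - wz D e) <= 1 * (ws D - wz D e)).
      { split; [apply Rmult_le_pos; lra|apply Rmult_le_compat_r; lra]. }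
      lra.
    - intros m. destruct (Step m) as [_ ->].
      rewrite Rabs_mult. apply Rmult_le_compat_r; [apply Rabs_pos|].
      rewrite Rabs_pos_eq by (apply Rmult_le_pos; lra).
      assert (D ^ (4 * e) * D ^ 2 <= 1 * D^2) by (apply Rmult_le_compat_r; lra). lra. }
  destruct (Step 0%nat) as [F1 F2]. rewrite Z in F2.
  replace (ii 0%nat) with i1 in F1 by (unfold ii; lia).
  rewrite F1, Ez. symmetry in F2. apply Rmult_integral in F2 as [F2|F2].
  - assert (0 < D ^ (4 * e) * D^2); [|lra].
    apply Rmult_lt_0_compat; [apply pow_lt; lra|lra].
  - replace (W (ii 1%nat)) with wt by lra. reflexivity.
Qed.
End Letters.

(** * Lower bound for a family of grids *)

(* Twice [gamma + p - q h] for [gamma = (1 - h + X) / 2]: q stands for n and p for m in [|n eta - m - gamma|]. *)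
Definition Xf (h X : R) (p q : Z) : R := 1 - h + X + 2 * IZR p - 2 * h * IZR q.
Definition Pr (h k X Y : R) (p q : Z) : R := Xf h X p q * Xf k Y q p.

Lemma Pr_swap h k X Y p q : Pr h k X Y p q = Pr k h Y X q p.
Proof. unfold Pr; ring. Qed.

(** The index change of one digit. Here [d] is the digit before centring and doubling; the two
    coordinates are rescaled by reciprocal factors, which is why the product survives. *)
Lemma move_factors A h k X Y X' Y' T d p q : IZR A * h = 1 + h * k ->
  X = h * (IZR T + Y') -> X' = h * (IZR T + Y) -> (2 * d = A - 2 + T)%Z ->
  Xf h X p q = h * Xf k Y' (A * p - q + d) p /\
  h * Xf k Y q p = Xf h X' p (A * p - q + d).
Proof.
  intros HA -> -> Hd. apply (f_equal IZR) in Hd.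
  rewrite plus_IZR, minus_IZR, mult_IZR in Hd.
  unfold Xf. rewrite plus_IZR, minus_IZR, mult_IZR.
  replace (IZR T) with (2 * IZR d - IZR A + 2) by lra.
  assert (E : IZR A * h * IZR p = (1 + h * k) * IZR p) by (rewrite HA; reflexivity).
  split; lra.
Qed.

Lemma move_Pr A h k X Y X' Y' T d p q : h <> 0 -> IZR A * h = 1 + h * k ->
  X = h * (IZR T + Y') -> X' = h * (IZR T + Y) -> (2 * d = A - 2 + T)%Z ->
  Pr h k X Y p q = Pr h k X' Y' p (A * p - q + d).
Proof.
  intros Hh HA E E' Hd.
  destruct (move_factors A h k X Y X' Y' T d p q HA E E' Hd) as [F1 F2].
  unfold Pr. rewrite F1, <- F2. ring.
Qed.

Lemma concave_between h A B q0 q q1 V : 0 <= h -> q0 <= q <= q1 ->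
  V <= (A - 2 * h * q0) * (B + 2 * q0) -> V <= (A - 2 * h * q1) * (B + 2 * q1) ->
  V <= (A - 2 * h * q) * (B + 2 * q).
Proof.
  intros Hh Hq H0 H1.
  destruct (Req_dec q0 q1) as [E|N]; [replace q with q0 by lra; assumption|].
  apply (Rmult_le_reg_r (q1 - q0)); [lra|].
  assert (V * (q1 - q) <= (A - 2 * h * q0) * (B + 2 * q0) * (q1 - q)) by (apply Rmult_le_compat_r; lra).
  assert (V * (q - q0) <= (A - 2 * h * q1) * (B + 2 * q1) * (q - q0)) by (apply Rmult_le_compat_r; lra).
  assert (0 <= 4 * h * ((q1 - q0) * ((q - q0) * (q1 - q)))).
  { apply Rmult_le_pos; [lra|]. apply Rmult_le_pos; [lra|]. apply Rmult_le_pos; lra. }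
  lra.
Qed.

Lemma diag_le h k X Y p V : 0 < h < 1 -> 0 < k < 1 -> 0 < 1 - h + X -> 0 < 1 - k + Y ->
  (0 <= p)%Z -> V <= (1 - h + X) * (1 - k + Y) -> V <= Pr h k X Y p p.
Proof.
  intros Hh Hk HX HY Hp HV. apply IZR_le in Hp.
  eapply Rle_trans; [exact HV|]. unfold Pr, Xf.
  assert (0 <= IZR p * (1 - h)) by (apply Rmult_le_pos; lra).
  assert (0 <= IZR p * (1 - k)) by (apply Rmult_le_pos; lra).
  apply Rmult_le_compat; lra.
Qed.

(** For fixed [p] the product is concave in [q]. One end of the segment is the diagonal point of
    this cell, the other becomes the diagonal point of the next cell, and [diag_le] compares each
    with the corner (0,0) of its cell. *)
Lemma ray_le A h k X Y X' Y' T d p q V : 0 < h < 1 -> 0 < k < 1 -> IZR A * h = 1 + h * k ->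
  X = h * (IZR T + Y') -> X' = h * (IZR T + Y) -> (2 * d = A - 2 + T)%Z ->
  0 < 1 - h + X -> 0 < 1 - k + Y -> 0 < 1 - h + X' -> 0 < 1 - k + Y' ->
  V <= (1 - h + X) * (1 - k + Y) -> V <= (1 - h + X') * (1 - k + Y') ->
  (0 <= p <= q)%Z -> (p <= A * p - q + d)%Z -> V <= Pr h k X Y p q.
Proof.
  intros Hh Hk HA E E' Hd HX HY HX' HY' HV HV' Hp Hq.
  pose proof (diag_le h k X Y p V Hh Hk HX HY ltac:(lia) HV) as D0.
  pose proof (diag_le h k X' Y' p V Hh Hk HX' HY' ltac:(lia) HV') as D1.
  assert (E1 : Pr h k X' Y' p p = Pr h k X Y p (A * p - p + d)).
  { rewrite (move_Pr A h k X Y X' Y' T d p (A * p - p + d)); try assumption; [|lra].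
    f_equal. lia. }
  rewrite E1 in D1. unfold Pr, Xf in *.
  replace ((1 - h + X + 2 * IZR p - 2 * h * IZR q) * (1 - k + Y + 2 * IZR q - 2 * k * IZR p))
    with ((1 - h + X + 2 * IZR p - 2 * h * IZR q) * ((1 - k + Y - 2 * k * IZR p) + 2 * IZR q)) by ring.
  apply (concave_between h _ _ (IZR p) _ (IZR (A * p - p + d))); [lra| |lra|lra].
  split; apply IZR_le; lia.
Qed.

(** When the indices have opposite signs, both factors grow in modulus away from the corner
    (0,-1). *)
Lemma mixed_le h k X Y p q V : 0 < h < 1 -> 0 < k < 1 -> 0 < 1 + h + X -> 0 < 1 + k - Y ->
  (0 <= p)%Z -> (q <= -1)%Z -> V <= (1 + h + X) * (1 + k - Y) -> V <= Rabs (Pr h k X Y p q).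
Proof.
  intros Hh Hk HX HY Hp Hq HV. apply IZR_le in Hp, Hq.
  eapply Rle_trans; [exact HV|]. unfold Pr, Xf.
  assert (0 <= h * (- 1 - IZR q)) by (apply Rmult_le_pos; lra).
  assert (0 <= k * IZR p) by (apply Rmult_le_pos; lra).
  rewrite Rabs_mult. rewrite (Rabs_pos_eq (1 - h + X + _ - _)) by lra.
  rewrite (Rabs_left1 (1 - k + Y + _ - _)) by lra.
  apply Rmult_le_compat; lra.
Qed.

(** The non-strict form of [corners], needed because [V] will be a minimum attained at a corner. *)
Record lcorners (h k X Y V : R) : Prop := {
  lc1 : V <= (1 - h + X) * (1 - k + Y);
  lc2 : V <= (1 + h + X) * (1 + k - Y);
  lc3 : V <= (1 + h - X) * (1 + k + Y);
  lc4 : V <= (1 - h - X) * (1 - k - Y);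
  lcX : - (1 - h) < X < 1 - h;
  lcY : - (1 - k) < Y < 1 - k }.

(** [S] stands for the cells of a two-sided sequence. [HT] crosses the even digit next to a cell and
    [HU] the odd one, so from any cell one of them leads forwards and the other backwards. *)
Section LowerBound.
Variables (a b : Z) (h k V : R) (S : R -> R -> Prop).
Hypothesis Hh : 0 < h < 1.
Hypothesis Hk : 0 < k < 1.
Hypothesis Ha : IZR a * h = 1 + h * k.
Hypothesis Hb : IZR b * k = 1 + h * k.
Hypothesis HT : forall X Y, S X Y -> exists T d X' Y', (2 * d = a - 2 + T)%Z /\
  X = h * (IZR T + Y') /\ X' = h * (IZR T + Y) /\ S X' Y'.
Hypothesis HU : forall X Y, S X Y -> exists T d X' Y', (2 * d = b - 2 + T)%Z /\
  Y = k * (IZR T + X') /\ Y' = k * (IZR T + X) /\ S X' Y'.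
Hypothesis HC : forall X Y, S X Y -> lcorners h k X Y V.
Hypothesis HN : forall X Y, S X Y -> S (- X) (- Y).

Lemma mixed_le' X Y p q : S X Y -> (0 <= p /\ q <= -1 \/ p <= -1 /\ 0 <= q)%Z -> V <= Rabs (Pr h k X Y p q).
Proof.
  intros HS [[Hp Hq]|[Hp Hq]]; destruct (HC _ _ HS).
  - apply mixed_le; lra || assumption.
  - rewrite Pr_swap. apply mixed_le; lra || assumption.
Qed.

(** Descent on [p + q]: the larger index is replaced by its image under the digit on that side.
    Either the point lies on the segment of [ray_le], or the new index falls below the smaller one,
    possibly to a negative value where [mixed_le'] applies. *)
Lemma nonneg_le n X Y p q : S X Y -> (0 <= p)%Z -> (0 <= q)%Z -> (p + q <= Z.of_nat n)%Z ->
  V <= Rabs (Pr h k X Y p q).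
Proof.
  revert X Y p q. induction n as [n IH] using (well_founded_induction lt_wf).
  intros X Y p q HS Hp Hq Hn. destruct (HC _ _ HS) as [C1 C2 C3 C4 CX CY].
  destruct (Z_le_gt_dec p q) as [L|L].
  - destruct (HT _ _ HS) as (T & d & X' & Y' & Ed & EX & EX' & HS').
    destruct (HC _ _ HS') as [C1' C2' C3' C4' CX' CY'].
    destruct (Z_le_gt_dec p (a * p - q + d)) as [G|G].
    { eapply Rle_trans; [|apply Rle_abs].
      apply (ray_le a h k X Y X' Y' T d p q V); try assumption; lra || lia. }
    rewrite (move_Pr a h k X Y X' Y' T d p q); try assumption; [|lra].
    destruct (Z_le_gt_dec 0 (a * p - q + d)) as [G0|G0].
    + apply (IH (Z.to_nat (p + (a * p - q + d)))); try assumption; lia.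
    + apply mixed_le'; [assumption|lia].
  - rewrite Pr_swap.
    destruct (HU _ _ HS) as (T & d & X' & Y' & Ed & EX & EX' & HS').
    destruct (HC _ _ HS') as [C1' C2' C3' C4' CX' CY'].
    assert (Hb' : IZR b * k = 1 + k * h) by lra.
    destruct (Z_le_gt_dec q (b * q - p + d)) as [G|G].
    { eapply Rle_trans; [|apply Rle_abs].
      apply (ray_le b k h Y X Y' X' T d q p V); try assumption; lra || lia. }
    rewrite (move_Pr b k h Y X Y' X' T d q p); try assumption; [|lra].
    rewrite <- Pr_swap.
    destruct (Z_le_gt_dec 0 (b * q - p + d)) as [G0|G0].
    + apply (IH (Z.to_nat (q + (b * q - p + d)))); try assumption; lia.
    + apply mixed_le'; [assumption|lia].
Qed.

Lemma Pr_neg X Y p q : Pr h k X Y p q = Pr h k (- X) (- Y) (- 1 - p) (- 1 - q).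
Proof. unfold Pr, Xf. rewrite !minus_IZR. ring. Qed.

Lemma grid_lower X Y p q : S X Y -> V <= Rabs (Pr h k X Y p q).
Proof.
  intros HS.
  destruct (Z_le_gt_dec 0 p), (Z_le_gt_dec 0 q).
  - apply (nonneg_le (Z.to_nat (p + q))); try assumption; lia.
  - apply mixed_le'; [assumption|lia].
  - apply mixed_le'; [assumption|lia].
  - rewrite Pr_neg. apply (nonneg_le (Z.to_nat (- 1 - p + (- 1 - q)))); [apply HN; assumption|lia..].
Qed.

End LowerBound.

(** * The limit inferior and the grid *)

Lemma nint_dist_le t m : nint_dist t <= Rabs (t - IZR m).
Proof.
  unfold nint_dist. destruct (base_Int_part t) as [H1 H2].
  destruct (Z_le_gt_dec m (Int_part t)) as [L|L].
  - apply IZR_le in L. eapply Rle_trans; [apply Rmin_l|].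
    rewrite Rabs_pos_eq; lra.
  - assert (L' : (Int_part t + 1 <= m)%Z) by lia. apply IZR_le in L'. rewrite plus_IZR in L'.
    eapply Rle_trans; [apply Rmin_r|]. rewrite Rabs_left1; lra.
Qed.

Lemma nint_dist_ex t : exists m, nint_dist t = Rabs (t - IZR m).
Proof.
  unfold nint_dist. destruct (base_Int_part t) as [H1 H2].
  destruct (Rle_dec (t - IZR (Int_part t)) (IZR (Int_part t) + 1 - t)).
  - exists (Int_part t). rewrite Rmin_left, Rabs_pos_eq; lra.
  - exists (Int_part t + 1)%Z. rewrite plus_IZR, Rmin_right, Rabs_left1; lra.
Qed.

Lemma is_liminf_Z_unique f L1 L2 : is_liminf_Z f L1 -> is_liminf_Z f L2 -> L1 = L2.
Proof.
  assert (K : forall L1 L2, is_liminf_Z f L1 -> is_liminf_Z f L2 -> L1 <= L2).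
  { clear. intros L1 L2 [_ H1] [H2 _]. apply Rnot_lt_le; intro N.
    destruct (H1 ((L1 - L2) / 2) ltac:(lra)) as [M HM].
    destruct (H2 ((L1 - L2) / 2) ltac:(lra) M) as [n [Hn1 Hn2]].
    specialize (HM n Hn1). lra. }
  intros H1 H2. apply Rle_antisym; apply K; assumption.
Qed.

Lemma M_eq alpha gamma L :
  is_liminf_Z (fun n => Rabs (IZR n) * nint_dist (IZR n * alpha - gamma)) L -> M alpha gamma = L.
Proof.
  intros H. apply (is_liminf_Z_unique _ _ _ (epsilon_spec (inhabits 0) _ (ex_intro _ L H)) H).
Qed.

(** Being far out is expressed by a small first coordinate instead of a large [q]: digit moves
    merely rescale that coordinate, and [Y] then has no influence on the limit. *)
Definition ev_above (h k X Y c : R) : Prop :=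
  exists d, 0 < d /\ forall p q, Rabs (Xf h X p q) < d -> c < Rabs (Pr h k X Y p q).

Definition grid_liminf (h k X Y L : R) : Prop :=
  (forall c, c < L -> ev_above h k X Y c) /\ (forall c, L < c -> ~ ev_above h k X Y c).

Lemma ev_above_mono h k X Y c c' : c' <= c -> ev_above h k X Y c -> ev_above h k X Y c'.
Proof. intros Hc [d [Hd H]]. exists d; split; [assumption|]. intros p q Hp. specialize (H p q Hp). lra. Qed.

Lemma grid_liminf_unique h k X Y L L' : grid_liminf h k X Y L -> grid_liminf h k X Y L' -> L = L'.
Proof.
  intros [H1 H2] [H1' H2']. destruct (Rtotal_order L L') as [G|[G|G]]; [exfalso|assumption|exfalso].
  - apply (H2 ((L + L') / 2)); [lra|]. apply H1'; lra.
  - apply (H2' ((L + L') / 2)); [lra|]. apply H1; lra.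
Qed.

Lemma grid_liminf_exists h k X Y C : ~ ev_above h k X Y C -> exists L, grid_liminf h k X Y L.
Proof.
  intros HC.
  destruct (completeness (ev_above h k X Y)) as [L [HL1 HL2]].
  - exists C. intros c Hc. apply Rnot_lt_le; intro N. apply HC. apply (ev_above_mono _ _ _ _ c); [lra|assumption].
  - exists (-1). exists 1. split; [lra|]. intros p q _. pose proof (Rabs_pos (Pr h k X Y p q)). lra.
  - exists L. split.
    + intros c Hc. apply NNPP; intro N.
      assert (L <= c); [|lra]. apply HL2. intros c' Hc'. apply Rnot_lt_le; intro N'.
      apply N. apply (ev_above_mono _ _ _ _ c'); [lra|assumption].
    + intros c Hc N. specialize (HL1 c N). lra.
Qed.

Section Liminf.
Variables (h k X Y : R).
Hypothesis Hh : 0 < h.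
Hypothesis Hk : 0 < k.
Hypothesis HD : h * k < 1.
Let g := (1 - h + X) / 2.
Hypothesis nonlattice : ~ (exists p q : Z, g = IZR p + IZR q * h).
Let K := Rabs (1 - k + Y + k * (1 - h + X)).

Lemma Xf_dist p q : Rabs (Xf h X p q) = 2 * Rabs ((IZR q * h - g) - IZR p).
Proof.
  replace (Xf h X p q) with (- (2 * ((IZR q * h - g) - IZR p))) by (unfold Xf, g; field).
  rewrite Rabs_Ropp, Rabs_mult, (Rabs_pos_eq 2) by lra. reflexivity.
Qed.

Lemma Xf_pos p q : 0 < Rabs (Xf h X p q).
Proof.
  apply Rabs_pos_lt. intros E. apply nonlattice. exists (- p)%Z, q.
  unfold Xf, g in *. rewrite opp_IZR. lra.
Qed.

(** So a small [|Xf|] forces a large [|q|]: for each [q] the distance to the integers is positive,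
    the point not being in the lattice. *)
Lemma Xf_bounded_below N : exists d, 0 < d /\ forall p q, (Z.abs q <= Z.of_nat N)%Z -> d <= Rabs (Xf h X p q).
Proof.
  assert (One : forall q, exists d, 0 < d /\ forall p, d <= Rabs (Xf h X p q)).
  { intros q. exists (2 * nint_dist (IZR q * h - g)). split.
    - destruct (nint_dist_ex (IZR q * h - g)) as [m Hm]. rewrite Hm.
      pose proof (Xf_pos m q) as P. rewrite Xf_dist in P. exact P.
    - intros p. rewrite Xf_dist. apply Rmult_le_compat_l; [lra|apply nint_dist_le]. }
  induction N as [|N [d [Hd IH]]].
  - destruct (One 0%Z) as [d [Hd H]]. exists d. split; [assumption|].
    intros p q Hq. assert (q = 0%Z) as -> by lia. apply H.
  - destruct (One (Z.of_nat (S N))) as [d1 [Hd1 H1]]. destruct (One (- Z.of_nat (S N))%Z) as [d2 [Hd2 H2]].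
    exists (Rmin d (Rmin d1 d2)). split; [repeat apply Rmin_glb_lt; assumption|].
    intros p q Hq.
    assert (Z.abs q <= Z.of_nat N \/ q = Z.of_nat (S N) \/ q = - Z.of_nat (S N))%Z as [C|[->| ->]] by lia.
    + eapply Rle_trans; [apply Rmin_l|]. apply IH; assumption.
    + eapply Rle_trans; [apply Rmin_r|]. eapply Rle_trans; [apply Rmin_l|]. apply H1.
    + eapply Rle_trans; [apply Rmin_r|]. eapply Rle_trans; [apply Rmin_r|]. apply H2.
Qed.

(** The second factor is [2 (1 - D) q] plus a constant minus [k Xf]. Together with the factor 2 in
    [Xf_dist] this produces the normalisation [4 (1 - D)]. *)
Lemma Pr_vs_q p q :
  Rabs (Rabs (Pr h k X Y p q) - 2 * (1 - h * k) * Rabs (IZR q) * Rabs (Xf h X p q)) <=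
  Rabs (Xf h X p q) * (K + k * Rabs (Xf h X p q)).
Proof.
  assert (E : Xf k Y q p = 2 * (1 - h * k) * IZR q + (1 - k + Y + k * (1 - h + X) - k * Xf h X p q)).
  { unfold Xf. ring. }
  unfold Pr. rewrite Rabs_mult, E.
  set (x := Rabs (Xf h X p q)). set (u := 2 * (1 - h * k) * IZR q).
  set (v := 1 - k + Y + k * (1 - h + X) - k * Xf h X p q).
  assert (Eu : Rabs u = 2 * (1 - h * k) * Rabs (IZR q)).
  { unfold u. rewrite Rabs_mult, (Rabs_pos_eq (2 * _)) by lra. reflexivity. }
  replace (x * Rabs (u + v) - 2 * (1 - h * k) * Rabs (IZR q) * x) with (x * (Rabs (u + v) - Rabs u)) by (rewrite Eu; ring).
  assert (x0 : 0 <= x) by apply Rabs_pos.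
  rewrite Rabs_mult, (Rabs_pos_eq x) by assumption.
  apply Rmult_le_compat_l; [assumption|].
  eapply Rle_trans; [apply Rabs_triang_inv2|].
  replace (u + v - u) with v by ring. unfold v, K.
  eapply Rle_trans; [apply Rabs_triang|]. rewrite Rabs_Ropp, Rabs_mult, (Rabs_pos_eq k) by lra.
  apply Rle_refl.
Qed.

Lemma small_error eps : 0 < eps -> exists d, 0 < d /\ forall t, 0 <= t < d -> t * (K + k * t) < eps.
Proof.
  intros He. assert (K0 : 0 <= K) by apply Rabs_pos.
  exists (Rmin 1 (eps / (K + k + 1))).
  assert (0 < eps / (K + k + 1)) by (apply Rdiv_lt_0_compat; lra).
  split; [apply Rmin_glb_lt; lra|].
  intros t [H0 H1].
  assert (t < 1) by (eapply Rlt_le_trans; [exact H1|apply Rmin_l]).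
  assert (t < eps / (K + k + 1)) by (eapply Rlt_le_trans; [exact H1|apply Rmin_r]).
  assert (k * t <= k * 1) by (apply Rmult_le_compat_l; lra).
  apply Rle_lt_trans with (t * (K + k + 1)).
  - apply Rmult_le_compat_l; lra.
  - apply (Rmult_lt_compat_r (K + k + 1)) in H3; [|lra].
    unfold Rdiv in H3. rewrite Rmult_assoc, Rinv_l in H3; lra.
Qed.

Lemma liminf_of_grid L : grid_liminf h k X Y L ->
  is_liminf_Z (fun n => Rabs (IZR n) * nint_dist (IZR n * h - g)) (L / (4 * (1 - h * k))).
Proof.
  intros [H1 H2]. set (w := 4 * (1 - h * k)). assert (Hw : 0 < w) by (unfold w; lra).
  split; intros eps He.
  - intros N.
    destruct (small_error (w * eps / 2)) as [d1 [Hd1 E1]]; [apply Rdiv_lt_0_compat; [apply Rmult_lt_0_compat; lra|lra]|].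
    destruct (Xf_bounded_below (Z.to_nat N)) as [d2 [Hd2 E2]].
    assert (Hc : L < L + w * eps / 2).
    { assert (0 < w * eps) by (apply Rmult_lt_0_compat; lra). lra. }
    specialize (H2 _ Hc).
    assert (exists p q, Rabs (Xf h X p q) < Rmin d1 d2 /\ Rabs (Pr h k X Y p q) <= L + w * eps / 2) as (p & q & P1 & P2).
    { apply NNPP; intro Nn. apply H2. exists (Rmin d1 d2). split; [apply Rmin_glb_lt; assumption|].
      intros p q Hpq. apply Rnot_le_lt; intro Hle. apply Nn. exists p, q. split; assumption. }
    exists q.
    assert (Q1 : Rabs (Xf h X p q) < d1) by (eapply Rlt_le_trans; [exact P1|apply Rmin_l]).
    assert (Q2 : Rabs (Xf h X p q) < d2) by (eapply Rlt_le_trans; [exact P1|apply Rmin_r]).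
    split.
    + destruct (Z_le_gt_dec N (Z.abs q)) as [G|G]; [assumption|exfalso].
      specialize (E2 p q ltac:(lia)). lra.
    + specialize (E1 _ (conj (Rabs_pos _) Q1)).
      assert (V' : 2 * (1 - h * k) * Rabs (IZR q) * Rabs (Xf h X p q) < L + w * eps).
      { assert (V3 := Rle_abs (- (Rabs (Pr h k X Y p q) - 2 * (1 - h * k) * Rabs (IZR q) * Rabs (Xf h X p q)))).
        rewrite Rabs_Ropp in V3. pose proof (Pr_vs_q p q). lra. }
      pose proof (nint_dist_le (IZR q * h - g) p) as Dl.
      rewrite Xf_dist in V'.
      assert (Rabs (IZR q) * nint_dist (IZR q * h - g) <= Rabs (IZR q) * Rabs (IZR q * h - g - IZR p)).
      { apply Rmult_le_compat_l; [apply Rabs_pos|exact Dl]. }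
      apply (Rmult_lt_reg_r w); [assumption|].
      replace ((L / w + eps) * w) with (L + w * eps) by (field; lra).
      apply Rle_lt_trans with (Rabs (IZR q) * Rabs (IZR q * h - g - IZR p) * w).
      * apply Rmult_le_compat_r; lra.
      * unfold w in *. lra.
  - assert (Hwe : 0 < w * eps) by (apply Rmult_lt_0_compat; lra).
    destruct (small_error (w * eps / 2)) as [d1 [Hd1 E1]]; [lra|].
    destruct (H1 (L - w * eps / 2)) as [d2 [Hd2 E2]]; [lra|].
    set (d := Rmin d1 d2). assert (Hd : 0 < d) by (apply Rmin_glb_lt; assumption).
    (* Beyond this [N], an index at distance at least [d] satisfies the bound through the size of
       [n] alone; nearer ones are covered by [H1]. *)
    destruct (archimed (Rmax 0 (2 * L / (w * d)) + 1)) as [Ar _].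
    set (N := up (Rmax 0 (2 * L / (w * d)) + 1)) in *.
    exists N. intros n Hn. apply IZR_le in Hn. rewrite abs_IZR in Hn.
    assert (N0 : 2 * L / (w * d) < Rabs (IZR n)).
    { pose proof (Rmax_r 0 (2 * L / (w * d))). lra. }
    destruct (nint_dist_ex (IZR n * h - g)) as [m Hm]. rewrite Hm.
    pose proof (Xf_dist m n) as Ex.
    set (x := Rabs (Xf h X m n)) in *.
    replace (Rabs (IZR n * h - g - IZR m)) with (x / 2) by lra.
    apply (Rmult_lt_reg_r w); [assumption|].
    replace ((L / w - eps) * w) with (L - w * eps) by (field; lra).
    destruct (Rlt_le_dec x d) as [G|G].
    + assert (G1 : x < d1) by (eapply Rlt_le_trans; [exact G|apply Rmin_l]).
      assert (G2 : x < d2) by (eapply Rlt_le_trans; [exact G|apply Rmin_r]).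
      specialize (E1 x (conj (Rabs_pos _) G1)). specialize (E2 _ _ G2).
      pose proof (Pr_vs_q m n) as V. fold x in V.
      assert (V3 := Rle_abs (Rabs (Pr h k X Y m n) - 2 * (1 - h * k) * Rabs (IZR n) * x)).
      unfold w in *. lra.
    + assert (2 * L < Rabs (IZR n) * (w * d)).
      { apply (Rmult_lt_compat_r (w * d)) in N0; [|apply Rmult_lt_0_compat; lra].
        replace (2 * L / (w * d) * (w * d)) with (2 * L) in N0 by (field; lra). exact N0. }
      assert (Rabs (IZR n) * (w * d) <= Rabs (IZR n) * (w * x)).
      { apply Rmult_le_compat_l; [apply Rabs_pos|]. apply Rmult_le_compat_l; lra. }
      lra.
Qed.
End Liminf.

(** * The orbit of a point *)

(** Replacing [Y] by [Y'] changes the product by [Xf (Y - Y')], which tends to 0 with [Xf]. *)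
Lemma ev_above_Y h k X Y Y' c c' : c' < c -> ev_above h k X Y c -> ev_above h k X Y' c'.
Proof.
  intros Hc [d [Hd H]].
  set (e := (c - c') / (Rabs (Y - Y') + 1)).
  assert (P : 0 < Rabs (Y - Y') + 1) by (pose proof (Rabs_pos (Y - Y')); lra).
  assert (He : 0 < e) by (apply Rdiv_lt_0_compat; lra).
  exists (Rmin d e). split; [apply Rmin_glb_lt; assumption|].
  intros p q Hp.
  assert (H1 : Rabs (Xf h X p q) < d) by (eapply Rlt_le_trans; [exact Hp|apply Rmin_l]).
  assert (H2 : Rabs (Xf h X p q) < e) by (eapply Rlt_le_trans; [exact Hp|apply Rmin_r]).
  specialize (H p q H1).
  assert (E : Pr h k X Y p q = Pr h k X Y' p q + Xf h X p q * (Y - Y')) by (unfold Pr, Xf; ring).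
  rewrite E in H. pose proof (Rabs_triang (Pr h k X Y' p q) (Xf h X p q * (Y - Y'))) as Tr.
  rewrite Rabs_mult in Tr.
  assert (Rabs (Xf h X p q) * Rabs (Y - Y') <= e * (Rabs (Y - Y') + 1)).
  { apply Rmult_le_compat; try apply Rabs_pos; lra. }
  assert (e * (Rabs (Y - Y') + 1) = c - c') by (unfold e; field; lra). lra.
Qed.

Lemma grid_liminf_Y h k X Y Y' L : grid_liminf h k X Y L -> grid_liminf h k X Y' L.
Proof.
  intros [H1 H2]. split; intros c Hc.
  - apply (ev_above_Y h k X Y Y' ((c + L) / 2)); [lra|apply H1; lra].
  - intros N. apply (H2 ((c + L) / 2)); [lra|]. apply (ev_above_Y h k X Y' Y c); [lra|exact N].
Qed.

Lemma grid_liminf_ext h k X Y X' Y' L : (forall c, ev_above h k X Y c <-> ev_above h k X' Y' c) ->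
  grid_liminf h k X Y L -> grid_liminf h k X' Y' L.
Proof.
  intros E [H1 H2]. split; intros c Hc.
  - apply E, H1, Hc.
  - intros N. apply (H2 c Hc), E, N.
Qed.

Lemma ev_above_shift h k X Y m c : ev_above h k X Y c <-> ev_above h k (X - 2 * IZR m) (Y + 2 * k * IZR m) c.
Proof.
  assert (E : forall p q, Xf h (X - 2 * IZR m) p q = Xf h X (p - m) q /\
    Pr h k (X - 2 * IZR m) (Y + 2 * k * IZR m) p q = Pr h k X Y (p - m) q).
  { intros p q. unfold Pr, Xf. rewrite minus_IZR. split; ring. }
  split; intros [d [Hd H]]; exists d; (split; [exact Hd|]); intros p q Hp.
  - destruct (E p q) as [E1 E2]. rewrite E1 in Hp; rewrite E2. apply H, Hp.
  - destruct (E (p + m)%Z q) as [E1 E2]. replace (p + m - m)%Z with p in * by lia.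
    rewrite <- E1 in Hp; rewrite <- E2. apply H, Hp.
Qed.

Lemma Xf_neg h X p q : Xf h (- X) p q = - Xf h X (- 1 - p) (- 1 - q).
Proof. unfold Xf. rewrite !minus_IZR. ring. Qed.

Lemma ev_above_neg h k X Y c : ev_above h k X Y c -> ev_above h k (- X) (- Y) c.
Proof.
  intros [d [Hd H]]. exists d; split; [exact Hd|]. intros p q Hp.
  unfold Pr. rewrite !Xf_neg in *. rewrite Rabs_Ropp in Hp. specialize (H _ _ Hp).
  replace (- Xf h X (-1 - p) (-1 - q) * - Xf k Y (-1 - q) (-1 - p)) with
    (Pr h k X Y (-1 - p) (-1 - q)) by (unfold Pr; ring). exact H.
Qed.

Lemma grid_liminf_neg h k X Y L : grid_liminf h k X Y L -> grid_liminf h k (- X) (- Y) L.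
Proof.
  apply grid_liminf_ext. intros c; split; intros H; apply ev_above_neg in H; [exact H|].
  rewrite !Ropp_involutive in H. exact H.
Qed.

(** One block of the expansion: its two digits are removed from the future [X] and appended to the
    past [Y]. *)
Record step (h k : R) (T U : Z) (X Y X' Y' : R) : Prop := {
  st_T : Z.Even T;
  st_U : Z.Odd U;
  st_X : X = h * (IZR T + k * (IZR U + X'));
  st_Y : Y' = k * (IZR U + h * (IZR T + Y)) }.

Section Steps.
Variables (a b : Z) (h k : R).
Hypothesis P : par a b h k.

Lemma step_points T U X Y X' Y' : step h k T U X Y X' Y' -> exists d d' : Z, forall p q,
  let q' := (a * p - q + d)%Z in let p' := (b * q' - p + d')%Z in
  Xf h X p q = h * k * Xf h X' p' q' /\ Pr h k X Y p q = Pr h k X' Y' p' q'.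
Proof.
  intros [[t Ht] [u Hu] EX EY]. destruct P as [Ha Hb _ [m Hm] _ [n Hn] Hh Hk _].
  exists (m - 1 + t)%Z, (n + u)%Z. intros p q q' p'.
  assert (Hd : (2 * (m - 1 + t) = a - 2 + T)%Z) by lia.
  assert (Hd' : (2 * (n + u) = b - 2 + U)%Z) by lia.
  set (Z0 := k * (IZR U + X')). set (H0 := h * (IZR T + Y)).
  destruct (move_factors a h k X Y H0 Z0 T _ p q Ha EX eq_refl Hd) as [F1 F2].
  assert (Hb' : IZR b * k = 1 + k * h) by lra.
  destruct (move_factors b k h Z0 H0 Y' X' U _ q' p Hb' eq_refl EY Hd') as [G1 G2].
  fold q' in F1, F2. fold p' in G1, G2.
  split; [rewrite F1, G1; ring|].
  unfold Pr. rewrite F1, G1. 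
  replace (h * (k * Xf h X' p' q') * Xf k Y q p) with (k * Xf h X' p' q' * (h * Xf k Y q p)) by ring.
  rewrite F2. rewrite <- G2. ring.
Qed.

Lemma step_points_inv T U X Y X' Y' p' q' : step h k T U X Y X' Y' -> exists p q,
  Xf h X p q = h * k * Xf h X' p' q' /\ Pr h k X Y p q = Pr h k X' Y' p' q'.
Proof.
  intros S. destruct (step_points T U X Y X' Y' S) as (d & d' & H).
  set (p := (b * q' - p' + d')%Z). exists p, (a * p - q' + d)%Z.
  specialize (H p (a * p - q' + d)%Z). simpl in H.
  replace (a * p - (a * p - q' + d) + d)%Z with q' in H by lia.
  replace (b * q' - p + d')%Z with p' in H by (unfold p; lia). exact H.
Qed.

Lemma ev_above_step T U X Y X' Y' c : step h k T U X Y X' Y' ->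
  ev_above h k X Y c <-> ev_above h k X' Y' c.
Proof.
  intros S. pose proof (par_h _ _ _ _ P). pose proof (par_k _ _ _ _ P).
  assert (HD : 0 < h * k) by (apply Rmult_lt_0_compat; lra).
  split; intros [d [Hd H1]].
  - exists (d / (h * k)). split; [apply Rdiv_lt_0_compat; lra|]. intros p' q' Hp.
    destruct (step_points_inv T U X Y X' Y' p' q' S) as (p & q & E1 & E2).
    rewrite <- E2. apply H1. rewrite E1, Rabs_mult, (Rabs_pos_eq (h * k)) by lra.
    apply (Rmult_lt_compat_l (h * k)) in Hp; [|lra].
    replace (h * k * (d / (h * k))) with d in Hp by (field; lra). exact Hp.
  - exists (h * k * d). split; [apply Rmult_lt_0_compat; lra|]. intros p q Hp.
    destruct (step_points T U X Y X' Y' S) as (e & e' & E). destruct (E p q) as [E1 E2].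
    rewrite E2. apply H1. rewrite E1, Rabs_mult, (Rabs_pos_eq (h * k)) in Hp by lra.
    apply (Rmult_lt_reg_l (h * k)); lra.
Qed.

(** Rounding within each parity class leaves remainders in [-1, 1], the range that [cell_pos]
    requires. *)
Definition evn (t : R) : Z := (2 * Int_part ((t + 1) / 2))%Z.
Definition odn (t : R) : Z := (2 * Int_part (t / 2) + 1)%Z.

Lemma evn_spec t : Z.Even (evn t) /\ -1 <= t - IZR (evn t) <= 1.
Proof.
  split; [eexists; reflexivity|]. unfold evn. rewrite mult_IZR.
  destruct (base_Int_part ((t + 1) / 2)). lra.
Qed.

Lemma odn_spec t : Z.Odd (odn t) /\ -1 <= t - IZR (odn t) <= 1.
Proof.
  split; [eexists; reflexivity|]. unfold odn. rewrite plus_IZR, mult_IZR.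
  destruct (base_Int_part (t / 2)). lra.
Qed.

(* The pair (r, s) holds the coordinates of the cell centre in the lattice basis, where a digit T acts by
   [(r, s) -> (a r - s - T, r)]; the cell itself has X = r - h s and Y = s - k r. *)
Definition half (v : R * R) : R := let t := IZR a * fst v - snd v in t - IZR (evn t).
Definition next (v : R * R) : R * R :=
  (let t := IZR b * half v - fst v in t - IZR (odn t), half v).

Section Orbit.
Variable x0 : R.
Let r0 := x0 - IZR (evn x0).
(** The second coordinate may start at 0 because the past of the expansion is free. *)
Fixpoint orb (i : nat) : R * R := match i with O => (r0, 0) | S j => next (orb j) end.
Definition cT i := evn (IZR a * fst (orb i) - snd (orb i)).
Definition cU i := odn (IZR b * half (orb i) - fst (orb i)).
Definition cx i := fst (orb i) - h * snd (orb i).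
Definition cy i := snd (orb i) - k * fst (orb i).
Definition cz i := half (orb i) - k * fst (orb i).
Definition cw i := fst (orb i) - h * half (orb i).

Lemma orb_range i : -1 <= fst (orb i) <= 1 /\ -1 <= snd (orb i) <= 1 /\ -1 <= half (orb i) <= 1.
Proof.
  assert (Hf : forall v, -1 <= half v <= 1) by (intros v; apply evn_spec).
  destruct i as [|i]; simpl.
  - split; [apply evn_spec|]. split; [lra|apply Hf].
  - split; [apply odn_spec|]. split; apply Hf.
Qed.

Lemma cx_eq i : cx i = h * (IZR (cT i) + cz i).
Proof.
  unfold cx, cT, cz, half. set (r := fst (orb i)). set (s := snd (orb i)).
  assert (E : IZR a * h * r = (1 + h * k) * r) by (rewrite (par_a _ _ _ _ P); reflexivity).
  lra.
Qed.

Lemma cw_eq i : cw i = h * (IZR (cT i) + cy i).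
Proof.
  unfold cw, cT, cy, half. set (r := fst (orb i)). set (s := snd (orb i)).
  assert (E : IZR a * h * r = (1 + h * k) * r) by (rewrite (par_a _ _ _ _ P); reflexivity).
  lra.
Qed.

Lemma cz_eq i : cz i = k * (IZR (cU i) + cx (S i)).
Proof.
  unfold cz, cx, cU. simpl. set (r := fst (orb i)). set (u := half (orb i)).
  assert (E : IZR b * k * u = (1 + h * k) * u) by (rewrite (par_b _ _ _ _ P); reflexivity).
  lra.
Qed.

Lemma cy_eq i : cy (S i) = k * (IZR (cU i) + cw i).
Proof.
  unfold cy, cw, cU. simpl. set (r := fst (orb i)). set (u := half (orb i)).
  assert (E : IZR b * k * u = (1 + h * k) * u) by (rewrite (par_b _ _ _ _ P); reflexivity).
  lra.
Qed.

Lemma orb_step i : step h k (cT i) (cU i) (cx i) (cy i) (cx (S i)) (cy (S i)).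
Proof.
  split; [apply evn_spec|apply odn_spec| |].
  - rewrite cx_eq, cz_eq. reflexivity.
  - rewrite cy_eq, cw_eq. reflexivity.
Qed.

Lemma ev_above_orb i c : ev_above h k (cx 0) (cy 0) c <-> ev_above h k (cx i) (cy i) c.
Proof.
  induction i as [|i IH]; [reflexivity|]. rewrite IH. eapply ev_above_step, orb_step.
Qed.

Lemma orb_bounds i : -2 <= cx i <= 2 /\ -2 <= cy i <= 2 /\ -2 <= cz i <= 2 /\ -2 <= cw i <= 2.
Proof.
  destruct (orb_range i) as (R1 & R2 & R3).
  destruct (adm_bounds _ _ (par_adm _ _ _ _ P)) as (Hk & Hh & Hh' & Hk' & _).
  assert (B : forall u v e, 0 < e < 1 -> -1 <= u <= 1 -> -1 <= v <= 1 -> -2 <= u - e * v <= 2).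
  { intros u v e He Hu Hv.
    assert (e * (-1) <= e * v <= e * 1) by (split; apply Rmult_le_compat_l; lra). lra. }
  unfold cx, cy, cz, cw. split; [|split; [|split]]; apply B; lra.
Qed.

(** Pulling a point of cell [i] back to cell 0 keeps its product and multiplies its first coordinate
    by [D^i]. Late cells thus inherit the bound on a whole strip; width 10 contains all corners
    needed. *)
Lemma tail_points c : ev_above h k (cx 0) (cy 0) c ->
  exists N, forall i, (N <= i)%nat -> forall p q, Rabs (Xf h (cx i) p q) < 10 -> c < Rabs (Pr h k (cx i) (cy i) p q).
Proof.
  intros [d [Hd H]].
  destruct (adm_bounds _ _ (par_adm _ _ _ _ P)) as (Hk & Hh & Hh' & Hk' & HD & _).
  assert (Pull : forall i p' q', exists p q, Xf h (cx 0) p q = (h * k) ^ i * Xf h (cx i) p' q' /\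
    Pr h k (cx 0) (cy 0) p q = Pr h k (cx i) (cy i) p' q').
  { induction i as [|i IH]; intros p' q'; [exists p', q'; simpl; split; ring|].
    destruct (step_points_inv _ _ _ _ _ _ p' q' (orb_step i)) as (p1 & q1 & E1 & E2).
    destruct (IH p1 q1) as (p & q & E3 & E4). exists p, q.
    rewrite E3, E4, E1, E2. simpl. split; ring. }
  destruct (pow_lt_1_zero (h * k)) with (y := d / 10) as [N HN]; [rewrite Rabs_pos_eq; lra|lra|].
  exists N. intros i Hi p' q' Hx. destruct (Pull i p' q') as (p & q & E1 & E2).
  rewrite <- E2. apply H. rewrite E1, Rabs_mult. specialize (HN i Hi).
  assert (Rabs ((h * k) ^ i) * Rabs (Xf h (cx i) p' q') <= d / 10 * Rabs (Xf h (cx i) p' q')).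
  { apply Rmult_le_compat_r; [apply Rabs_pos|lra]. }
  assert (d / 10 * Rabs (Xf h (cx i) p' q') < d / 10 * 10) by (apply Rmult_lt_compat_l; lra). lra.
Qed.

Lemma not_ev_above_orb : ~ ev_above h k (cx 0) (cy 0) 100.
Proof.
  intros Hev. destruct (tail_points _ Hev) as [N HN].
  specialize (HN N (le_n _) 0%Z 0%Z).
  destruct (adm_bounds _ _ (par_adm _ _ _ _ P)) as (Hk & Hh & Hh' & Hk' & _).
  destruct (orb_bounds N) as (B1 & B2 & _).
  unfold Pr, Xf in HN. 
  assert (A1 : Rabs (1 - h + cx N + 2 * 0 - 2 * h * 0) <= 4) by (apply Rabs_le; lra).
  assert (A2 : Rabs (1 - k + cy N + 2 * 0 - 2 * k * 0) <= 4) by (apply Rabs_le; lra).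
  rewrite Rabs_mult in HN.
  assert (Rabs (1 - h + cx N + 2 * 0 - 2 * h * 0) * Rabs (1 - k + cy N + 2 * 0 - 2 * k * 0) <= 4 * 4).
  { apply Rmult_le_compat; try apply Rabs_pos; assumption. }
  specialize (HN ltac:(lra)). lra.
Qed.

(** The grid is translated so that its first coordinate starts in [-1, 1]; the second argument is
    chosen so that this translation turns it into [cy 0]. *)
Lemma ev_above_start c : ev_above h k x0 (2 * k * IZR (evn x0 / 2) * -1 + cy 0) c <-> ev_above h k (cx 0) (cy 0) c.
Proof.
  rewrite (ev_above_shift h k x0 _ (evn x0 / 2)%Z).
  assert (E : evn x0 = (2 * (evn x0 / 2))%Z).
  { unfold evn. rewrite (Z.mul_comm 2 (Int_part _)), Z.div_mul by lia. lia. }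
  replace (cx 0) with (x0 - 2 * IZR (evn x0 / 2)).
  - replace (2 * k * IZR (evn x0 / 2) * -1 + cy 0 + 2 * k * IZR (evn x0 / 2)) with (cy 0) by ring. reflexivity.
  - unfold cx; simpl. unfold r0. rewrite E at 2. rewrite mult_IZR. ring.
Qed.

Lemma grid_liminf_ex Y : exists L, grid_liminf h k x0 Y L.
Proof.
  destruct (grid_liminf_exists h k (cx 0) (cy 0) 100 not_ev_above_orb) as [L HL].
  exists L. apply (grid_liminf_Y _ _ _ (2 * k * IZR (evn x0 / 2) * -1 + cy 0)).
  revert HL. apply grid_liminf_ext. intros c. symmetry. apply ev_above_start.
Qed.

Lemma grid_liminf_orb Y L i : grid_liminf h k x0 Y L -> grid_liminf h k (cx i) (cy i) L.
Proof.
  intros HL. apply (grid_liminf_Y _ _ _ _ (2 * k * IZR (evn x0 / 2) * -1 + cy 0)) in HL.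
  revert HL. apply grid_liminf_ext. intros c. rewrite ev_above_start. apply ev_above_orb.
Qed.

End Orbit.
End Steps.

Lemma crude_bound_le_limit h k : adm h k -> crude_bound h k <= limit_value h k.
Proof.
  intros A. destruct (adm_bounds _ _ A) as (Hk & Hh & Hh' & Hk' & HD & Hd & Hhk).
  unfold crude_bound, limit_value. destruct (ws_bounds (h * k) HD) as [Hw Hw1].
  set (D := h * k) in *. assert (0 <= D^2) by (apply pow2_ge_0).
  assert (0 <= k * D * (1 - D + D ^ 2 * ws D)).
  { apply Rmult_le_pos; [apply Rmult_le_pos; lra|].
    assert (0 <= D ^ 2 * ws D) by (apply Rmult_le_pos; lra). lra. }
  rewrite Rmult_comm. apply Rmult_le_compat; lra.
Qed.

Lemma corners_weaken h k X Y c c' : c' <= c -> corners h k X Y c -> corners h k X Y c'.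
Proof. intros Hc []; split; lra. Qed.

Definition xC (h k : R) : R := (3 * (h * k) - 2 * h) / (1 - h * k).
Definition yC (h k : R) : R := (3 * k - 2 * (h * k)) / (1 - h * k).

(** * From the orbit to the possible tails *)

Section Classify.
Variables (a b : Z) (h k x0 c : R).
Hypothesis P : par a b h k.
Hypothesis Hc : limit_value h k <= c.
Notation cx := (cx a b h x0).
Notation cy := (cy a b k x0).
Notation cz := (cz a b k x0).
Notation cw := (cw a b h x0).
Notation cT := (cT a b x0).
Notation cU := (cU a b x0).
Notation orb := (orb a b x0).
Variable N : nat.
Hypothesis HN : forall i, (N <= i)%nat -> forall p q,
  Rabs (Xf h (cx i) p q) < 10 -> c < Rabs (Pr h k (cx i) (cy i) p q).

Let A : adm h k := par_adm _ _ _ _ P.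

Lemma even_corners i : (N <= i)%nat -> corners h k (cx i) (cy i) c.
Proof.
  intros Hi. pose proof (crude_bound_le_limit _ _ A).
  destruct (adm_bounds _ _ A) as (Hk & Hh & Hh' & Hk' & HD & Hd & Hhk).
  destruct (orb_range a b x0 i) as (R1 & R2 & R3).
  destruct (orb_bounds a b h k P x0 i) as (B1 & B2 & B3 & B4).
  assert (Q : forall p q, (-1 <= p <= 0)%Z -> (-1 <= q <= 0)%Z -> c < Rabs (Pr h k (cx i) (cy i) p q)).
  { intros p q Hp Hq. apply (HN i Hi). unfold Xf.
    assert (p = -1 \/ p = 0)%Z as [->| ->] by lia; assert (q = -1 \/ q = 0)%Z as [->| ->] by lia;
      apply Rabs_def1; lra. }
  apply cell_corners; try assumption; try lra; fold (cx i) (cy i).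
  - pose proof (Q 0 0 ltac:(lia) ltac:(lia))%Z as E. unfold Pr, Xf in E.
    eapply Rlt_le_trans; [exact E|right; f_equal; ring].
  - pose proof (Q 0 (-1) ltac:(lia) ltac:(lia))%Z as E. unfold Pr, Xf in E.
    rewrite <- Rabs_Ropp. eapply Rlt_le_trans; [exact E|right; f_equal; ring].
  - pose proof (Q (-1) 0 ltac:(lia) ltac:(lia))%Z as E. unfold Pr, Xf in E.
    rewrite <- Rabs_Ropp. eapply Rlt_le_trans; [exact E|right; f_equal; ring].
  - pose proof (Q (-1) (-1) ltac:(lia) ltac:(lia))%Z as E. unfold Pr, Xf in E.
    eapply Rlt_le_trans; [exact E|right; f_equal; ring].
Qed.

(** The cell between the two digits of a block. Its corners are points of the grid of the even cell,
    found by undoing the digit [T]. *)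
Lemma odd_corners i : (N <= i)%nat -> corners h k (cw i) (cz i) c.
Proof.
  intros Hi. pose proof (crude_bound_le_limit _ _ A).
  destruct (adm_bounds _ _ A) as (Hk & Hh & Hh' & Hk' & HD & Hd & Hhk).
  destruct (orb_range a b x0 i) as (R1 & R2 & R3).
  destruct (orb_bounds a b h k P x0 i) as (B1 & B2 & B3 & B4).
  destruct (par_even _ _ _ _ P) as [m Hm]. destruct (proj1 (evn_spec (IZR a * fst (orb i) - snd (orb i)))) as [t Ht].
  fold (cT i) in Ht.
  assert (Hd' : (2 * (m - 1 + t) = a - 2 + cT i)%Z) by lia.
  assert (Q : forall p q, (-1 <= p <= 0)%Z -> (-1 <= q <= 0)%Z -> c < Rabs (Pr h k (cw i) (cz i) p q)).
  { intros p q' Hp Hq.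
    set (q := (a * p - q' + (m - 1 + t))%Z).
    assert (Eq : (a * p - q + (m - 1 + t))%Z = q') by (unfold q; lia).
    destruct (move_factors a h k _ _ _ _ _ _ p q (par_a _ _ _ _ P) (cx_eq a b h k P x0 i) (cw_eq a b h k P x0 i) Hd') as [F1 _].
    pose proof (move_Pr a h k _ _ _ _ _ _ p q ltac:(lra) (par_a _ _ _ _ P) (cx_eq a b h k P x0 i) (cw_eq a b h k P x0 i) Hd') as F2.
    rewrite Eq in F1, F2. rewrite <- F2. apply (HN i Hi). rewrite F1, Rabs_mult, (Rabs_pos_eq h) by lra.
    assert (Rabs (Xf k (cz i) q' p) <= 10).
    { unfold Xf. assert (p = -1 \/ p = 0)%Z as [->| ->] by lia; assert (q' = -1 \/ q' = 0)%Z as [->| ->] by lia;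
      apply Rabs_le; lra. }
    assert (h * Rabs (Xf k (cz i) q' p) <= h * 10) by (apply Rmult_le_compat_l; lra). lra. }
  apply cell_corners; try assumption; try lra; fold (cw i) (cz i).
  - pose proof (Q 0 0 ltac:(lia) ltac:(lia))%Z as E. unfold Pr, Xf in E.
    eapply Rlt_le_trans; [exact E|right; f_equal; ring].
  - pose proof (Q 0 (-1) ltac:(lia) ltac:(lia))%Z as E. unfold Pr, Xf in E.
    rewrite <- Rabs_Ropp. eapply Rlt_le_trans; [exact E|right; f_equal; ring].
  - pose proof (Q (-1) 0 ltac:(lia) ltac:(lia))%Z as E. unfold Pr, Xf in E.
    rewrite <- Rabs_Ropp. eapply Rlt_le_trans; [exact E|right; f_equal; ring].
  - pose proof (Q (-1) (-1) ltac:(lia) ltac:(lia))%Z as E. unfold Pr, Xf in E.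
    eapply Rlt_le_trans; [exact E|right; f_equal; ring].
Qed.

Lemma orbit_chain i : (N <= i)%nat ->
  chain h k (cy i) (cz i) (cy (S i)) (cz (S i)) (cx i) (cw i) (cx (S i)) (cw (S i)) (cT i) (cU i) (cT (S i)).
Proof.
  intros Hi. pose proof (crude_bound_le_limit _ _ A).
  split; try apply evn_spec; try apply odn_spec;
    try (apply (corners_weaken _ _ _ _ c); [lra|]; first [apply even_corners; lia|apply odd_corners; lia]);
    first [apply cx_eq | apply cw_eq | apply cz_eq | apply cy_eq]; exact P.
Qed.

Lemma digits_constant :
  (forall i, (N <= i)%nat -> cT i = 0%Z /\ (cU i = 1 \/ cU i = -1)%Z) \/
  (forall i, (N <= i)%nat -> cT i = (-2)%Z /\ cU i = 3%Z) \/
  (forall i, (N <= i)%nat -> cT i = 2%Z /\ cU i = (-3)%Z).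
Proof.
  assert (St : forall i, (N <= i)%nat ->
    (cT i = 0 /\ cT (S i) = 0 /\ (cU i = 1 \/ cU i = -1) \/
     cT i = -2 /\ cT (S i) = -2 /\ cU i = 3 \/ cT i = 2 /\ cT (S i) = 2 /\ cU i = -3)%Z).
  { intros i Hi. eapply chain_step; [exact P|apply orbit_chain, Hi]. }
  assert (Cst : forall i, (N <= i)%nat -> cT i = cT N).
  { intros i Hi. induction Hi as [|i Hi IH]; [reflexivity|]. specialize (St i Hi). lia. }
  pose proof (St N (le_n N)) as [H|[H|H]]; [left|right; left|right; right];
    intros i Hi; specialize (St i Hi); specialize (Cst i Hi); lia.
Qed.

Lemma constant_tail T U X : (forall i, (N <= i)%nat -> cT i = T /\ cU i = U) ->
  -2 <= X <= 2 -> X = h * (IZR T + k * (IZR U + X)) -> cx N = X.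
Proof.
  intros H HX EX. destruct (adm_bounds _ _ A) as (Hk & Hh & Hh' & Hk' & HD & Hd & Hhk).
  assert (Z : / 4 * (cx (N + 0)%nat - X) = 0).
  { apply (contraction_zero (fun m => / 4 * (cx (N + m)%nat - X))).
    - intros m. destruct (orb_bounds a b h k P x0 (N + m)) as (B1 & _). apply Rabs_le. lra.
    - intros m. destruct (H (N + m)%nat ltac:(lia)) as [HT HU].
      pose proof (cx_eq a b h k P x0 (N + m)) as E1. pose proof (cz_eq a b h k P x0 (N + m)) as E2.
      rewrite E2, HT, HU in E1. replace (S (N + m)) with (N + S m)%nat in E1 by lia.
      replace (/ 4 * (cx (N + m)%nat - X)) with (h * k * (/ 4 * (cx (N + S m)%nat - X))) by (rewrite E1; rewrite EX at 2; ring).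
      rewrite Rabs_mult. apply Rmult_le_compat_r; [apply Rabs_pos|]. rewrite Rabs_pos_eq; lra. }
  replace (N + 0)%nat with N in Z by lia. lra.
Qed.

Lemma letters_case : (forall i, (N <= i)%nat -> cT i = 0%Z /\ (cU i = 1 \/ cU i = -1)%Z) ->
  exists i W, (cx i = h * k * W \/ cx i = - (h * k * W)) /\
    (W = ws (h * k) \/ exists n, W = wz (h * k) n).
Proof.
  intros H. destruct (adm_bounds _ _ A) as (Hk & Hh & Hh' & Hk' & HD & Hd & Hhk).
  set (D := h * k) in *.
  set (u := fun i => IZR (cU i)).
  assert (Hu : forall i, (N <= i)%nat -> (u i = 1 \/ u i = -1) /\ u i * u i = 1).
  { intros i Hi. unfold u. destruct (H i Hi) as [_ [->| ->]]; split; lra. }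
  assert (Ex : forall i, (N <= i)%nat -> cx i = D * (u i + cx (S i))).
  { intros i Hi. rewrite (cx_eq a b h k P x0 i), (cz_eq a b h k P x0 i), (proj1 (H i Hi)).
    unfold D, u. ring. }
  assert (Ez : forall i, (N <= i)%nat -> cz i = k * (u i + cx (S i))).
  { intros i Hi. apply (cz_eq a b h k P x0 i). }
  assert (Ew : forall i, (N <= i)%nat -> cw i = h * cy i).
  { intros i Hi. rewrite (cw_eq a b h k P x0 i), (proj1 (H i Hi)). ring. }
  assert (Ey : forall i, (N <= i)%nat -> cy (S i) = k * (u i + h * cy i)).
  { intros i Hi. rewrite (cy_eq a b h k P x0 i), (Ew i Hi). reflexivity. }
  (* The offset 5 leaves enough earlier cells to iterate the backward recurrence three times before
     its bound is used. *)
  set (W := fun j => 1 + u (N + 5 + j)%nat * cx (S (N + 5 + j))).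
  set (U := fun j => 1 + u (N + 5 + j)%nat * (h * cy (N + 5 + j)%nat)).
  set (s := fun j => Z.eqb (cU (N + 5 + j)) (cU (S (N + 5 + j)))).
  assert (Hs : forall j, u (N + 5 + j)%nat * u (S (N + 5 + j)) = sg (s j)).
  { intros j. unfold s, u.
    destruct (H (N + 5 + j)%nat ltac:(lia)) as [_ E1]. destruct (H (S (N + 5 + j)) ltac:(lia)) as [_ E2].
    destruct E1 as [-> | ->], E2 as [-> | ->]; simpl; ring. }
  assert (D2 : 0 < D^2 <= 56/1000*D) by nra.
  assert (Bx0 : forall i, (N <= i)%nat -> -1 <= cx i <= 1).
  { intros i Hi. pose proof (corX _ _ _ _ _ (even_corners i Hi)). lra. }
  assert (By0 : forall i, (N <= i)%nat -> -1 <= cy i <= 1).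
  { intros i Hi. pose proof (corY _ _ _ _ _ (even_corners i Hi)). lra. }
  assert (Mul : forall e t B, 0 < e -> - B <= t <= B -> - (e * B) <= e * t <= e * B).
  { intros e t B He Ht. replace (- (e * B)) with (e * - B) by ring. split; apply Rmult_le_compat_l; lra. }
  assert (Bx : forall i, (N <= i)%nat -> - (D + 12/10*D^2) <= cx i <= D + 12/10*D^2).
  { assert (Q : forall B, (forall i, (N <= i)%nat -> -B <= cx i <= B) ->
      forall i, (N <= i)%nat -> - (D * (1 + B)) <= cx i <= D * (1 + B)).
    { intros B HB i Hi. rewrite (Ex i Hi). specialize (HB (S i) ltac:(lia)).
      destruct (Hu i Hi) as [[E|E] _]; rewrite E; apply Mul; lra. }
    (* Three rounds of [B -> D (1 + B)], starting from 1, fall below [D + 12/10 D^2]. *)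
    pose proof (Q _ (Q _ (Q 1 Bx0))) as Q3. intros i Hi. specialize (Q3 i Hi).
    assert (D * (1 + D * (1 + D * (1 + 1))) <= D + 12/10*D^2) by nra. lra. }
  assert (By : forall i, (N + 4 <= i)%nat -> - (D + 12/10*D^2) <= h * cy i <= D + 12/10*D^2).
  { assert (Q : forall B M, (N <= M)%nat -> (forall i, (M <= i)%nat -> -B <= h * cy i <= B) ->
      forall i, (S M <= i)%nat -> - (D * (1 + B)) <= h * cy i <= D * (1 + B)).
    { intros B M HM HB i Hi. destruct i as [|i]; [lia|]. rewrite (Ey i) by lia.
      replace (h * (k * (u i + h * cy i))) with (D * (u i + h * cy i)) by (unfold D; ring).
      specialize (HB i ltac:(lia)).
      destruct (Hu i ltac:(lia)) as [[E|E] _]; rewrite E; apply Mul; lra. }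
    assert (Q0 : forall i, (N <= i)%nat -> -1 <= h * cy i <= 1).
    { intros i Hi. pose proof (Mul h (cy i) 1 ltac:(lra) (By0 i Hi)). lra. }
    pose proof (Q _ (S (S N)) ltac:(lia) (Q _ (S N) ltac:(lia) (Q 1 N ltac:(lia) Q0))) as Q3.
    intros i Hi. specialize (Q3 i ltac:(lia)).
    assert (D * (1 + D * (1 + D * (1 + 1))) <= D + 12/10*D^2) by nra. lra. }
  assert (Sgn : forall i t B, (N <= i)%nat -> - B <= t <= B -> - B <= u i * t <= B).
  { intros i t B Hi Ht. destruct (Hu i Hi) as [[E|E] _]; rewrite E; lra. }
  assert (LT : exists i, W i = ws D \/ exists n, W i = wz D n).
  { apply (letters_tail h k s W U A).
    - intros j. unfold W. rewrite (Ex (S (N + 5 + j))) by lia.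
      replace (N + 5 + S j)%nat with (S (N + 5 + j)) by lia. fold D. rewrite <- Hs.
      destruct (Hu (S (N + 5 + j)) ltac:(lia)) as [_ E].
      transitivity (1 + u (N + 5 + j)%nat * u (S (N + 5 + j)) * D + u (N + 5 + j)%nat * D *
        (u (S (N + 5 + j)) * u (S (N + 5 + j))) * cx (S (S (N + 5 + j)))); [rewrite E|]; ring.
    - intros j. unfold U. replace (N + 5 + S j)%nat with (S (N + 5 + j)) by lia.
      rewrite (Ey (N + 5 + j)%nat) by lia. fold D. rewrite <- Hs.
      destruct (Hu (N + 5 + j)%nat ltac:(lia)) as [_ E].
      transitivity (1 + u (N + 5 + j)%nat * u (S (N + 5 + j)) * D + u (S (N + 5 + j)) * D *
        (u (N + 5 + j)%nat * u (N + 5 + j)%nat) * (h * cy (N + 5 + j)%nat));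
        [rewrite E|]; unfold D; ring.
    - intros j. apply Rle_lt_trans with c; [exact Hc|]. unfold W, U.
      pose proof (even_corners (S (N + 5 + j)) ltac:(lia)) as [C1 _ _ C4 _ _].
      rewrite (Ey (N + 5 + j)%nat) in C1, C4 by lia.
      destruct (Hu (N + 5 + j)%nat ltac:(lia)) as [[E|E] _]; rewrite E in *.
      + eapply Rlt_le_trans; [exact C4|right; ring].
      + eapply Rlt_le_trans; [exact C1|right; ring].
    - intros j. apply Rle_lt_trans with c; [exact Hc|]. unfold W, U.
      pose proof (odd_corners (N + 5 + j) ltac:(lia)) as [C1 _ _ C4 _ _].
      rewrite (Ew (N + 5 + j)%nat), (Ez (N + 5 + j)%nat) in C1, C4 by lia.
      destruct (Hu (N + 5 + j)%nat ltac:(lia)) as [[E|E] _]; rewrite E in *.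
      + eapply Rlt_le_trans; [exact C4|right; ring].
      + eapply Rlt_le_trans; [exact C1|right; ring].
    - intros j. fold D. unfold W.
      pose proof (Sgn (N + 5 + j)%nat _ _ ltac:(lia) (Bx (S (N + 5 + j)) ltac:(lia))). lra.
    - intros j. fold D. unfold U.
      pose proof (Sgn (N + 5 + j)%nat _ _ ltac:(lia) (By (N + 5 + j)%nat ltac:(lia))). lra. }
  destruct LT as [j Hj]. exists (N + 5 + j)%nat, (W j). split; [|exact Hj].
  rewrite (Ex (N + 5 + j)%nat) by lia. unfold W.
  destruct (Hu (N + 5 + j)%nat ltac:(lia)) as [[E|E] _]; rewrite E; [left|right]; ring.
Qed.

Lemma tail_cases : exists i X, (cx i = X \/ cx i = - X) /\
  (X = h * k * ws (h * k) \/ (exists n, X = - (h * k * wz (h * k) n)) \/ X = xC h k).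
Proof.
  destruct (adm_bounds _ _ A) as (Hk & Hh & Hh' & Hk' & HD & Hd & Hhk).
  assert (BC : -2 <= xC h k <= 2).
  { unfold xC. split; apply (Rmult_le_reg_r (1 - h * k)); try lra;
    replace ((3 * (h * k) - 2 * h) / (1 - h * k) * (1 - h * k)) with (3 * (h * k) - 2 * h) by (field; lra); lra. }
  destruct digits_constant as [H|[H|H]].
  - destruct (letters_case H) as (i & W & E & [->|[n ->]]).
    + exists i, (h * k * ws (h * k)). tauto.
    (* The sign is chosen to match the word of [delta], whose first block is [A'_1]. *)
    + exists i, (- (h * k * wz (h * k) n)). split; [destruct E; [right|left]; lra|eauto].
  - exists N, (xC h k). split; [left|auto].
    apply (constant_tail _ _ _ H BC). unfold xC. field. lra.
  - exists N, (xC h k). split; [right|auto].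
    apply (constant_tail _ _ (- xC h k) H ltac:(lra)). unfold xC. field. lra.
Qed.

End Classify.

Theorem classify a b h k x0 Y L : par a b h k -> grid_liminf h k x0 Y L -> limit_value h k < L ->
  exists X Y', grid_liminf h k X Y' L /\
  (X = h * k * ws (h * k) \/ (exists n, X = - (h * k * wz (h * k) n)) \/ X = xC h k).
Proof.
  intros P HL HLc.
  pose proof (grid_liminf_orb a b h k P x0 Y L 0 HL) as [H1 _].
  destruct (tail_points a b h k P x0 (limit_value h k) (H1 _ HLc)) as [N HN].
  destruct (tail_cases a b h k x0 (limit_value h k) P (Rle_refl _) N HN) as (i & X & E & HX).
  pose proof (grid_liminf_orb a b h k P x0 Y L i HL) as Hi.
  destruct E as [E|E].
  - exists X, (cy a b k x0 i). rewrite E in Hi. auto.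
  - exists X, (- cy a b k x0 i). apply grid_liminf_neg in Hi. rewrite E, Ropp_involutive in Hi. auto.
Qed.

(** * Values of the periodic words *)

(** The product of [cor4] after a sign normalised to 1, with forward series [W] and backward series
    [U]. *)
Definition phi (h k W U : R) : R := (2 - h - W) * (1 - k - k * U).

Lemma phi_swap h k W U : adm h k -> U <= W -> phi h k W U <= phi h k U W.
Proof.
  intros A H. destruct (adm_bounds _ _ A) as (Hk & Hh & Hh' & Hk' & HD & Hd & Hhk).
  unfold phi. assert (0 <= (W - U) * (1 - 3 * k + h * k)) by (apply Rmult_le_pos; lra). lra.
Qed.

(** Bounding every product, not only those near the axis, also shows that the point is not in the
    lattice when [V > 0]. *)
Definition grid_min (h k X Y V : R) : Prop :=
  (forall p q, V <= Rabs (Pr h k X Y p q)) /\ (forall c, V < c -> ~ ev_above h k X Y c).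

Lemma grid_min_liminf h k X Y V : grid_min h k X Y V -> grid_liminf h k X Y V.
Proof.
  intros [H1 H2]. split; [|exact H2]. intros c Hc. exists 1. split; [lra|].
  intros p q _. specialize (H1 p q). lra.
Qed.

Lemma grid_min_nonlattice h k X Y V : 0 < V -> grid_min h k X Y V ->
  ~ (exists p q : Z, (1 - h + X) / 2 = IZR p + IZR q * h).
Proof.
  intros HV [H _] (p & q & E). specialize (H (- p)%Z q).
  assert (Z0 : Xf h X (- p) q = 0) by (unfold Xf; rewrite opp_IZR; lra).
  unfold Pr in H. rewrite Z0, Rmult_0_l, Rabs_R0 in H. lra.
Qed.

(** [Fam] collects the pairs of forward and backward series at the signs of a two-sided sequence;
    [Fswap] says that the sequence is its own mirror image. *)
Section Family.
Variables (a b : Z) (h k V : R) (Fam : R -> R -> Prop).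
Hypothesis P : par a b h k.
Let D := h * k.
Hypothesis Fswap : forall W U, Fam W U -> Fam U W.
Hypothesis Fnext : forall W U, Fam W U -> exists e W' U', (e = 1 \/ e = -1) /\
  W = 1 + e * D * W' /\ U' = 1 + e * D * U /\ Fam W' U'.
Hypothesis FV : forall W U, Fam W U -> V <= phi h k W U.
Hypothesis FB : forall W U, Fam W U -> - (D + 12/10*D^2) <= W - 1 <= D + 12/10 * D^2.

Definition edge_of (X Y : R) : Prop := exists e W U, (e = 1 \/ e = -1) /\ Fam W U /\
  X = e * (W - 1) /\ Y = k * e * U.

Lemma family_corners X Y : edge_of X Y -> lcorners h k X Y V.
Proof.
  intros (e & W & U & He & HF & -> & ->).
  destruct (adm_bounds _ _ (par_adm _ _ _ _ P)) as (Hk & Hh & Hh' & Hk' & HD & Hd & Hhk).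
  fold D in HD, Hd.
  pose proof (FB _ _ HF) as BW. pose proof (FB _ _ (Fswap _ _ HF)) as BU. pose proof (FV _ _ HF) as HV.
  assert (D2 : 0 < D^2 <= 56/1000*D) by nra.
  set (B := D + 12/10 * D^2) in *.
  assert (HB : 0 < B <= 11/10 * D) by (unfold B; lra).
  assert (DK : D <= 264/1000 * k) by (apply Rmult_le_compat_r; lra).
  assert (BkU : k * (1 - B) <= k * U <= k * (1 + B)) by (split; apply Rmult_le_compat_l; lra).
  assert (kB : 0 < k * B <= k * (7/100)) by (split; [apply Rmult_lt_0_compat|apply Rmult_le_compat_l]; lra).
  assert (V0 : V <= (1 - h + B) * (1 - 2 * k + k * B)).
  { eapply Rle_trans; [exact HV|]. unfold phi. apply Rmult_le_compat; lra. }
  (* For positive [e] only [cor4] is critical: the other three corners are at least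
     [(1 - h - B)(1 - k B)], which already exceeds the crude bound [V0] on [V]. *)
  assert (V1 : V <= (1 - h - B) * (1 - k * B)).
  { assert ((1 - 264/1000) * (1 - 7/100) <= (1 - h) * (1 - B)) by (apply Rmult_le_compat; lra).
    assert (k * (68/100) <= k * ((1 - h) * (1 - B))) by (apply Rmult_le_compat_l; lra). lra. }
  assert (C4 : V <= (1 - h - (W - 1)) * (1 - k - k * U)) by (unfold phi in HV; lra).
  assert (C1 : V <= (1 - h + (W - 1)) * (1 - k + k * U)).
  { eapply Rle_trans; [exact V1|]. apply Rmult_le_compat; lra. }
  assert (C2 : V <= (1 + h + (W - 1)) * (1 + k - k * U)).
  { eapply Rle_trans; [exact V1|]. apply Rmult_le_compat; lra. }
  assert (C3 : V <= (1 + h - (W - 1)) * (1 + k + k * U)).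
  { eapply Rle_trans; [exact V1|]. apply Rmult_le_compat; lra. }
  destruct He as [-> | ->]; split; lra.
Qed.

Lemma family_lower X Y p q : edge_of X Y -> V <= Rabs (Pr h k X Y p q).
Proof.
  destruct (adm_bounds _ _ (par_adm _ _ _ _ P)) as (Hk & Hh & Hh' & Hk' & HD & Hd & Hhk).
  pose proof P as [Ha Hb _ [m Hm] _ [n Hn] _ _ _].
  apply (grid_lower a b h k V edge_of); try lra; try assumption.
  - clear X Y. intros X Y (e & W & U & He & HF & -> & ->).
    destruct (Fnext _ _ HF) as (e' & W' & U' & He' & EW & EU & HF').
    (* Crossing the digit 0 exchanges past and future, so the new cell carries the reversed pair
       [(U', W')]. *)
    exists 0%Z, (m - 1)%Z, (e * e' * (U' - 1)), (k * (e * e') * W').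
    split; [lia|]. split; [rewrite EW; unfold D; ring|]. split.
    + rewrite EU. destruct He' as [-> | ->]; unfold D; ring.
    + exists (e * e'), U', W'. split; [destruct He as [-> | ->], He' as [-> | ->]; lra|].
      split; [apply Fswap, HF'|]. split; reflexivity.
  - clear X Y. intros X Y (e & W & U & He & HF & -> & ->).
    exists (match Rlt_dec 0 e with left _ => 1%Z | right _ => (-1)%Z end),
      (match Rlt_dec 0 e with left _ => n | right _ => (n - 1)%Z end), (e * (U - 1)), (k * e * W).
    destruct He as [-> | ->]; destruct (Rlt_dec 0 _); try lra;
      (split; [lia|split; [ring|split; [ring|]]]);
      [exists 1 | exists (-1)]; exists U, W; (split; [lra|split; [apply Fswap, HF|split; ring]]).
  - apply family_corners.
  - clear X Y. intros X Y (e & W & U & He & HF & -> & ->).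
    exists (- e), W, U. split; [lra|]. split; [exact HF|]. split; ring.
Qed.

Definition near_V (n : nat) (X Y : R) : Prop :=
  exists p q, Rabs (Xf h X p q) <= 4 * D ^ n /\ Rabs (Pr h k X Y p q) <= V.

Lemma near_V_not_above X Y c : (forall n, near_V n X Y) -> V < c -> ~ ev_above h k X Y c.
Proof.
  intros Hn Hc (d & Hd' & H).
  destruct (adm_bounds _ _ (par_adm _ _ _ _ P)) as (Hk & Hh & Hh' & Hk' & HD & Hd & Hhk).
  destruct (pow_lt_1_zero D) with (y := d / 4) as [N HN]; [unfold D; rewrite Rabs_pos_eq; lra|lra|].
  specialize (HN N (le_n _)). destruct (Hn N) as (p & q & H1 & H2).
  assert (c < Rabs (Pr h k X Y p q)); [|lra].
  apply H. rewrite Rabs_pos_eq in HN by (apply pow_le; unfold D; lra). lra.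
Qed.

Lemma near_V_step n T U X Y X' Y' : step h k T U X Y X' Y' -> near_V n X' Y' -> near_V (S n) X Y.
Proof.
  intros St (p' & q' & H1 & H2).
  destruct (adm_bounds _ _ (par_adm _ _ _ _ P)) as (Hk & Hh & Hh' & Hk' & HD & Hd & Hhk).
  destruct (step_points_inv a b h k P _ _ _ _ _ _ p' q' St) as (p & q & E1 & E2).
  exists p, q. rewrite E2. split; [|exact H2].
  rewrite E1, Rabs_mult, (Rabs_pos_eq (h * k)) by lra. fold D. simpl.
  replace (4 * (D * D ^ n)) with (D * (4 * D ^ n)) by ring.
  apply Rmult_le_compat_l; [unfold D; lra|exact H1].
Qed.

(** A near-minimal point of a later cell is carried back over one sign, which brings it closer to
    the axis by a factor [D]. *)
Lemma near_V_next n e e' W U W' U' : (e = 1 \/ e = -1) -> (e' = 1 \/ e' = -1) ->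
  W = 1 + e' * D * W' -> U' = 1 + e' * D * U ->
  near_V n (e * e' * (W' - 1)) (k * (e * e') * U') -> near_V (S n) (e * (W - 1)) (k * e * U).
Proof.
  intros He He' EW EU.
  assert (exists u, IZR u = e * e' /\ Z.Odd u) as (u & Hu & Ou).
  { destruct He as [-> | ->], He' as [-> | ->];
      [exists 1%Z|exists (-1)%Z|exists (-1)%Z|exists 1%Z]; (split; [lra|]);
      [exists 0%Z|exists (-1)%Z|exists (-1)%Z|exists 0%Z]; lia. }
  apply (near_V_step n 0 u). split; [exists 0%Z; lia|exact Ou| |]; rewrite Hu.
  - rewrite EW. unfold D. ring.
  - rewrite EU. destruct He' as [-> | ->]; unfold D; ring.
Qed.

Lemma near_V_mono n X Y : near_V (S n) X Y -> near_V n X Y.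
Proof.
  destruct (adm_bounds _ _ (par_adm _ _ _ _ P)) as (Hk & Hh & Hh' & Hk' & HD & Hd & Hhk).
  intros (p & q & H1 & H2). exists p, q. split; [|exact H2]. eapply Rle_trans; [exact H1|].
  simpl. apply Rmult_le_compat_l; [lra|]. fold D in HD.
  assert (0 <= D ^ n) by (apply pow_le; lra).
  assert (D * D ^ n <= 1 * D ^ n) by (apply Rmult_le_compat_r; lra). lra.
Qed.

Lemma near_V_start e W U : (e = 1 \/ e = -1) -> Fam W U -> phi h k W U <= V ->
  near_V 0 (e * (W - 1)) (k * e * U).
Proof.
  intros He HF HV.
  destruct (family_corners (e * (W - 1)) (k * e * U)) as [C1 C2 C3 C4 CX CY].
  { exists e, W, U. auto. }
  destruct (adm_bounds _ _ (par_adm _ _ _ _ P)) as (Hk & Hh & Hh' & Hk' & HD & Hd & Hhk).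
  unfold phi in HV. destruct He as [-> | ->].
  - exists (-1)%Z, (-1)%Z. unfold Pr, Xf. split.
    + simpl pow. apply Rabs_le. lra.
    + rewrite Rabs_pos_eq; [lra|].
      replace ((1 - h + 1 * (W - 1) + 2 * -1 - 2 * h * -1) * (1 - k + k * 1 * U + 2 * -1 - 2 * k * -1))
        with ((1 - h - 1 * (W - 1)) * (1 - k - k * 1 * U)) by ring.
      apply Rmult_le_pos; lra.
  - exists 0%Z, 0%Z. unfold Pr, Xf. split.
    + simpl pow. apply Rabs_le. lra.
    + rewrite Rabs_pos_eq; [lra|]. apply Rmult_le_pos; lra.
Qed.

Lemma family_min e W U : (e = 1 \/ e = -1) -> Fam W U ->
  (forall n, near_V n (e * (W - 1)) (k * e * U)) ->
  grid_min h k (e * (W - 1)) (k * e * U) V.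
Proof.
  intros He HF Hn. split.
  - intros p q. apply family_lower. exists e, W, U. auto.
  - intros c. apply near_V_not_above, Hn.
Qed.

End Family.

Section Words.
Variables (a b : Z) (h k : R).
Hypothesis P : par a b h k.
Let D := h * k.
Let A : adm h k := par_adm _ _ _ _ P.

Definition doubles_value : R := phi h k (ws D) (1 - D * ws D).

(** The disjuncts are the first and the second sign of a block. *)
Definition FamD (W U : R) : Prop := (W = ws D /\ U = 1 - D * ws D) \/ (U = ws D /\ W = 1 - D * ws D).

Lemma doubles_min : grid_min h k (D * ws D) (k * -1 * ws D) doubles_value.
Proof.
  destruct (adm_bounds _ _ A) as (Hk & Hh & Hh' & Hk' & HD & Hd & Hhk). fold D in HD, Hd.
  destruct (ws_bounds D HD) as [Hw Hw1].
  assert (D2 : 0 < D^2 <= 56/1000*D) by nra.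
  assert (Dw : D * 1 <= D * ws D <= D * (1 + D)) by (split; apply Rmult_le_compat_l; lra).
  assert (Fswap : forall W U, FamD W U -> FamD U W) by (unfold FamD; tauto).
  assert (Fnext : forall W U, FamD W U -> exists e W' U', (e = 1 \/ e = -1) /\
    W = 1 + e * D * W' /\ U' = 1 + e * D * U /\ FamD W' U').
  { intros W U [[-> ->]|[-> ->]].
    - exists 1, (1 - D * ws D), (ws D). split; [lra|]. split; [rewrite (ws_eq D) at 1; ring|].
      split; [rewrite (ws_eq D) at 1; ring|]. right. auto.
    - exists (-1), (ws D), (1 - D * ws D). split; [lra|]. split; [ring|]. split; [ring|]. left; auto. }
  assert (FV : forall W U, FamD W U -> doubles_value <= phi h k W U).
  { intros W U [[-> ->]|[-> ->]]; [apply Rle_refl|]. apply phi_swap; [exact A|lra]. }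
  assert (FB : forall W U, FamD W U -> - (D + 12/10*D^2) <= W - 1 <= D + 12/10 * D^2).
  { intros W U [[-> ->]|[-> ->]]; lra. }
  assert (NV : forall n e, (e = 1 \/ e = -1) -> near_V h k doubles_value n (e * (ws D - 1)) (k * e * (1 - D * ws D))).
  { induction n as [|n IH]; intros e He.
    - apply (near_V_start a b h k doubles_value FamD P Fswap FV FB); [exact He|left; auto|apply Rle_refl].
    - apply (near_V_mono a b h k doubles_value P).
      apply (near_V_next a b h k doubles_value P (S n) e 1 _ _ (1 - D * ws D) (ws D)); try assumption; try lra.
      + fold D. rewrite (ws_eq D) at 1. ring.
      + fold D. rewrite (ws_eq D) at 1. ring.
      + apply (near_V_next a b h k doubles_value P n (e * 1) (-1) _ _ (ws D) (1 - D * ws D)); fold D; try lra.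
        apply IH. lra. }
  replace (D * ws D) with (-1 * ((1 - D * ws D) - 1)) at 1 by ring.
  apply (family_min a b h k doubles_value FamD P Fswap Fnext FV FB); [lra|right; auto|].
  intros n. apply (near_V_mono a b h k doubles_value P).
  apply (near_V_next a b h k doubles_value P n (-1) (-1) _ _ (ws D) (1 - D * ws D)); fold D; try lra.
  apply NV. lra.
Qed.

Section Mixed.
Variable e0 : nat.
Let N := (2 * e0)%nat.
Let Delta := ws D - wz D e0.
(* Normalised forward series at a sign followed by exactly [p] blocks of equal signs before the next pair of
   single signs; the backward series take the same values. *)
Definition wp (p : nat) : R := ws D - (- D ^ 2) ^ p * Delta.
Definition mixed_value : R := phi h k (wp N) (1 - D * wp 0).

Lemma wp0 : wp 0 = wz D e0.
Proof. unfold wp, Delta. simpl. ring. Qed.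

Lemma wpN : wp N = ws D - D ^ (4 * e0) * Delta.
Proof.
  unfold wp, N. rewrite (pow_mult (- D ^ 2) 2). replace ((- D^2)^2) with (D ^ 4) by ring.
  rewrite <- pow_mult. reflexivity.
Qed.

Lemma wp_S p : wp (S p) = 1 + D * (1 - D * wp p).
Proof.
  unfold wp. change ((- D ^ 2) ^ S p) with (- D ^ 2 * (- D ^ 2) ^ p). rewrite (ws_eq D) at 1. ring.
Qed.

Lemma wp0_eq : wp 0 = 1 - D * (1 - D * wp N).
Proof.
  destruct (adm_bounds _ _ A) as (Hk & Hh & Hh' & Hk' & HD & Hd & Hhk). fold D in HD.
  rewrite wp0, wpN, (wz_eq D e0 HD) at 1. unfold Delta. ring.
Qed.

Lemma wp_numeric : 0 < k <= 2112/10000 /\ 0 < h <= 264/1000 /\ 0 < D <= 56/1000 /\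
  0 < D^2 <= 56/1000*D /\ D = h * k /\ 18/10 * D <= Delta <= 2 * D /\ 1 <= ws D <= 1 + D - D^2.
Proof.
  destruct (adm_bounds _ _ A) as (Hk & Hh & Hh' & Hk' & HD & Hd & Hhk). fold D in HD.
  destruct (ws_bounds D HD) as [Hw Hw1]. pose proof (wz_bounds D e0 HD) as Hz.
  assert (D2 : 0 < D^2 <= 56/1000*D) by nra.
  assert (0 < D^2 * ws D <= D^2 * (1056/1000)).
  { split; [apply Rmult_lt_0_compat; lra| apply Rmult_le_compat_l; lra]. }
  unfold Delta. repeat split; lra.
Qed.

Lemma wp_even p : Nat.Even p -> wp p = ws D - (D ^ 2) ^ p * Delta.
Proof. intros E. pose proof (pow_neg_even h k p E) as Q. fold D in Q. unfold wp. rewrite Q. reflexivity. Qed.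

Lemma wp_odd p : Nat.Odd p -> wp p = ws D + (D ^ 2) ^ p * Delta.
Proof. intros E. pose proof (pow_neg_odd h k p E) as Q. fold D in Q. unfold wp. rewrite Q. ring. Qed.

Lemma powD2 p q : (p <= q)%nat -> 0 <= (D ^ 2) ^ q <= (D ^ 2) ^ p.
Proof.
  intros H. destruct wp_numeric as (Hk & Hh & HD & HD2 & ED & HDe & Hw).
  split; [apply pow_le; lra|].
  replace q with (p + (q - p))%nat by lia. rewrite pow_add.
  destruct (pow_unit (D^2) (q - p)) as [U0 U1]; [lra|].
  assert (0 <= (D ^ 2) ^ p) by (apply pow_le; lra).
  assert ((D ^ 2) ^ p * (D ^ 2) ^ (q - p) <= (D ^ 2) ^ p * 1) by (apply Rmult_le_compat_l; lra). lra.
Qed.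

Lemma wp_range p : wp 0 <= wp p /\ 1 - D <= wp p <= 1 + D.
Proof.
  destruct wp_numeric as (Hk & Hh & HD & HD2 & ED & HDe & Hw).
  assert (W0 : wp 0 = ws D - Delta) by (unfold wp; simpl; ring).
  assert (L0 : 1 - D <= wp 0) by (rewrite wp0; apply wz_bounds; exact HD).
  destruct (Nat.Even_or_Odd p) as [E|O].
  - rewrite (wp_even p E). destruct (powD2 0 p) as [Q0 Q1]; [lia|]. rewrite pow_O in Q1.
    assert (0 <= (D ^ 2) ^ p * Delta <= 1 * Delta) by (split; [apply Rmult_le_pos|apply Rmult_le_compat_r]; lra).
    lra.
  - rewrite (wp_odd p O). destruct O as [m Hm]. destruct (powD2 1 p) as [Q0 Q1]; [lia|].
    rewrite pow_1 in Q1.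
    assert (0 <= (D ^ 2) ^ p * Delta <= D ^ 2 * Delta) by (split; [apply Rmult_le_pos|apply Rmult_le_compat_r]; lra).
    assert (D^2 * Delta <= D^2 * (2 * D)) by (apply Rmult_le_compat_l; lra).
    assert (D^2 * (2 * D) <= D^2 * 1) by (apply Rmult_le_compat_l; lra). lra.
Qed.

(** First signs of the blocks, and of the single pair when [p = 0], with [p] blocks ahead in the gap
    and [q] behind; the second disjunct is their mirror image. *)
Definition FamM (W U : R) : Prop := exists p q, (p + q = N)%nat /\
  ((W = wp p /\ U = 1 - D * wp q) \/ (U = wp p /\ W = 1 - D * wp q)).

(** The minimum sits right after a single pair, at [p = N]. For even [p] both factors are at least
    their critical values; for odd [p] also [q] is odd, and the second factor gains order
    [k D Delta], more than the order [D^2 Delta] that the first can lose. *)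
Lemma wp_critical p q : (p + q = N)%nat -> mixed_value <= phi h k (wp p) (1 - D * wp q).
Proof.
  intros Hpq. destruct wp_numeric as (Hk & Hh & HD & HD2 & ED & HDe & Hw).
  unfold mixed_value, phi.
  destruct (wp_range p) as [_ Rp]. destruct (wp_range q) as [Q0 Rq]. destruct (wp_range N) as [_ RN].
  destruct (wp_range 0) as [_ R0].
  assert (EN : Nat.Even N) by (exists e0; reflexivity).
  assert (kD : 0 < k * D <= 2112/10000*(56/1000)) by (split; [apply Rmult_lt_0_compat|apply Rmult_le_compat]; lra).
  assert (kD0 : 0 <= k * (D * wp 0)) by (apply Rmult_le_pos; [|apply Rmult_le_pos]; lra).
  assert (kDq : k * (D * wp 0) <= k * (D * wp q)).
  { apply Rmult_le_compat_l; [lra|]. apply Rmult_le_compat_l; lra. }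
  destruct (Nat.Even_or_Odd p) as [E|O].
  - assert (wp p <= wp N).
    { rewrite (wp_even p E), (wp_even N EN). destruct (powD2 p N) as [Z0 Z1]; [lia|].
      assert ((D ^ 2) ^ N * Delta <= (D ^ 2) ^ p * Delta) by (apply Rmult_le_compat_r; lra). lra. }
    apply Rmult_le_compat; lra.
  - assert (Oq : Nat.Odd q).
    { destruct (Nat.Even_or_Odd q) as [[m Hm]|]; [exfalso|assumption].
      destruct O as [m' Hm'], EN as [m'' Hm'']. lia. }
    assert (Lq : Delta <= wp q - wp 0).
    { rewrite (wp_odd q Oq). unfold wp; simpl.
      assert (0 <= (D ^ 2) ^ q * Delta) by (apply Rmult_le_pos; [apply pow_le|]; lra). simpl in *. lra. }
    assert (Lp : wp p - wp N <= 2 * D^2 * Delta).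
    { rewrite (wp_odd p O), (wp_even N EN). destruct O as [m Hm].
      destruct (powD2 1 p) as [Z0 Z1]; [lia|]. destruct (powD2 1 N) as [Z2 Z3]; [lia|]. rewrite pow_1 in *.
      assert ((D ^ 2) ^ p * Delta <= D ^ 2 * Delta) by (apply Rmult_le_compat_r; lra).
      assert ((D ^ 2) ^ N * Delta <= D ^ 2 * Delta) by (apply Rmult_le_compat_r; lra). lra. }
    assert (G : k * D * Delta * (6/10) <= k * D * (wp q - wp 0) * (2 - h - wp p)).
    { apply Rmult_le_compat; [apply Rmult_le_pos; lra|lra| |lra]. apply Rmult_le_compat_l; lra. }
    assert (Lo : (wp p - wp N) * (1 - k - k * (1 - D * wp 0)) <= 2 * D^2 * Delta).
    { destruct (Rle_dec (wp p) (wp N)).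
      - assert (0 <= (wp N - wp p) * (1 - k - k * (1 - D * wp 0))) by (apply Rmult_le_pos; lra).
        assert (0 <= D^2 * Delta) by (apply Rmult_le_pos; lra). lra.
      - assert ((wp p - wp N) * (1 - k - k * (1 - D * wp 0)) <= (wp p - wp N) * 1); [|lra].
        assert (k * (D * wp 0) <= k * 1).
        { apply Rmult_le_compat_l; [lra|]. assert (D * wp 0 <= D * 2) by (apply Rmult_le_compat_l; lra). lra. }
        apply Rmult_le_compat_l; lra. }
    assert (Cm : D^2 * Delta <= 264/1000 * (k * D * Delta)).
    { replace (D^2 * Delta) with (h * (k * D * Delta)) by (unfold D; ring).
      apply Rmult_le_compat_r; [apply Rmult_le_pos; lra|lra]. }
    assert (0 < k * D * Delta) by (apply Rmult_lt_0_compat; lra).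
    lra.
Qed.

Lemma mixed_min : grid_min h k (- (D * wz D e0)) (k * wp N) mixed_value.
Proof.
  destruct wp_numeric as (Hk & Hh & HD & HD2 & ED & HDe & Hw).
  assert (Dw : forall p, D - D^2 <= D * wp p <= D + D^2).
  { intros p. destruct (wp_range p) as [_ R].
    assert (D * (1 - D) <= D * wp p <= D * (1 + D)) by (split; apply Rmult_le_compat_l; lra). lra. }
  assert (Fswap : forall W U, FamM W U -> FamM U W).
  { intros W U (p & q & E & H). exists p, q. split; [exact E|tauto]. }
  assert (Fnext : forall W U, FamM W U -> exists e W' U', (e = 1 \/ e = -1) /\
    W = 1 + e * D * W' /\ U' = 1 + e * D * U /\ FamM W' U').
  { intros W U (p & q & E & [[-> ->]|[-> ->]]).
    - destruct p as [|p].
      + exists (-1), (1 - D * wp N), (wp 0). split; [lra|]. split; [rewrite wp0_eq; ring|].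
        replace q with N by lia. split; [rewrite wp0_eq; ring|].
        exists 0%nat, N. split; [lia|right; auto].
      + exists 1, (1 - D * wp p), (wp (S q)). split; [lra|]. rewrite !wp_S.
        split; [ring|]. split; [ring|]. exists (S q), p. split; [lia|right; split; [apply eq_sym, wp_S|reflexivity]].
    - exists (-1), (wp q), (1 - D * wp p). split; [lra|]. split; [ring|]. split; [ring|].
      exists q, p. split; [lia|left; auto]. }
  assert (FV : forall W U, FamM W U -> mixed_value <= phi h k W U).
  { intros W U (p & q & E & [[-> ->]|[-> ->]]); [apply wp_critical, E|].
    eapply Rle_trans; [apply wp_critical, E|]. apply phi_swap; [exact A|].
    destruct p as [|p].
    - replace q with N by lia. rewrite wp0_eq at 1.
      assert (D * 1 <= D * (wp N * (1 + D))); [|lra].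
      apply Rmult_le_compat_l; [lra|].
      destruct (wp_range N) as [L _]. rewrite wp0_eq in L.
      apply (Rmult_le_reg_r (1 - D)); lra.
    - rewrite wp_S. specialize (Dw p) as D1. specialize (Dw q) as D3.
      assert (0 <= D * (1 - D * wp p)) by (apply Rmult_le_pos; lra). lra. }
  assert (FB : forall W U, FamM W U -> - (D + 12/10*D^2) <= W - 1 <= D + 12/10 * D^2).
  { intros W U (p & q & E & [[-> ->]|[-> ->]]).
    - destruct (wp_range p) as [_ R]. lra.
    - specialize (Dw q). lra. }
  (* From any position the critical one recurs after finitely many signs; all that is kept of the
     way there is one more factor [D]. *)
  assert (Loop : forall n, (forall e, (e = 1 \/ e = -1) -> near_V h k mixed_value n (e * (wp N - 1)) (k * e * (1 - D * wp 0))) ->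
    forall p q, (p + q = N)%nat -> forall e, (e = 1 \/ e = -1) ->
      near_V h k mixed_value (S n) (e * (wp p - 1)) (k * e * (1 - D * wp q))).
  { intros n Hn. induction p as [|p IH]; intros q E e He.
    - replace q with N by lia. apply (near_V_mono a b h k mixed_value P).
      apply (near_V_next a b h k mixed_value P (S n) e (-1) _ _ (1 - D * wp N) (wp 0)); fold D; try lra.
      + rewrite wp0_eq; ring.
      + rewrite wp0_eq; ring.
      + apply (near_V_next a b h k mixed_value P n (e * -1) (-1) _ _ (wp N) (1 - D * wp 0)); fold D; try lra.
        apply Hn. lra.
    - apply (near_V_mono a b h k mixed_value P). apply (near_V_mono a b h k mixed_value P).
      apply (near_V_next a b h k mixed_value P (S (S n)) e 1 _ _ (1 - D * wp p) (wp (S q))); fold D; try lra.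
      + rewrite wp_S; ring.
      + rewrite wp_S; ring.
      + apply (near_V_next a b h k mixed_value P (S n) (e * 1) (-1) _ _ (wp p) (1 - D * wp (S q))); fold D; try lra.
        apply IH; [lia|lra]. }
  assert (NV : forall n e, (e = 1 \/ e = -1) -> near_V h k mixed_value n (e * (wp N - 1)) (k * e * (1 - D * wp 0))).
  { induction n as [|n IH]; intros e He.
    - apply (near_V_start a b h k mixed_value FamM P Fswap FV FB); [exact He| |apply Rle_refl].
      exists N, 0%nat. split; [lia|left; auto].
    - apply Loop; [exact IH|lia|exact He]. }
  replace (- (D * wz D e0)) with (1 * ((1 - D * wp 0) - 1)) by (rewrite wp0; ring).
  replace (k * wp N) with (k * 1 * wp N) by ring.
  apply (family_min a b h k mixed_value FamM P Fswap Fnext FV FB); [lra| |].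
  { exists N, 0%nat. split; [lia|right; auto]. }
  intros n. apply (near_V_mono a b h k mixed_value P).
  apply (near_V_next a b h k mixed_value P n 1 (-1) _ _ (wp 0) (1 - D * wp N)); fold D; try lra.
  apply (near_V_mono a b h k mixed_value P). apply Loop; [apply NV|lia|lra].
Qed.

End Mixed.
End Words.

(** * The constant word *)

(** Corner values of the constant word. The remaining corner exceeds [c1] because [xC < 0 < yC]. *)
Definition c1 (h k : R) := (1 - h + xC h k) * (1 - k + yC h k).
Definition c2 (h k : R) := (1 + h + xC h k) * (1 + k - yC h k).
Definition c4 (h k : R) := (1 - h - xC h k) * (1 - k - yC h k).
Definition C_value (h k : R) := Rmin (c1 h k) (Rmin (c2 h k) (c4 h k)).

Lemma c1_eq h k : h * k < 1 ->
  c1 h k * (1 - h * k)^2 = (1 - 3*h + 2*(h*k) + h*(h*k)) * (1 + 2*k - 3*(h*k) + k*(h*k)).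
Proof. intros H. unfold c1, xC, yC. field. lra. Qed.

Lemma c2_eq h k : h * k < 1 ->
  c2 h k * (1 - h * k)^2 = (1 - h + 2*(h*k) - h*(h*k)) * (1 - 2*k + h*k - k*(h*k)).
Proof. intros H. unfold c2, xC, yC. field. lra. Qed.

Lemma c4_eq h k : h * k < 1 ->
  c4 h k * (1 - h * k)^2 = (1 + h - 4*(h*k) + h*(h*k)) * (1 - 4*k + h*k + k*(h*k)).
Proof. intros H. unfold c4, xC, yC. field. lra. Qed.

(** The value of alternating signs, where [wz D 0 = 1 / (1 + D)]; it equals [mixed_value] at 0. *)
Definition alternating_value (h k : R) := let D := h * k in (1 - h + D / (1 + D)) * (1 - 2*k + k * (D / (1 + D))).

(** * Corners of the constant word against the limit and the alternating value *)

Section Compare.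
Variables (h k : R).
Hypothesis A : adm h k.
Let D := h * k.

Lemma mono (m : R) : 0 <= m -> 0 <= D * m <= 56/1000 * m /\ 0 <= h * m <= 264/1000 * m /\ 0 <= k * m <= 2112/10000 * m.
Proof.
  intros Hm. destruct (adm_bounds _ _ A) as (Hk & Hh & Hh' & Hk' & HD & Hd & Hhk). fold D in HD.
  repeat split; try (apply Rmult_le_pos; lra); apply Rmult_le_compat_r; lra.
Qed.

(** Every monomial left after clearing [(1 - D)^2] is bounded by one of lower degree, so that [lra]
    can treat the monomials as independent variables. *)
Lemma monos : let d := D in 0 < d <= 56/1000 /\ 0 < h <= 264/1000 /\ 0 < k <= 2112/10000 /\ k < h /\ d <= 264/1000 * k /\ d <= 2112/10000 * h /\
  0 < k * d <= h * d /\ k * d <= 2112/10000 * d /\ h * d <= 264/1000*d /\ 0 <= d * d <= 264/1000 * (k * d) /\ d * d <= 2112/10000 * (h * d) /\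
  0 <= k * (d * d) <= 2112/10000 * (d * d) /\ 0 <= h * (d * d) <= 264/1000 * (d * d) /\
  0 <= d * (d * d) <= 56/1000 * (d * d) /\
  0 <= k * (d * (d * d)) <= 2112/10000 * (d * (d * d)) /\ 0 <= h * (d * (d * d)) <= 264/1000 * (d * (d * d)) /\
  0 <= d * (d * (d * d)) <= 56/1000 * (d * (d * d)) /\
  0 <= k * (d * (d * (d * d))) <= 2112/10000 * (d * (d * (d * d))) /\ 0 <= h * (d * (d * (d * d))) <= 264/1000 * (d * (d * (d * d))) /\
  0 <= d * (d * (d * (d * d))) <= 56/1000 * (d * (d * (d * d))) /\
  0 <= k * (d * (d * (d * (d * d)))) <= 2112/10000 * (d * (d * (d * (d * d)))) /\
  0 <= h * (d * (d * (d * (d * d)))) <= 264/1000 * (d * (d * (d * (d * d)))) /\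
  0 <= d * (d * (d * (d * (d * d)))) <= 56/1000 * (d * (d * (d * (d * d)))) /\
  0 <= k * (d * (d * (d * (d * (d * d))))) <= 2112/10000 * (d * (d * (d * (d * (d * d))))) /\
  0 <= h * (d * (d * (d * (d * (d * d))))) <= 264/1000 * (d * (d * (d * (d * (d * d))))).
Proof.
  intros d. destruct (adm_bounds _ _ A) as (Hk & Hh & Hh' & Hk' & HD & Hd & Hhk). fold D in HD. fold d in HD.
  pose proof (mono d ltac:(lra)) as M1. fold d in M1.
  pose proof (mono (d * d) ltac:(lra)) as M2. fold d in M2.
  pose proof (mono (d * (d * d)) ltac:(lra)) as M3. fold d in M3.
  pose proof (mono (d * (d * (d * d))) ltac:(lra)) as M4. fold d in M4.
  pose proof (mono (d * (d * (d * (d * d)))) ltac:(lra)) as M5. fold d in M5.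
  pose proof (mono (d * (d * (d * (d * (d * d))))) ltac:(lra)) as M6. fold d in M6.
  assert (d <= 264/1000 * k) by (apply Rmult_le_compat_r; lra).
  assert (d <= 2112/10000 * h) by (unfold d, D; rewrite (Rmult_comm h k); apply Rmult_le_compat_r; lra).
  assert (k * d <= h * d) by (apply Rmult_le_compat_r; lra).
  assert (d * d <= 264/1000 * k * d) by (apply Rmult_le_compat_r; lra).
  assert (d * d <= 2112/10000 * h * d) by (apply Rmult_le_compat_r; lra).
  assert (0 < k * d) by (apply Rmult_lt_0_compat; lra).
  repeat split; lra.
Qed.

Lemma limit_value_upper : limit_value h k <= (1 - h - D + D^2 + D^3) * (1 - 2*k + k*D).
Proof.
  destruct monos as (HD & Hh & Hk & _).
  unfold limit_value. fold D. destruct (ws_bounds D HD) as [Hw Hw1].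
  assert (D2 : 0 < D^2 <= 56/1000*D) by nra.
  assert (E := ws_eq D).
  assert (D^2 * ws D <= D^2 * (1 + D)) by (apply Rmult_le_compat_l; lra).
  assert (D^2 * ws D <= D^2 * 2) by (apply Rmult_le_compat_l; lra).
  assert (0 <= D^2 * ws D) by (apply Rmult_le_pos; lra).
  assert (kD : 0 < k * D) by (apply Rmult_lt_0_compat; lra).
  assert (0 <= k * D * (1 - D + D^2 * ws D) <= k * D * 1).
  { split; [apply Rmult_le_pos|apply Rmult_le_compat_l]; lra. }
  apply Rmult_le_compat; lra.
Qed.

Lemma limit_value_lower : (1 - h - D + D^2) * (1 - 2*k + k*D - k*D^2) <= limit_value h k.
Proof.
  destruct monos as (HD & Hh & Hk & _).
  unfold limit_value. fold D. destruct (ws_bounds D HD) as [Hw Hw1].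
  assert (D2 : 0 < D^2 <= 56/1000*D) by nra.
  assert (0 <= D^2 * ws D) by (apply Rmult_le_pos; lra).
  assert (kD : 0 < k * D <= k * 1) by (split; [apply Rmult_lt_0_compat|apply Rmult_le_compat_l]; lra).
  assert (0 <= k * D^2 <= k * D * 1).
  { split; [apply Rmult_le_pos; lra|]. replace (k * D^2) with (k * D * D) by ring. apply Rmult_le_compat_l; lra. }
  assert (k * D * (1 - D) <= k * D * (1 - D + D^2 * ws D)) by (apply Rmult_le_compat_l; lra).
  apply Rmult_le_compat; lra.
Qed.

Lemma alternating_value_bounds : (1 - h + D - D^2) * (1 - 2*k + k*D - k*D^2) <= alternating_value h k <= (1 - h + D - D^2 + D^3) * (1 - 2*k + k*D).
Proof.
  destruct monos as (HD & Hh & Hk & _).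
  unfold alternating_value. fold D.
  assert (D2 : 0 < D^2 <= 56/1000*D) by nra.
  assert (D3 : 0 < D^3 <= D^2*1).
  { replace (D^3) with (D^2 * D) by ring. split; [apply Rmult_lt_0_compat; lra|apply Rmult_le_compat_l; lra]. }
  assert (E : D / (1 + D) = D - D^2 + D^3 / (1 + D)) by (field; lra).
  assert (E3 : 0 <= D^3 / (1 + D) <= D^3).
  { split; [apply Rmult_le_pos; [lra|left; apply Rinv_0_lt_compat; lra]|].
    apply (Rmult_le_reg_r (1 + D)); [lra|].
    replace (D^3 / (1 + D) * (1 + D)) with (D^3) by (field; lra). nra. }
  assert (k * (D - D^2) <= k * (D / (1 + D)) <= k * D) by (split; apply Rmult_le_compat_l; lra).
  assert (0 <= k * (D - D^2)) by (apply Rmult_le_pos; lra).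
  split; apply Rmult_le_compat; lra.
Qed.

Lemma sq_pos : 0 < (1 - D)^2.
Proof. destruct monos as (HD & _). apply pow_lt. lra. Qed.

Ltac go E := pose proof monos as MM; cbv zeta in MM; destruct MM as (?&?&?&?&?&?&?&?&?&?&?&?&?&?&?&?&?&?&?&?&?&?&?&?&?);
  pose proof sq_pos as SQ; apply (Rmult_lt_reg_r ((1 - D)^2)) || apply (Rmult_le_reg_r ((1 - D)^2)); [exact SQ|unfold D in *; rewrite E by lra; lra].

Lemma rel_lower t u : 0 <= t <= 5 -> t * D <= (1 + D) * u -> t * D - t * (D * D) <= u.
Proof.
  intros Ht H. destruct monos as (HD & _).
  apply (Rmult_le_reg_l (1 + D)); [lra|].
  assert (0 <= t * (D * (D * D))) by (apply Rmult_le_pos; [lra|]; apply Rmult_le_pos; [lra|]; apply Rmult_le_pos; lra).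
  lra.
Qed.

Lemma rel_upper t u : 0 <= t -> (1 + D) * u <= t * D -> 0 <= u -> u <= t * D.
Proof.
  intros Ht H Hu. destruct monos as (HD & _).
  assert (0 <= D * u) by (apply Rmult_le_pos; lra). lra.
Qed.

(** Equality is the case [b = a + 3]. After multiplication by [(1 - D)^2] the two sides then agree
    to second order, and the third-order term [10 k D] decides. *)
Lemma c4_gt : 3 * D <= (1 + D) * (h - k) -> limit_value h k < c4 h k.
Proof.
  intros H. eapply Rle_lt_trans; [apply limit_value_upper|].
  apply rel_lower in H; [|lra]. go c4_eq.
Qed.

(** As for [c4_gt], with equality at [b = 2 a - 3] and the third-order term [8 h D - 2 k D],
    positive since [k < h]. *)
Lemma c1_gt : 3 * D <= (1 + D) * (2 * k - h) -> limit_value h k < c1 h k.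
Proof.
  intros H. eapply Rle_lt_trans; [apply limit_value_upper|].
  apply rel_lower in H; [|lra]. go c1_eq.
Qed.

Lemma c2_gt : limit_value h k < c2 h k.
Proof. eapply Rle_lt_trans; [apply limit_value_upper|]. go c2_eq. Qed.

Lemma c4_le : (1 + D) * (h - k) <= D -> c4 h k <= limit_value h k.
Proof.
  intros H. eapply Rle_trans; [|apply limit_value_lower].
  assert (h - k <= 1 * D) by (destruct monos as (_ & _ & _ & L & _); apply rel_upper; lra). go c4_eq.
Qed.

Lemma c1_le : (1 + D) * (2 * k - h) <= D -> c1 h k <= limit_value h k.
Proof.
  intros H. eapply Rle_trans; [|apply limit_value_lower].
  assert (2 * k - h <= 1 * D).
  { destruct (Rle_dec 0 (2 * k - h)); [apply rel_upper; lra|]. destruct monos as (HD & _). lra. }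
  go c1_eq.
Qed.

Lemma c4_ge_alternating : 5 * D <= (1 + D) * (h - k) -> alternating_value h k <= c4 h k.
Proof.
  intros H. eapply Rle_trans; [apply alternating_value_bounds|].
  apply rel_lower in H; [|lra]. go c4_eq.
Qed.

Lemma c1_ge_alternating : 5 * D <= (1 + D) * (2 * k - h) -> alternating_value h k <= c1 h k.
Proof.
  intros H. eapply Rle_trans; [apply alternating_value_bounds|].
  apply rel_lower in H; [|lra]. go c1_eq.
Qed.

Lemma c2_ge_alternating : alternating_value h k <= c2 h k.
Proof. eapply Rle_trans; [apply alternating_value_bounds|]. go c2_eq. Qed.

(** The second-order margin is only [2 D], and a third-order term [14 k D] works against it; hence
    the smaller bound on [k]. *)
Lemma c4_le_alternating : 9 * k <= 1 + D -> (1 + D) * (h - k) <= 3 * D -> c4 h k <= alternating_value h k.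
Proof.
  intros H9 H. eapply Rle_trans; [|apply alternating_value_bounds].
  assert (h - k <= 3 * D) by (destruct monos as (_ & _ & _ & L & _); apply rel_upper; lra).
  assert (k <= 118/1000) by (destruct monos as (HD & _); lra).
  assert (k * D <= 118/1000 * D) by (destruct monos as (HD & _ & _ & L & _); apply Rmult_le_compat_r; lra).
  go c4_eq.
Qed.

(** The margin [2 D] faces the third-order term [8 h D + 2 k D], hence the smaller bounds on both
    [h] and [k]. *)
Lemma c1_le_alternating : 6 * h <= 1 + D -> 9 * k <= 1 + D -> (1 + D) * (2 * k - h) <= 3 * D -> c1 h k <= alternating_value h k.
Proof.
  intros H6 H9 H. eapply Rle_trans; [|apply alternating_value_bounds].
  assert (2 * k - h <= 3 * D).
  { destruct (Rle_dec 0 (2 * k - h)); [apply rel_upper; lra|]. destruct monos as (HD & _). lra. }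
  assert (h <= 176/1000) by (destruct monos as (HD & _); lra).
  assert (k <= 118/1000) by (destruct monos as (HD & _); lra).
  assert (k * D <= 118/1000 * D) by (destruct monos as (HD & _ & _ & L & _); apply Rmult_le_compat_r; lra).
  assert (h * D <= 176/1000 * D) by (destruct monos as (HD & _ & _ & L & _); apply Rmult_le_compat_r; lra).
  go c1_eq.
Qed.
End Compare.

Lemma C_min a b h k : par a b h k -> grid_min h k (xC h k) (yC h k) (C_value h k).
Proof.
  intros P. pose proof (par_adm _ _ _ _ P) as A.
  destruct (adm_bounds _ _ A) as (Hk & Hh & Hh' & Hk' & HD & Hd & Hhk).
  pose proof P as [Ha Hb _ [m Hm] _ [n Hn] _ _ _].
  assert (FX : xC h k = h * (IZR (-2) + k * (IZR 3 + xC h k))) by (unfold xC; field; lra).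
  assert (FY : yC h k = k * (IZR 3 + h * (IZR (-2) + yC h k))) by (unfold yC; field; lra).
  assert (FX' : xC h k = h * (-2 + yC h k)) by (unfold xC, yC; field; lra).
  assert (FY' : yC h k = k * (3 + xC h k)) by (unfold xC, yC; field; lra).
  assert (St : step h k (-2) 3 (xC h k) (yC h k) (xC h k) (yC h k)).
  { split; [exists (-1)%Z; lia|exists 1%Z; lia|exact FX|exact FY]. }
  assert (EX : xC h k * (1 - h * k) = 3 * (h * k) - 2 * h) by (unfold xC; field; lra).
  assert (EY : yC h k * (1 - h * k) = 3 * k - 2 * (h * k)) by (unfold yC; field; lra).
  assert (BX : - (1 - h) < xC h k < 0).
  { assert (0 < h * (h * k)) by (apply Rmult_lt_0_compat; lra).
    assert (h * k <= h * (2112/10000)) by (apply Rmult_le_compat_l; lra).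
    split; apply (Rmult_lt_reg_r (1 - h * k)); lra. }
  assert (DK : h * k <= 264/1000 * k) by (apply Rmult_le_compat_r; lra).
  assert (BY : 0 < yC h k < 1 - k).
  { assert (0 < k * (h * k)) by (apply Rmult_lt_0_compat; lra).
    split; apply (Rmult_lt_reg_r (1 - h * k)); lra. }
  assert (L1 : C_value h k <= c1 h k) by apply Rmin_l.
  assert (L2 : C_value h k <= c2 h k) by (eapply Rle_trans; [apply Rmin_r|apply Rmin_l]).
  assert (L4 : C_value h k <= c4 h k) by (eapply Rle_trans; [apply Rmin_r|apply Rmin_r]).
  assert (L3 : C_value h k <= (1 + h - xC h k) * (1 + k + yC h k)).
  { eapply Rle_trans; [exact L1|]. unfold c1. apply Rmult_le_compat; lra. }
  unfold c1, c2, c4 in L1, L2, L4.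
  assert (S0 : forall p q, (p = 0 \/ p = -1)%Z -> (q = 0 \/ q = -1)%Z ->
      Rabs (Pr h k (xC h k) (yC h k) p q) <= C_value h k -> near_V h k (C_value h k) 0 (xC h k) (yC h k)).
  { intros p q Hp Hq HV. exists p, q. split; [|exact HV].
    rewrite pow_O. unfold Xf. apply Rabs_le.
    destruct Hp as [-> | ->], Hq as [-> | ->]; lra. }
  assert (NV : forall j, near_V h k (C_value h k) j (xC h k) (yC h k)).
  { induction j as [|j IH]; [|eapply near_V_step; eassumption].
    unfold C_value, Rmin in S0 |- *.
    destruct (Rle_dec (c2 h k) (c4 h k)) as [R2|R2]; destruct (Rle_dec (c1 h k) _) as [R1|R1];
      [apply (S0 0 0)%Z|apply (S0 0 (-1))%Z|apply (S0 0 0)%Z|apply (S0 (-1) (-1))%Z]; auto;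
      unfold Pr, Xf, c1, c2, c4 in *.
    1, 3: rewrite Rabs_pos_eq; [right; ring|apply Rmult_le_pos; lra].
    - rewrite Rabs_left1; [right; ring|].
      assert (0 <= (1 + h + xC h k) * (1 + k - yC h k)) by (apply Rmult_le_pos; lra). lra.
    - assert (0 <= (1 - h - xC h k) * (1 - k - yC h k)) by (apply Rmult_le_pos; lra).
      rewrite Rabs_pos_eq; [right; ring|]. lra. }
  split; [|intros c; apply (near_V_not_above a b h k _ P _ _ _ NV)].
  intros p q.
  apply (grid_lower a b h k (C_value h k) (fun X Y => (X = xC h k /\ Y = yC h k) \/ (X = - xC h k /\ Y = - yC h k)));
    try lra; try assumption; try (left; split; reflexivity).
  - intros X Y [[-> ->]|[-> ->]].
    + exists (-2)%Z, (m - 2)%Z, (xC h k), (yC h k). split; [lia|]. auto.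
    + exists 2%Z, m, (- xC h k), (- yC h k). split; [lia|]. split; [lra|]. split; [lra|]. auto.
  - intros X Y [[-> ->]|[-> ->]].
    + exists 3%Z, (n + 1)%Z, (xC h k), (yC h k). split; [lia|]. auto.
    + exists (-3)%Z, (n - 2)%Z, (- xC h k), (- yC h k). split; [lia|]. split; [lra|]. split; [lra|]. auto.
  - intros X Y [[-> ->]|[-> ->]]; split; lra.
  - intros X Y [[-> ->]|[-> ->]]; [right|left]; split; ring.
Qed.

Lemma C_value_upper h k L : C_value h k = L -> L <= c1 h k /\ L <= c4 h k.
Proof.
  intros <-. split; [apply Rmin_l|]. eapply Rle_trans; [apply Rmin_r|apply Rmin_r].
Qed.

(** * Closed form, monotonicity and limit of the mixed values *)

Section Values.
Variables (h k : R).
Hypothesis A : adm h k.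
Let D := h * k.
(** The limit of [ws D - wz D e] for large [e]. *)
Definition Gam : R := ws D - (1 - D + D ^ 2 * ws D).
(** The amount by which the forward series at the critical position falls short of [ws D]; it alone
    determines [mixed_value], monotonically. *)
Definition Rm (e : nat) : R := D ^ (4 * e) * (ws D - wz D e).
Let A1 := 2 - h - ws D.
Let A2 := 1 - 2 * k + k * D * (1 - D + D ^ 2 * ws D).

Lemma mixed_value_eq e : mixed_value h k e = (A1 + Rm e) * (A2 - k * D ^ 3 * Rm e).
Proof.
  destruct (adm_bounds _ _ A) as (Hk & Hh & Hh' & Hk' & HD & Hd & Hhk). fold D in HD.
  unfold mixed_value, phi. fold D. rewrite wp0, wpN. fold D.
  pose proof (wz_eq D e HD) as E. unfold Rm, A1, A2.
  replace (1 - D * wz D e) with (1 - D * (1 - D + D ^ 2 * (ws D + D ^ (4 * e) * (wz D e - ws D)))) by (rewrite <- E; reflexivity).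
  ring.
Qed.

Lemma values_numeric : 0 < k <= 2112/10000 /\ 0 < h <= 264/1000 /\ 0 < D <= 56/1000 /\
  0 < D^2 <= 56/1000*D /\ 57/100 <= A1 <= 1 /\ 57/100 <= A2 <= 1 /\ 18/10 * D <= Gam <= 2 * D /\
  0 < k * D ^ 3 <= 1/1000.
Proof.
  destruct (numeric h k A) as (Hk & Hh & HD & HD2 & _ & HA1 & HA2 & Hw). fold D in HD, HD2, HA1, HA2, Hw. fold A1 in HA1. fold A2 in HA2.
  assert (D2w : D^2 * (9/10) <= D^2 * ws D <= D^2 * (11/10)) by (split; apply Rmult_le_compat_l; lra).
  assert (0 < k * D^3).
  { apply Rmult_lt_0_compat; [lra|apply pow_lt; lra]. }
  assert (k * D^3 <= 1/1000).
  { replace (D^3) with (D * D^2) by ring.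
    assert (D * D^2 <= 56/1000*(56/1000*(56/1000))) by (apply Rmult_le_compat; lra).
    assert (k * (D * D^2) <= k * (56/1000*(56/1000*(56/1000)))) by (apply Rmult_le_compat_l; lra). lra. }
  unfold Gam. repeat split; lra.
Qed.

Lemma Rm_eq e : Rm e * (1 - D ^ (4 * e) * D ^ 2) = D ^ (4 * e) * Gam.
Proof.
  destruct values_numeric as (_ & _ & HD & _). unfold Rm, Gam.
  rewrite (wz_eq D e HD) at 1. pose proof (wz_eq D e HD) as E.
  set (q := D ^ (4 * e)) in *. set (z := wz D e) in *.
  transitivity (q * (ws D - z - D^2 * q * (ws D - z))); [|rewrite E at 1; ring].
  rewrite <- E. ring.
Qed.

Lemma Rm_bounds e : 0 < Rm e <= 21/10 * D /\ Rm e <= 21/10 * D * D ^ (4 * e).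
Proof.
  destruct values_numeric as (Hk & Hh & HD & HD2 & HA1 & HA2 & HG & Hg).
  destruct (pow_unit D (4 * e)) as [_ P1]; [lra|]. assert (P0 : 0 < D ^ (4 * e)) by (apply pow_lt; lra).
  pose proof (wz_bounds D e HD) as Hz. destruct (ws_bounds D HD) as [Hw Hw1].
  assert (D2w : D^2 * (9/10) <= D^2 * ws D <= D^2 * (11/10)) by (split; apply Rmult_le_compat_l; lra).
  assert (Rm e <= D ^ (4 * e) * (21/10 * D)) by (unfold Rm; apply Rmult_le_compat_l; lra).
  assert (D ^ (4 * e) * (21/10 * D) <= 1 * (21/10 * D)) by (apply Rmult_le_compat_r; lra).
  assert (0 < Rm e) by (unfold Rm; apply Rmult_lt_0_compat; lra).
  repeat split; lra.
Qed.

Lemma Rm_decr e : Rm (S e) < Rm e.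
Proof.
  destruct values_numeric as (Hk & Hh & HD & HD2 & HA1 & HA2 & HG & Hg).
  pose proof (Rm_eq e) as E1. pose proof (Rm_eq (S e)) as E2.
  destruct (Rm_bounds e) as [B1 _]. destruct (Rm_bounds (S e)) as [B2 _].
  assert (P0 : 0 < D ^ (4 * e)) by (apply pow_lt; lra). destruct (pow_unit D (4 * e)) as [_ P1]; [lra|].
  assert (Q : D ^ (4 * S e) < D ^ (4 * e)).
  { replace (4 * S e)%nat with (4 + 4 * e)%nat by lia. rewrite pow_add.
    assert (D ^ 4 < 1).
    { replace (D^4) with (D^2 * D^2) by ring. assert (D^2*D^2 < 1 * 1) by (apply Rmult_gt_0_lt_compat; lra). lra. }
    assert (D ^ 4 * D ^ (4 * e) < 1 * D ^ (4 * e)) by (apply Rmult_lt_compat_r; lra). lra. }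
  set (q := D ^ (4 * e)) in *. set (q' := D ^ (4 * S e)) in *.
  assert (q' * Gam < q * Gam) by (apply Rmult_lt_compat_r; lra).
  assert (q * D^2 <= 1 * D^2) by (apply Rmult_le_compat_r; lra).
  assert (q' * D^2 <= q * D^2) by (apply Rmult_le_compat_r; lra).
  apply Rnot_le_lt; intro N.
  assert (Rm e * (1 - q * D^2) <= Rm (S e) * (1 - q * D^2)) by (apply Rmult_le_compat_r; lra).
  assert (Rm (S e) * (1 - q * D^2) <= Rm (S e) * (1 - q' * D^2)) by (apply Rmult_le_compat_l; lra).
  lra.
Qed.

Lemma value_incr r r' : 0 <= r < r' -> r' <= 21/10 * D ->
  (A1 + r) * (A2 - k * D ^ 3 * r) < (A1 + r') * (A2 - k * D ^ 3 * r').
Proof.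
  intros Hr Hr'. destruct values_numeric as (Hk & Hh & HD & HD2 & HA1 & HA2 & HG & Hg).
  set (g := k * D^3) in *.
  assert (0 < (r' - r) * (A2 - g * (A1 + r + r'))).
  { apply Rmult_lt_0_compat; [lra|].
    assert (g * (A1 + r + r') <= 1/1000 * 3) by (apply Rmult_le_compat; lra). lra. }
  lra.
Qed.

Lemma mixed_value_decr e : mixed_value h k (S e) < mixed_value h k e.
Proof.
  rewrite !mixed_value_eq. apply value_incr; [|apply Rm_bounds]. split; [|apply Rm_decr].
  destruct (Rm_bounds (S e)). lra.
Qed.

Lemma mixed_value_gt e : limit_value h k < mixed_value h k e.
Proof.
  rewrite mixed_value_eq. unfold limit_value. fold D A1 A2.
  replace (A1 * A2) with ((A1 + 0) * (A2 - k * D^3 * 0)) by ring.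
  apply value_incr; [|apply Rm_bounds]. destruct (Rm_bounds e). lra.
Qed.

Lemma mixed_value_le e : mixed_value h k e <= limit_value h k + Rm e.
Proof.
  destruct values_numeric as (Hk & Hh & HD & HD2 & HA1 & HA2 & HG & Hg).
  destruct (Rm_bounds e) as [B _]. rewrite mixed_value_eq. unfold limit_value. fold D A1 A2.
  set (g := k * D^3) in *.
  assert (0 <= Rm e * (1 - A2)) by (apply Rmult_le_pos; lra).
  assert (0 <= g * Rm e * (A1 + Rm e)) by (apply Rmult_le_pos; [apply Rmult_le_pos|]; lra). lra.
Qed.

Lemma mixed_value_cv : Un_cv (mixed_value h k) (limit_value h k).
Proof.
  intros eps He. destruct values_numeric as (Hk & Hh & HD & HD2 & HA1 & HA2 & HG & Hg).
  destruct (pow_lt_1_zero D) with (y := eps) as [N HN]; [rewrite Rabs_pos_eq; lra|lra|].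
  exists N. intros n Hn. pose proof (mixed_value_gt n). pose proof (mixed_value_le n).
  destruct (Rm_bounds n) as [B B'].
  specialize (HN (4 * n)%nat ltac:(lia)). rewrite Rabs_pos_eq in HN by (apply pow_le; lra).
  assert (P0 : 0 <= D ^ (4 * n)) by (apply pow_le; lra).
  assert (21/10 * D * D ^ (4 * n) <= 1 * D ^ (4 * n)) by (apply Rmult_le_compat_r; lra).
  unfold Rdist. rewrite Rabs_pos_eq; lra.
Qed.

Lemma doubles_value_eq : doubles_value h k = A1 * (A2 + k * D * Gam).
Proof. unfold doubles_value, phi, Gam, A1, A2. fold D. ring. Qed.

Lemma doubles_value_gt : limit_value h k < doubles_value h k.
Proof.
  destruct values_numeric as (Hk & Hh & HD & HD2 & HA1 & HA2 & HG & Hg).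
  rewrite doubles_value_eq. unfold limit_value. fold D A1 A2. apply Rmult_lt_compat_l; [lra|].
  assert (0 < k * D * Gam) by (apply Rmult_lt_0_compat; [apply Rmult_lt_0_compat|]; lra). lra.
Qed.

(** Over the common value [A1 A2], alternating signs gain at least [Gam / 2], blocks at most
    [k D Gam]. *)
Lemma doubles_le_mixed : doubles_value h k <= mixed_value h k 0.
Proof.
  destruct values_numeric as (Hk & Hh & HD & HD2 & HA1 & HA2 & HG & Hg).
  rewrite doubles_value_eq, mixed_value_eq. pose proof (Rm_eq 0) as E. destruct (Rm_bounds 0) as [B _].
  simpl pow in E. rewrite !Rmult_1_l in E.
  assert (Gam <= Rm 0).
  { assert (0 <= Rm 0 * (D * D)) by (apply Rmult_le_pos; [lra|apply Rmult_le_pos; lra]). lra. }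
  set (g := k * D^3) in *.
  assert (g * (A1 + Rm 0) <= 1/1000 * 2) by (apply Rmult_le_compat; lra).
  assert (Gam * (50/100) <= Rm 0 * (A2 - g * (A1 + Rm 0))) by (apply Rmult_le_compat; lra).
  assert (A1 * (k * D * Gam) <= 1 * (k * D * Gam)).
  { apply Rmult_le_compat_r; [apply Rmult_le_pos; [apply Rmult_le_pos|]; lra|lra]. }
  assert (k * D * Gam <= 1/10 * Gam).
  { apply Rmult_le_compat_r; [lra|]. assert (k * D <= 1 * D) by (apply Rmult_le_compat_r; lra). lra. }
  lra.
Qed.

Lemma mixed_value_0 : mixed_value h k 0 = alternating_value h k.
Proof.
  destruct values_numeric as (Hk & Hh & HD & HD2 & HA1 & HA2 & HG & Hg).
  unfold mixed_value, phi. rewrite wp0. fold D.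
  change (wp h k 0 (2 * 0)) with (wp h k 0 0). rewrite wp0. fold D.
  pose proof (wz_eq D 0 HD) as E. simpl pow in E.
  assert (E1 : wz D 0 = / (1 + D)).
  { apply (Rmult_eq_reg_r (1 - D * (D * 1))).
    - transitivity (1 - D); [lra|field; lra].
    - assert (D * D <= 1/10 * D) by (apply Rmult_le_compat_r; lra). lra. }
  rewrite E1. unfold alternating_value. fold D. field. lra.
Qed.
End Values.

Lemma limit_value_pos h k : adm h k -> 0 < limit_value h k.
Proof. intros A. pose proof (crude_bound_le_limit h k A). pose proof (crude_bound_lower h k A). lra. Qed.

(** * Points of periodic words as fixed points *)

Lemma infinite_sum_tail (f u : nat -> R) (D C : R) : 0 <= D < 1 ->
  (forall i, f i = u i + D * f (S i)) -> (forall i, Rabs (f i) <= C) ->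
  infinite_sum (fun i => u i * D ^ i) (f 0%nat).
Proof.
  intros HD Hf HC.
  assert (E : forall n, sum_f_R0 (fun i => u i * D ^ i) n = f 0%nat - D ^ S n * f (S n)).
  { induction n as [|n IH].
    - simpl. rewrite (Hf 0%nat). ring.
    - simpl sum_f_R0. rewrite IH, (Hf (S n)). simpl. ring. }
  intros eps He. assert (C0 : 0 <= C) by (eapply Rle_trans; [apply Rabs_pos|apply (HC 0%nat)]).
  destruct (pow_lt_1_zero D) with (y := eps / (C + 1)) as [N HN]; [rewrite Rabs_pos_eq; lra|apply Rdiv_lt_0_compat; lra|].
  exists N. intros n Hn. rewrite E. unfold Rdist.
  replace (f 0%nat - D ^ S n * f (S n) - f 0%nat) with (- (D ^ S n * f (S n))) by ring.
  rewrite Rabs_Ropp, Rabs_mult. specialize (HN (S n) ltac:(lia)).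
  apply Rle_lt_trans with (eps / (C + 1) * C).
  - apply Rmult_le_compat; try apply Rabs_pos; [lra|apply HC].
  - apply Rlt_le_trans with (eps / (C + 1) * (C + 1)); [|right; field; lra].
    apply Rmult_lt_compat_l; [apply Rdiv_lt_0_compat; lra|lra].
Qed.

Lemma gamma_blocks_eq a b blk g :
  infinite_sum (fun i => (IZR (fst (blk i)) * eta a b + IZR (snd (blk i)) * Dc a b) * Dc a b ^ i) g ->
  gamma_blocks a b blk = g.
Proof.
  intros H. unfold gamma_blocks.
  apply (uniqueness_sum _ _ _ (epsilon_spec (inhabits 0) _ (ex_intro _ g H)) H).
Qed.

Definition eval_word (h D : R) (P : list (Z * Z)) (x : R) : R :=
  fold_right (fun c t => IZR (fst c) * h + IZR (snd c) * D + D * t) x P.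

Lemma eval_word_cons h D c P x :
  eval_word h D (c :: P) x = IZR (fst c) * h + IZR (snd c) * D + D * eval_word h D P x.
Proof. reflexivity. Qed.

(** The remainder of the series after [i] blocks is the rest of the current period evaluated at [x];
    the fixed-point hypothesis joins one period to the next. *)
Lemma gamma_word_eq a b P x : 0 <= Dc a b < 1 -> P <> nil ->
  eval_word (eta a b) (Dc a b) P x = x -> gamma_word a b P = x.
Proof.
  intros HD HP Hx. set (h := eta a b) in *. set (D := Dc a b) in *. set (n := length P).
  assert (Hn : (0 < n)%nat) by (destruct P; [congruence|simpl in n; lia]).
  set (f := fun i => eval_word h D (skipn (i mod n) P) x).
  assert (F0 : f 0%nat = x).
  { unfold f. rewrite Nat.Div0.mod_0_l. exact Hx. }
  assert (Sk : forall j, (j < n)%nat -> skipn j P = nth j P (0%Z, 0%Z) :: skipn (S j) P).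
  { unfold n. clear. induction P as [|c P IH]; intros j Hj; simpl in Hj; [lia|].
    destruct j as [|j]; [reflexivity|]. simpl. apply IH. lia. }
  unfold gamma_word. rewrite <- F0. apply gamma_blocks_eq. fold h D n.
  assert (Bd : exists C, forall j, (j <= n)%nat -> Rabs (eval_word h D (skipn j P) x) <= C).
  { generalize n. clear. induction n as [|n [C IH]].
    - exists (Rabs (eval_word h D (skipn 0 P) x)). intros j Hj. replace j with 0%nat by lia. apply Rle_refl.
    - exists (Rmax C (Rabs (eval_word h D (skipn (S n) P) x))). intros j Hj.
      destruct (Nat.eq_dec j (S n)) as [->|Ne]; [apply Rmax_r|].
      eapply Rle_trans; [apply IH; lia|apply Rmax_l]. }
  destruct Bd as [C HC].
  apply (infinite_sum_tail f (fun i => IZR (fst (nth (i mod n) P (0%Z, 0%Z))) * h + IZR (snd (nth (i mod n) P (0%Z, 0%Z))) * D) D C HD).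
  - intros i. pose proof (Nat.mod_upper_bound i n ltac:(lia)) as Hi.
    unfold f at 1. rewrite (Sk _ Hi), eval_word_cons. f_equal. f_equal. unfold f.
    assert (Sm : S i mod n = if Nat.eq_dec (S (i mod n)) n then 0%nat else S (i mod n)).
    { rewrite (Nat.div_mod_eq i n) at 1. rewrite <- Nat.add_succ_r, Nat.add_comm, Nat.mul_comm.
      rewrite Nat.Div0.mod_add. destruct (Nat.eq_dec (S (i mod n)) n) as [->|Ne]; [apply Nat.Div0.mod_same|].
      apply Nat.mod_small. lia. }
    rewrite Sm. destruct (Nat.eq_dec (S (i mod n)) n) as [E|Ne]; [|reflexivity].
    rewrite E. unfold n. rewrite skipn_all, skipn_O. symmetry; exact Hx.
  - intros i. apply HC. pose proof (Nat.mod_upper_bound i n ltac:(lia)). lia.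
Qed.

(** * The spectrum *)

(** Both relations follow from [beta = (a / b) eta] and the quadratic equation of [eta]. Taking its
    smaller root gives [a eta < 2], that is [D < 1]. *)
Lemma par_eta a b : (4 <= a)%Z -> Z.Even a -> (a < b)%Z -> Z.Odd b -> par a b (eta a b) (beta a b).
Proof.
  intros H4 He Hlt Ho.
  assert (A4 : 4 <= IZR a) by (apply IZR_le; lia).
  assert (B5 : 5 <= IZR b) by (apply IZR_le; lia).
  set (x := IZR a) in *. set (y := IZR b) in *.
  set (s := sqrt (y ^ 2 - 4 * y / x)).
  assert (xy : 4 * 5 <= x * y) by (apply Rmult_le_compat; lra).
  assert (Hyx : 4 * y / x * x = 4 * y) by (field; lra).
  assert (P1 : 0 < 4 * y / x) by (apply Rdiv_lt_0_compat; lra).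
  assert (P2 : 4 * y / x <= y).
  { apply (Rmult_le_reg_r x); [lra|]. rewrite Hyx. assert (4 * y <= x * y) by (apply Rmult_le_compat_r; lra). lra. }
  assert (y2 : 5 * y <= y ^ 2) by (replace (y ^ 2) with (y * y) by ring; apply Rmult_le_compat_r; lra).
  assert (Ss : s * s = y ^ 2 - 4 * y / x) by (apply sqrt_sqrt; lra).
  assert (S0 : 0 <= s) by apply sqrt_pos.
  assert (Es : sqrt (x ^ 2 - 4 * x / y) = x * s / y).
  { apply sqrt_lem_1.
    - replace (x ^ 2 - 4 * x / y) with (x * x / (y * y) * (y ^ 2 - 4 * y / x)) by (field; lra).
      apply Rmult_le_pos; [|lra]. apply Rmult_le_pos; [apply Rmult_le_pos; lra|].
      left; apply Rinv_0_lt_compat, Rmult_lt_0_compat; lra.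
    - apply Rmult_le_pos; [apply Rmult_le_pos; lra|left; apply Rinv_0_lt_compat; lra].
    - transitivity (x * x / (y * y) * (s * s)); [field; lra|]. rewrite Ss. field. lra. }
  assert (Eh : eta a b = (y - s) / 2) by reflexivity.
  assert (Ek : beta a b = x / y * eta a b).
  { rewrite Eh. unfold beta. fold x y. rewrite Es. field. lra. }
  set (h := eta a b) in *. set (k := beta a b) in *.
  assert (Q : h * h = y * h - y / x).
  { rewrite Eh. transitivity ((y ^ 2 - 2 * y * s + s * s) / 4); [field|]. rewrite Ss. field. lra. }
  assert (Ehk : x * h = 1 + h * k).
  { rewrite Ek. replace (h * (x / y * h)) with (x / y * (h * h)) by ring. rewrite Q. field. lra. }
  assert (Sy : s < y).
  { apply Rnot_le_lt; intro N. assert (y * y <= s * s) by (apply Rmult_le_compat; lra). lra. }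
  assert (Ly : y - 4 / x < s).
  { apply Rnot_le_lt; intro N.
    assert (s * s <= (y - 4 / x) * (y - 4 / x)) by (apply Rmult_le_compat; lra).
    assert (E : (y - 4 / x) * (y - 4 / x) * (x * x) = (x * y) * (x * y) - 8 * (x * y) + 16) by (field; lra).
    assert (E2 : s * s * (x * x) = (x * y) * (x * y) - 4 * (x * y)) by (rewrite Ss; field; lra).
    assert (s * s * (x * x) <= (y - 4 / x) * (y - 4 / x) * (x * x)).
    { apply Rmult_le_compat_r; [apply Rle_0_sqr|assumption]. }
    lra. }
  assert (Hh : 0 < h) by lra.
  assert (Hk : 0 < k).
  { rewrite Ek. apply Rmult_lt_0_compat; [apply Rdiv_lt_0_compat|]; lra. }
  split; try assumption.
  - fold y. rewrite Ek at 1. rewrite <- Ehk. field. lra.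
  - assert (x * h < x * (2 / x)) by (apply Rmult_lt_compat_l; lra).
    replace (x * (2 / x)) with 2 in * by (field; lra). lra.
Qed.

(** * Blocks read as digit pairs *)

Section Words.
Variables (a b : Z) (h k : R).
Hypothesis P : par a b h k.
Let D := h * k.
Definition pt (X : R) : R := (1 - h + X) / 2.

(** Hence [A_1], [A'_1] and [C_3] are the digit pairs (0, 1), (0, -1) and (-2, 3). *)
Lemma block_pt c d T U X : (2 * c = a - 2 + T)%Z -> (2 * d = b - 2 + U)%Z ->
  IZR c * h + IZR d * D + D * pt X = pt (h * (IZR T + k * (IZR U + X))).
Proof.
  intros Hc Hd. apply (f_equal IZR) in Hc, Hd.
  rewrite mult_IZR, plus_IZR, minus_IZR in Hc, Hd.
  replace (IZR T) with (2 * IZR c - IZR a + 2) by lra.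
  replace (IZR U) with (2 * IZR d - IZR b + 2) by lra.
  pose proof (par_a _ _ _ _ P) as E1. pose proof (par_b _ _ _ _ P) as E2.
  assert (E3 : h * (IZR b * k) = h * (1 + h * k)) by (rewrite E2; reflexivity).
  unfold pt, D. lra.
Qed.

Lemma half_exact n m : n = (2 * m)%Z -> (n / 2 = m)%Z.
Proof. intros ->. rewrite Z.mul_comm. apply Z.div_mul. lia. Qed.

Lemma blockA_pt X : IZR (fst (blockA a b 1)) * h + IZR (snd (blockA a b 1)) * D + D * pt X = pt (D * (1 + X)).
Proof.
  destruct P as [_ _ _ [m Hm] _ [n Hn] _ _ _]. simpl.
  rewrite (half_exact (a - 2) (m - 1)), (half_exact (b - 2 + 1) n) by lia.
  rewrite (block_pt (m - 1) n 0 1) by lia. f_equal. unfold D. ring.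
Qed.

Lemma blockA'_pt X : IZR (fst (blockA' a b 1)) * h + IZR (snd (blockA' a b 1)) * D + D * pt X = pt (D * (-1 + X)).
Proof.
  destruct P as [_ _ _ [m Hm] _ [n Hn] _ _ _]. simpl.
  rewrite (half_exact (a - 2) (m - 1)), (half_exact (b - 2 - 1) (n - 1)) by lia.
  rewrite (block_pt (m - 1) (n - 1) 0 (-1)) by lia. f_equal. unfold D. ring.
Qed.

Lemma blockC_pt X : IZR (fst (blockC a b 3)) * h + IZR (snd (blockC a b 3)) * D + D * pt X =
  pt (h * (-2 + k * (3 + X))).
Proof.
  destruct P as [_ _ _ [m Hm] _ [n Hn] _ _ _]. simpl.
  rewrite (half_exact (a - 4) (m - 2)), (half_exact (b - 2 + 3) (n + 1)) by lia.
  apply (block_pt (m - 2) (n + 1) (-2) 3); lia.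
Qed.

Definition quad : list (Z * Z) :=
  blockA' a b 1 :: blockA' a b 1 :: blockA a b 1 :: blockA a b 1 :: nil.

Lemma eval_quads e n : eval_word h D (concat (repeat quad n)) (pt (- (D * wp h k e 0))) =
  pt (- (D * wp h k e (2 * n))).
Proof.
  induction n as [|n IH]; [reflexivity|].
  simpl repeat. simpl concat. rewrite !eval_word_cons.
  replace (eval_word h D (concat (repeat quad n)) (pt (- (D * wp h k e 0)))) with
    (pt (- (D * wp h k e (2 * n)))).
  rewrite !blockA_pt, !blockA'_pt. f_equal.
  replace (2 * S n)%nat with (S (S (2 * n))) by lia. rewrite !wp_S. fold D. ring.
Qed.

Lemma delta_word_eval e :
  eval_word h D (blockA' a b 1 :: blockA a b 1 :: concat (repeat quad e)) (pt (- (D * wp h k e 0))) =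
  pt (- (D * wp h k e 0)).
Proof.
  rewrite !eval_word_cons, eval_quads, blockA_pt, blockA'_pt. f_equal.
  rewrite (wp0_eq a b h k P e) at 1. fold D. ring.
Qed.

Lemma doubles_word_eval :
  eval_word h D (blockA a b 1 :: blockA a b 1 :: blockA' a b 1 :: blockA' a b 1 :: nil) (pt (D * ws D)) =
  pt (D * ws D).
Proof.
  rewrite !eval_word_cons. simpl eval_word. rewrite !blockA'_pt, !blockA_pt. f_equal.
  rewrite (ws_eq D) at 2. rewrite (ws_eq D) at 2. ring.
Qed.

Lemma C_word_eval : eval_word h D (blockC a b 3 :: nil) (pt (xC h k)) = pt (xC h k).
Proof.
  rewrite eval_word_cons. simpl eval_word. rewrite blockC_pt. f_equal.
  pose proof (par_D _ _ _ _ P). unfold xC. field. lra.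
Qed.

End Words.

(** * The spectrum above its limit point *)

Section Spectrum.
Variables (a b : Z).
Hypothesis H4 : (4 <= a)%Z.
Hypothesis Ha : Z.Even a.
Hypothesis Hab : (a < b)%Z.
Hypothesis Hb : Z.Odd b.
Let h := eta a b.
Let k := beta a b.
Let P : par a b h k := par_eta a b H4 Ha Hab Hb.
Let A : adm h k := par_adm _ _ _ _ P.

Lemma Mstar_liminf X Y L : ~ (exists p q : Z, pt h X = IZR p + IZR q * h) ->
  grid_liminf h k X Y L -> Mstar a b (pt h X) = L.
Proof.
  intros Hn HL. destruct (adm_bounds _ _ A) as (Hk & Hh & Hh' & Hk' & HD & Hd & Hhk).
  unfold Mstar. fold h. change (Dc a b) with (h * k).
  rewrite (M_eq h (pt h X) (L / (4 * (1 - h * k)))).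
  - field. lra.
  - apply (liminf_of_grid h k X Y Hk ltac:(lra) Hn L HL).
Qed.

Lemma value_of_min X Y V : 0 < V -> grid_min h k X Y V ->
  Mstar a b (pt h X) = V /\ Lstar a b V.
Proof.
  intros HV Hm. pose proof (grid_min_nonlattice _ _ _ _ _ HV Hm) as Hn.
  assert (E : Mstar a b (pt h X) = V) by (apply (Mstar_liminf X Y); [exact Hn|apply grid_min_liminf, Hm]).
  split; [exact E|]. exists (pt h X). split; [exact Hn|symmetry; exact E].
Qed.

Lemma Dc_range : 0 <= Dc a b < 1.
Proof. destruct (adm_bounds _ _ A) as (Hk & Hh & Hh' & Hk' & HD & _). change (Dc a b) with (h * k). lra. Qed.

Lemma delta_value e : delta a b e = mixed_value h k e /\ Lstar a b (mixed_value h k e).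
Proof.
  assert (V0 : 0 < mixed_value h k e) by (pose proof (limit_value_pos h k A); pose proof (mixed_value_gt h k A e); lra).
  destruct (value_of_min _ _ _ V0 (mixed_min a b h k P e)) as [E L]. split; [|exact L].
  rewrite <- E. unfold delta. f_equal.
  pose proof (delta_word_eval a b h k P e) as W. rewrite wp0 in W.
  apply gamma_word_eq; [exact Dc_range|discriminate|exact W].
Qed.

Lemma delta_m1_value : delta_m1 a b = doubles_value h k /\ Lstar a b (doubles_value h k).
Proof.
  assert (V0 : 0 < doubles_value h k) by (pose proof (limit_value_pos h k A); pose proof (doubles_value_gt h k A); lra).
  destruct (value_of_min _ _ _ V0 (doubles_min a b h k P)) as [E L]. split; [|exact L].
  rewrite <- E. unfold delta_m1. f_equal.
  apply gamma_word_eq; [exact Dc_range|discriminate|exact (doubles_word_eval a b h k P)].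
Qed.

Lemma delta_m2_value : 0 < C_value h k -> delta_m2 a b = C_value h k /\ Lstar a b (C_value h k).
Proof.
  intros V0.
  destruct (value_of_min _ _ _ V0 (C_min a b h k P)) as [E L]. split; [|exact L].
  rewrite <- E. unfold delta_m2. f_equal.
  apply gamma_word_eq; [exact Dc_range|discriminate|exact (C_word_eval a b h k P)].
Qed.

Lemma delta_inf_eq : delta_inf a b = limit_value h k.
Proof.
  unfold delta_inf, limit_value, ws. change (Dc a b) with (h * k). fold h k.
  assert (0 <= (h * k)^2) by apply pow2_ge_0. field. lra.
Qed.

(** With [rel_2ab], the passage from the ranges of [b] to the hypotheses of the comparison
    lemmas. *)
Lemma rel_ba : (1 + h * k) * (h - k) = IZR (b - a) * (h * k).
Proof. rewrite minus_IZR. pose proof (par_a _ _ _ _ P). pose proof (par_b _ _ _ _ P).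
  replace ((1 + h * k) * (h - k)) with (h * (1 + h * k) - k * (1 + h * k)) by ring.
  replace (h * (1 + h * k)) with (h * (IZR b * k)) by (rewrite H0; reflexivity).
  replace (k * (1 + h * k)) with (k * (IZR a * h)) by (rewrite H; reflexivity). ring.
Qed.

Lemma rel_2ab : (1 + h * k) * (2 * k - h) = IZR (2 * a - b) * (h * k).
Proof. rewrite minus_IZR, mult_IZR. pose proof (par_a _ _ _ _ P). pose proof (par_b _ _ _ _ P).
  replace ((1 + h * k) * (2 * k - h)) with (2 * (k * (1 + h * k)) - h * (1 + h * k)) by ring.
  replace (h * (1 + h * k)) with (h * (IZR b * k)) by (rewrite H0; reflexivity).
  replace (k * (1 + h * k)) with (k * (IZR a * h)) by (rewrite H; reflexivity). ring.
Qed.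

Lemma scale_le n z : (n <= z)%Z -> IZR n * (h * k) <= IZR z * (h * k).
Proof.
  intros H. apply IZR_le in H. destruct (adm_bounds _ _ A) as (Hk & Hh & Hh' & Hk' & HD & _).
  apply Rmult_le_compat_r; lra.
Qed.

Lemma C_value_gt : (a + 3 <= b <= 2 * a - 3)%Z -> limit_value h k < C_value h k.
Proof.
  intros Hr. unfold C_value. apply Rmin_glb_lt; [|apply Rmin_glb_lt].
  - apply c1_gt; [exact A|]. rewrite rel_2ab. apply (scale_le 3). lia.
  - apply c2_gt, A.
  - apply c4_gt; [exact A|]. rewrite rel_ba. apply (scale_le 3). lia.
Qed.

(** Both [b - a] and [2 a - b] are odd, so outside the range one of them is at most 1. *)
Lemma C_value_range : limit_value h k < C_value h k -> (a + 3 <= b <= 2 * a - 3)%Z.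
Proof.
  intros H. destruct (C_value_upper h k _ eq_refl) as [L1 L4].
  pose proof Ha as [m Hm]. pose proof Hb as [n Hn].
  split; apply Z.nlt_ge; intro N.
  - assert (c4 h k <= limit_value h k); [|lra]. apply c4_le; [exact A|].
    rewrite rel_ba. pose proof (scale_le (b - a) 1 ltac:(lia)). lra.
  - assert (c1 h k <= limit_value h k); [|lra]. apply c1_le; [exact A|].
    rewrite rel_2ab. pose proof (scale_le (2 * a - b) 1 ltac:(lia)). lra.
Qed.

Lemma C_value_ge_alternating : (a + 5 <= b <= 2 * a - 5)%Z -> alternating_value h k <= C_value h k.
Proof.
  intros Hr. unfold C_value. apply Rmin_glb; [|apply Rmin_glb].
  - apply c1_ge_alternating; [exact A|]. rewrite rel_2ab. apply (scale_le 5). lia.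
  - apply c2_ge_alternating, A.
  - apply c4_ge_alternating; [exact A|]. rewrite rel_ba. apply (scale_le 5). lia.
Qed.

Lemma C_value_le_alternating : (a + 3 <= b <= 2 * a - 3)%Z -> (b = a + 3 \/ 2 * a - 3 <= b)%Z -> C_value h k <= alternating_value h k.
Proof.
  intros Hr Hc. destruct (C_value_upper h k _ eq_refl) as [L1 L4].
  destruct (adm_bounds _ _ A) as (Hk & Hh & _).
  (* The range [a + 3 <= b <= 2 a - 3] forces [a >= 6] and [b >= 9]. *)
  assert (H6 : 6 * h <= 1 + h * k).
  { rewrite <- (par_a _ _ _ _ P). apply Rmult_le_compat_r; [lra|apply IZR_le; lia]. }
  assert (H9 : 9 * k <= 1 + h * k).
  { rewrite <- (par_b _ _ _ _ P). apply Rmult_le_compat_r; [lra|apply IZR_le; lia]. }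
  destruct Hc as [Hc|Hc].
  - assert (c4 h k <= alternating_value h k); [|lra]. apply c4_le_alternating; try assumption.
    rewrite rel_ba. apply (scale_le _ 3). lia.
  - assert (c1 h k <= alternating_value h k); [|lra]. apply c1_le_alternating; try assumption.
    rewrite rel_2ab. apply (scale_le _ 3). lia.
Qed.

Lemma spectrum_top x : (Lstar a b x /\ limit_value h k < x) <->
  (x = doubles_value h k \/ (exists e, x = mixed_value h k e) \/ ((a + 3 <= b <= 2 * a - 3)%Z /\ x = C_value h k)).
Proof.
  split.
  - intros [(g & Hn & Ex) Hx].
    set (X := 2 * g - 1 + h).
    assert (Eg : g = pt h X) by (unfold pt, X; field).
    (* The choice [Y = 0] is arbitrary; [grid_liminf_Y] later relates it to the past of the periodic
       word. *)
    destruct (grid_liminf_ex a b h k P X 0) as [L HL].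
    assert (E : Mstar a b g = L).
    { rewrite Eg. apply (Mstar_liminf X 0); [|exact HL]. rewrite <- Eg. exact Hn. }
    rewrite E in Ex. subst x.
    destruct (classify a b h k X 0 L P HL Hx) as (X' & Y' & HL' & [->|[[e ->]| ->]]).
    + left. pose proof (grid_min_liminf _ _ _ _ _ (doubles_min a b h k P)) as W.
      apply (grid_liminf_Y _ _ _ _ Y') in W. exact (grid_liminf_unique _ _ _ _ _ _ HL' W).
    + right; left. exists e. pose proof (grid_min_liminf _ _ _ _ _ (mixed_min a b h k P e)) as W.
      apply (grid_liminf_Y _ _ _ _ Y') in W. exact (grid_liminf_unique _ _ _ _ _ _ HL' W).
    + right; right. pose proof (grid_min_liminf _ _ _ _ _ (C_min a b h k P)) as W.
      apply (grid_liminf_Y _ _ _ _ Y') in W.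
      pose proof (grid_liminf_unique _ _ _ _ _ _ HL' W) as EL. rewrite EL in Hx.
      split; [apply C_value_range, Hx|exact EL].
  - intros [->|[[e ->]|[Hr ->]]].
    + split; [apply delta_m1_value|apply doubles_value_gt, A].
    + split; [apply delta_value|apply mixed_value_gt, A].
    + pose proof (C_value_gt Hr). pose proof (limit_value_pos h k A).
      split; [apply delta_m2_value; lra|assumption].
Qed.

Lemma mixed_value_le_alternating e : mixed_value h k e <= alternating_value h k.
Proof.
  rewrite <- (mixed_value_0 h k A). induction e as [|e IH]; [lra|]. pose proof (mixed_value_decr h k A e). lra.
Qed.

Lemma max_of_list m : Lstar a b m -> limit_value h k < m -> alternating_value h k <= m ->
  ((a + 3 <= b <= 2 * a - 3)%Z -> C_value h k <= m) -> is_max (Lstar a b) m.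
Proof.
  intros Lm Hm H0 Hc. split; [exact Lm|]. intros y Hy.
  destruct (Rle_dec y (limit_value h k)) as [Hle|Hgt]; [lra|].
  destruct (proj1 (spectrum_top y) (conj Hy (Rnot_le_lt _ _ Hgt))) as [->|[[e ->]|[Hr ->]]].
  - pose proof (doubles_le_mixed h k A) as V. rewrite (mixed_value_0 h k A) in V. lra.
  - pose proof (mixed_value_le_alternating e). lra.
  - apply Hc, Hr.
Qed.
End Spectrum.

Theorem theorem1 (a b : Z) :
  (4 <= a)%Z -> Z.Even a -> (a < b)%Z -> Z.Odd b ->
  ((b = a + 1 \/ b = a + 3 \/ 2 * a - 3 <= b)%Z -> is_max (Lstar a b) (delta a b 0)) /\
  ((a + 5 <= b <= 2 * a - 5)%Z -> is_max (Lstar a b) (delta_m2 a b)) /\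
  (forall k : nat, delta a b (S k) < delta a b k) /\
  Un_cv (delta a b) (delta_inf a b) /\
  (forall x : R, (Lstar a b x /\ delta_inf a b < x) <->
     (x = delta_m1 a b \/ (exists k : nat, x = delta a b k) \/
      ((a + 3 <= b <= 2 * a - 3)%Z /\ x = delta_m2 a b))).
Proof.
  intros H4 Ha Hab Hb.
  pose proof (par_adm _ _ _ _ (par_eta a b H4 Ha Hab Hb)) as A.
  set (h := eta a b) in *. set (k := beta a b) in *.
  pose proof (delta_value a b H4 Ha Hab Hb) as Ed. fold h k in Ed.
  destruct (delta_m1_value a b H4 Ha Hab Hb) as [E1 _]. fold h k in E1.
  pose proof (delta_m2_value a b H4 Ha Hab Hb) as E2. fold h k in E2.
  pose proof (delta_inf_eq a b) as Ei. fold h k in Ei.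
  pose proof (limit_value_pos h k A) as C0.
  pose proof (C_value_gt a b H4 Ha Hab Hb) as Vg. fold h k in Vg.
  assert (Spec : forall x, (Lstar a b x /\ delta_inf a b < x) <->
     (x = delta_m1 a b \/ (exists k : nat, x = delta a b k) \/
      ((a + 3 <= b <= 2 * a - 3)%Z /\ x = delta_m2 a b))).
  { intros x. rewrite Ei, E1. unfold h, k. rewrite (spectrum_top a b H4 Ha Hab Hb x). fold h k.
    split; (intros [G|[[e G]|[Hr G]]]; [left; exact G|right; left; exists e|right; right; split; [exact Hr|]]).
    - rewrite (proj1 (Ed e)). exact G.
    - rewrite (proj1 (E2 ltac:(specialize (Vg Hr); lra))). exact G.
    - rewrite <- (proj1 (Ed e)). exact G.
    - rewrite <- (proj1 (E2 ltac:(specialize (Vg Hr); lra))). exact G. }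
  split; [|split; [|split; [|split; [|exact Spec]]]].
  - intros Hc. rewrite (proj1 (Ed 0%nat)).
    apply (max_of_list a b H4 Ha Hab Hb); fold h k; [apply Ed|apply mixed_value_gt, A|right; symmetry; apply mixed_value_0, A|].
    intros Hr. rewrite (mixed_value_0 h k A). apply (C_value_le_alternating a b H4 Ha Hab Hb Hr). lia.
  - intros Hr. assert (Vg' : limit_value h k < C_value h k) by (apply Vg; lia).
    destruct (E2 ltac:(lra)) as [E3 L3]. rewrite E3.
    apply (max_of_list a b H4 Ha Hab Hb); fold h k; [exact L3|exact Vg'|apply (C_value_ge_alternating a b H4 Ha Hab Hb Hr)|].
    intros _. apply Rle_refl.
  - intros e. rewrite !(proj1 (Ed _)). apply mixed_value_decr, A.
  - rewrite Ei. intros eps He. destruct (mixed_value_cv h k A eps He) as [N HN].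
    exists N. intros n Hn. rewrite (proj1 (Ed n)). apply HN, Hn.
Qed.
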